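(* Let $n\ge 1$, let $f$ be a transcendental entire function on $\mathbb{C}^n$, and let $b\in\mathbb{C}\setminus\{0\}$. Suppose that (i) for every $i=1,2,\ldots,n$: $\partial_{z_i}(f)=0\Rightarrow f=0$; (ii) for every $i=1,2,\ldots,n$: $f=b\rightleftharpoons \partial_{z_i}(f)=b$. Then one of the following cases must occur: (1) $f(z)=c\,e^{z_1+z_2+\cdots+z_n}$, where $c\in\mathbb{C}$ is a non-zero constant; (2) $f(z)=\frac{c}{A}\,e^{A(z_1+z_2+\cdots+z_n)}+b-\frac{b}{A}$, where $A$ and $c$ are non-zero constants in $\mathbb{C}$.
   Context: Write $z=(z_1,\ldots,z_n)\in\mathbb{C}^n$ and $\partial_{z_i}(f)=\partial f/\partial z_i$. An entire function on $\mathbb{C}^n$ is a function holomorphic on all of $\mathbb{C}^n$; it is transcendental if it is not a polynomial. For functions $f,g$ and $a\in\mathbb{C}$, the notation $f=a\Rightarrow g=a$ means that $g(z)=a$ at every point $z$ with $f(z)=a$. The notation $f=a\rightleftharpoons g=a$ (sharing $a$ counting multiplicities, CM) means that $f-a$ and $g-a$ have the same zeros with the same multiplicities. Here the zero multiplicity at a point $p$ of a holomorphic function $h\not\equiv 0$ is the degree of the lowest-degree non-vanishing homogeneous polynomial in the expansion of $h$ in homogeneous polynomials in $z-p$ around $p$. *)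

(* Defs.v *)
From mathcomp Require Import all_boot all_order all_algebra.
(* The notations of mpoly clash with those of mathcomp-analysis. *)
From mathcomp Require Import -(notations) mpoly.
From mathcomp Require Import all_classical all_reals all_analysis.
From mathcomp Require Import complex.

Set Implicit Arguments.
Unset Strict Implicit.
Unset Printing Implicit Defensive.

Import Order.TTheory GRing.Theory Num.Theory.
Import numFieldNormedType.Exports.

Local Open Scope classical_set_scope.
Local Open Scope ring_scope.
Local Open Scope complex_scope.

(* The topology and norm of a numFieldType are inferred from its structure
   projection, not from the bare carrier [complex R]; packing R[i] as a
   numClosedFieldType makes them available on [CC R] and on ['rV[CC R]_n]. *)
Definition CC (R : realType) : numClosedFieldType := R[i].

Definition cexp (R : realType) (z : CC R) : CC R :=
  (expR (complex.Re z) * cos (complex.Im z))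
    +i* (expR (complex.Re z) * sin (complex.Im z)).

Section Entire.
Variables (R : realType) (n : nat).
Implicit Types (f g h : 'rV[CC R]_n -> CC R) (p z : 'rV[CC R]_n).

(* [differentiable] over the field [CC R] is complex Frechet differentiability. *)
Definition entire f : Prop := forall z, differentiable f z.

Definition mpoly_eval (P : mpoly n (CC R)) z : CC R :=
  meval (fun i : 'I_n => z 0 i) P.

Definition transcendental f : Prop :=
  ~ exists P : mpoly n (CC R), forall z, f z = mpoly_eval P z.

Definition partial (i : 'I_n) f : 'rV[CC R]_n -> CC R :=
  fun z => 'D_(delta_mx 0 i) f z.

Definition homogeneous_expansion h p (P : nat -> mpoly n (CC R)) : Prop :=
  (forall k, P k \is ishomog1 k mdeg) /\
  \forall z \near p,
    series (fun k => mpoly_eval (P k) (z - p)) @ \oo --> h z.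

(* A relation rather than a function, so that a germ vanishing identically has
   no multiplicity; the expansion P of a holomorphic h at p is unique. *)
Definition zero_multiplicity h p (m : nat) : Prop :=
  exists P : nat -> mpoly n (CC R),
    [/\ homogeneous_expansion h p P,
        P m != 0
      & forall k, (k < m)%N -> P k = 0].

Definition share_CM f g (a : CC R) : Prop :=
  (forall z, f z = a <-> g z = a) /\
  (forall z, f z = a -> forall m : nat,
    zero_multiplicity (fun w => f w - a) z m <->
    zero_multiplicity (fun w => g w - a) z m).

End Entire.

(* Main.v *)
Require Import Defs.
From mathcomp Require Import all_boot all_order all_algebra.
From mathcomp Require Import -(notations) mpoly.
From mathcomp Require Import all_classical all_reals all_analysis.
From mathcomp Require Import complex zify ring lra.
Import Order.TTheory GRing.Theory Num.Theory.
Import numFieldNormedType.Exports.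
Local Open Scope classical_set_scope.
Local Open Scope ring_scope.
Set Implicit Arguments. Unset Strict Implicit. Unset Printing Implicit Defensive.

(** The solution [F] has the order of the exponential of a primitive of [phi], out of scale with
    [phi]; [Y] serves to eliminate it. Indeed [F' = phi F + b] gives
    [Y = lam b (phi - 1) / (phi F')], and the logarithmic derivative of this identity is an equation
    in [phi], [lam] and [Y] alone. On good circles it forces [Y] to follow [phi] where [phi] is
    large; subtracting the two leading terms of [Y] and multiplying by [lam phi] leaves an entire
    function [E], which turns out to be small, and it is [E] that enters the coefficients of the
    quadratic.

    The growth of [phi], [1 / phi] and [Y] is measured against [2 ^ 2 ^ k]. Passing to [k + 1]
    squares the bound, so its logarithm only doubles on a window; the relative widths [1 / k ^ 2]
    are summable, as the growth argument demands, yet cost only powers of [k] in each estimate.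
    Negligible then means at most [2 ^ (k m)].

    The sum of the three coefficients is a product, so their vanishing gives [E = lam' - 2 lam ^ 2]
    or [E = lam' - 3 lam ^ 2]; this is the origin of [j], which is 2 or 3. *)

(* Restrict [f] to a complex line parallel to a coordinate axis and put [F = f - b].
   At the points where [f = b] the partial derivative equals [b], so the zeros of
   [F] have multiplicity one, hence so have those of [pd i f - b]; as these zeros
   fill the level set of [f], the gradient of [pd i f] is there proportional to that
   of [f], and its i-th component does not vanish. On the line, [(F' - b) / F] is
   thus an entire function [phi] without zeros, and [F' = phi F + b].

   The core is that such a [phi] is constant. Let [lam = phi' / phi] and
   [Y = lam (f / f' - 1 / phi)], which is entire because [f' = 0] forces [f = 0]. On
   suitable circles, chosen by a Borel-type growth argument, logarithmic derivatives
   are negligible compared with the growth of [phi], [1 / phi] and [Y]. The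
   differential equation linking [Y] and [phi] then makes [phi] a root of a quadratic
   polynomial whose coefficients are negligible, hence vanish identically; this leads
   to [lam' = j lam ^ 2] with [j > 0] and, by the same growth comparison, to
   [lam = 0].

   So [pd i f - b = A (f - b)] with [A] constant on each line. In the plane of two
   axes these equations integrate explicitly, and comparing the zeros forces all the
   constants [A] to agree, which gives case (2); case (1) is its instance [A = 1]. *)

(** * Complex numbers, continuity and derivatives *)

Section Modulus.
Variable R : realType.
Local Notation C := (CC R).
Implicit Types z w : C.

(** The modulus is taken in the ordered field [R], because the order of [CC R] is only partial. *)
Definition nm z : R := ComplexField.Normc.normc z.
Definition rc (x : R) : C := real_complex R x.
Definition re z : R := complex.Re z.
Definition im z : R := complex.Im z.

Lemma nmE z : nm z = Num.sqrt (re z ^+ 2 + im z ^+ 2).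
Proof. by case: z. Qed.

Lemma nm_sqr z : nm z ^+ 2 = re z ^+ 2 + im z ^+ 2.
Proof. by rewrite nmE sqr_sqrtr // addr_ge0 ?sqr_ge0. Qed.

Lemma rcE z : z = rc (re z) + 'i%C * rc (im z).
Proof. exact: complexE. Qed.

Lemma nm_ge0 z : 0 <= nm z.
Proof. by rewrite nmE sqrtr_ge0. Qed.

Lemma norm_rcE z : `|z| = rc (nm z).
Proof. by case: z. Qed.

Lemma nm0 : nm 0 = 0.
Proof. exact: ComplexField.Normc.normc0. Qed.

Lemma nm1 : nm 1 = 1.
Proof. exact: ComplexField.Normc.normc1. Qed.

Lemma nmD z w : nm (z + w) <= nm z + nm w.
Proof. exact: le_normcD. Qed.

Lemma nmN z : nm (- z) = nm z.
Proof. exact: normcN. Qed.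

Lemma nmM z w : nm (z * w) = nm z * nm w.
Proof. exact: ComplexField.Normc.normcM. Qed.

Lemma nmV z : nm z^-1 = (nm z)^-1.
Proof. exact: ComplexField.Normc.normcV. Qed.

Lemma nmX z n : nm (z ^+ n) = nm z ^+ n.
Proof. by elim: n => [|n IH]; rewrite ?expr0 ?nm1 // !exprS nmM IH. Qed.

Lemma nm_div z w : nm (z / w) = nm z / nm w.
Proof. by rewrite nmM nmV. Qed.

Lemma nmB z w : nm (z - w) <= nm z + nm w.
Proof. by rewrite -(nmN w) nmD. Qed.

Lemma nm_sym z w : nm (z - w) = nm (w - z).
Proof. by rewrite -nmN opprB. Qed.

Lemma nm_eq0 z : nm z = 0 -> z = 0.
Proof. exact: ComplexField.Normc.eq0_normc. Qed.

Lemma nm_eq0E z : (nm z == 0) = (z == 0).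
Proof. by apply/eqP/eqP => [/nm_eq0|->] //; rewrite nm0. Qed.

Lemma nm_gt0 z : (0 < nm z) = (z != 0).
Proof. by rewrite lt_def nm_ge0 andbT nm_eq0E. Qed.

Lemma nm_rc x : nm (rc x) = `|x|.
Proof. by rewrite nmE /= expr0n addr0 sqrtr_sqr. Qed.

Lemma nm_i : nm 'i%C = 1.
Proof. by rewrite nmE /= expr0n expr1n add0r sqrtr1. Qed.

Lemma re_le_nm z : `|re z| <= nm z.
Proof. by rewrite nmE -sqrtr_sqr ler_wsqrtr // lerDl sqr_ge0. Qed.

Lemma im_le_nm z : `|im z| <= nm z.
Proof. by rewrite nmE -sqrtr_sqr ler_wsqrtr // lerDr sqr_ge0. Qed.

Lemma nm_dist z w : `|nm z - nm w| <= nm (z - w).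
Proof.
have h1 := nmD (z - w) w; have h2 := nmD (w - z) z.
rewrite !subrK in h1 h2; rewrite (nm_sym w z) in h2.
rewrite ler_norml; lra.
Qed.

Lemma nm_geB z w : nm z - nm w <= nm (z - w).
Proof. by apply: le_trans (nm_dist _ _); rewrite ler_norm. Qed.

Lemma rcD x y : rc (x + y) = rc x + rc y. Proof. exact: rmorphD. Qed.
Lemma rcB x y : rc (x - y) = rc x - rc y. Proof. exact: rmorphB. Qed.
Lemma rcN x : rc (- x) = - rc x. Proof. exact: rmorphN. Qed.
Lemma rcM x y : rc (x * y) = rc x * rc y. Proof. exact: rmorphM. Qed.
Lemma rcV x : rc x^-1 = (rc x)^-1. Proof. exact: fmorphV. Qed.
Lemma rc0 : rc 0 = 0. Proof. by []. Qed.
Lemma rc1 : rc 1 = 1. Proof. by []. Qed.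
Lemma rcn n : rc n%:R = n%:R. Proof. exact: rmorph_nat. Qed.
Lemma rc_inj : injective rc. Proof. by move=> x y []. Qed.

Lemma reD z w : re (z + w) = re z + re w. Proof. by case: z; case: w. Qed.
Lemma imD z w : im (z + w) = im z + im w. Proof. by case: z; case: w. Qed.
Lemma reN z : re (- z) = - re z. Proof. by case: z. Qed.
Lemma imN z : im (- z) = - im z. Proof. by case: z. Qed.
Lemma reB z w : re (z - w) = re z - re w. Proof. by rewrite reD reN. Qed.
Lemma imB z w : im (z - w) = im z - im w. Proof. by rewrite imD imN. Qed.
Lemma reM z w : re (z * w) = re z * re w - im z * im w.
Proof. by case: z; case: w. Qed.
Lemma imM z w : im (z * w) = re z * im w + im z * re w.
Proof. by case: z => a b; case: w. Qed.
Lemma re_rc x : re (rc x) = x. Proof. by []. Qed.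
Lemma im_rc x : im (rc x) = 0. Proof. by []. Qed.
Lemma re_i : re 'i%C = 0. Proof. by []. Qed.
Lemma im_i : im 'i%C = 1. Proof. by []. Qed.
Lemma C_eq z w : re z = re w -> im z = im w -> z = w.
Proof. by case: z => a b; case: w => c d /= -> ->. Qed.

Definition cj z : C := conjc z.
Lemma cjD z w : cj (z + w) = cj z + cj w. Proof. exact: rmorphD. Qed.
Lemma cjM z w : cj (z * w) = cj z * cj w. Proof. exact: rmorphM. Qed.
Lemma cjN z : cj (- z) = - cj z. Proof. exact: rmorphN. Qed.
Lemma cjK z : cj (cj z) = z. Proof. exact: conjcK. Qed.
Lemma re_cj z : re (cj z) = re z. Proof. by case: z. Qed.
Lemma im_cj z : im (cj z) = - im z. Proof. by case: z. Qed.
Lemma cj_rc x : cj (rc x) = rc x. Proof. exact: conjc_real. Qed.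
Lemma nm_cj z : nm (cj z) = nm z.
Proof. by rewrite !nmE re_cj im_cj sqrrN. Qed.
Lemma mul_cj z : z * cj z = rc (nm z ^+ 2).
Proof.
apply: C_eq; rewrite ?reM ?imM re_cj im_cj ?re_rc ?im_rc ?nm_sqr; ring.
Qed.
Lemma addr_cj z : z + cj z = rc (2 * re z).
Proof. by apply: C_eq; rewrite ?reD ?imD ?re_cj ?im_cj ?re_rc ?im_rc; ring. Qed.

End Modulus.

Section Near.
Variables (R : realType) (D : zmodType) (em : D -> CC R).
Local Notation C := (CC R).
Implicit Types (f g : D -> C) (P Q : D -> Prop) (x h : D).

(* Taking [em] to be [rc] or the identity treats functions of a real and of a
   complex variable at once. *)
Definition nr P := exists2 d : R, 0 < d & forall h, nm (em h) < d -> P h.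
Definition cont f x := forall e : R, 0 < e -> nr (fun h => nm (f (x + h) - f x) < e).
(** The non-strict inequality holds by itself at [h = 0], so no punctured neighbourhood occurs. *)
Definition der f x (d : C) := forall e : R, 0 < e ->
  nr (fun h => nm (f (x + h) - f x - em h * d) <= e * nm (em h)).

Lemma nr_and P Q : nr P -> nr Q -> nr (fun h => P h /\ Q h).
Proof.
move=> [d d0 Pd] [d' d'0 Qd]; exists (Num.min d d'); first by rewrite lt_min d0.
by move=> h; rewrite lt_min => /andP[h1 h2]; split; [exact: Pd|exact: Qd].
Qed.

Lemma nr_mono P Q : (forall h, P h -> Q h) -> nr P -> nr Q.
Proof. by move=> PQ [d d0 Pd]; exists d => // h /Pd /PQ. Qed.

Lemma nr_lt (e : R) : 0 < e -> nr (fun h => nm (em h) < e).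
Proof. by exists e. Qed.

Lemma nr_all P : (forall h, P h) -> nr P.
Proof. by exists 1. Qed.

Lemma cont_const c x : cont (fun=> c) x.
Proof. by move=> e e0; apply: nr_all => h; rewrite subrr nm0. Qed.

Lemma contD f g x : cont f x -> cont g x -> cont (fun y => f y + g y) x.
Proof.
move=> cf cg e e0; have e2 : 0 < e / 2 by lra.
apply: nr_mono (nr_and (cf _ e2) (cg _ e2)) => h [h1 h2].
rewrite opprD addrACA (le_lt_trans (nmD _ _))//; lra.
Qed.

Lemma contN f x : cont f x -> cont (fun y => - f y) x.
Proof. by move=> cf e e0; apply: nr_mono (cf _ e0) => h; rewrite -opprD nmN. Qed.

Lemma contB f g x : cont f x -> cont g x -> cont (fun y => f y - g y) x.
Proof. by move=> cf cg; apply: contD cf (contN cg). Qed.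

Lemma contM f g x : cont f x -> cont g x -> cont (fun y => f y * g y) x.
Proof.
move=> cf cg e e0.
pose K := nm (f x) + nm (g x) + 1.
have K0 : 0 < K by rewrite /K; have := nm_ge0 (f x); have := nm_ge0 (g x); lra.
pose e' := Num.min 1 (e / (2 * K)).
have e'0 : 0 < e' by rewrite /e' lt_min ltr01 divr_gt0 // mulr_gt0.
have e'1 : e' <= 1 by rewrite /e' ge_min lexx.
have e'K : e' * K <= e / 2.
  have : e' <= e / (2 * K) by rewrite /e' ge_min lexx orbT.
  rewrite -(ler_pM2r K0) => /le_trans; apply.
  by have -> : e / (2 * K) * K = e / 2 by field; rewrite gt_eqF.
apply: nr_mono (nr_and (cf _ e'0) (cg _ e'0)) => h [h1 h2].
have -> : f (x + h) * g (x + h) - f x * g x =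
  (f (x + h) - f x) * (g (x + h) - g x) + (f (x + h) - f x) * g x
  + f x * (g (x + h) - g x) by ring.
set A := f (x + h) - f x in h1 *; set B := g (x + h) - g x in h2 *.
apply: le_lt_trans (nmD _ _) _; apply: le_lt_trans (lerD (nmD _ _) (lexx _)) _.
rewrite !nmM.
have a0 := nm_ge0 A; have b0 := nm_ge0 B.
have f0 := nm_ge0 (f x); have g0 := nm_ge0 (g x).
rewrite /K in e'K; nra.
Qed.

Lemma contV f x : f x != 0 -> cont f x -> cont (fun y => (f y)^-1) x.
Proof.
move=> fx0 cf e e0; have n0 : 0 < nm (f x) by rewrite nm_gt0.
set N := nm (f x) in n0.
pose d := Num.min (N / 2) (e * N ^+ 2 / 2).
have d0 : 0 < d by rewrite /d lt_min !divr_gt0 ?mulr_gt0 ?exprn_gt0.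
apply: nr_mono (cf _ d0) => h.
rewrite /d lt_min => /andP[h1 h2].
have h3 : N / 2 < nm (f (x + h)).
  have := nm_geB (f x) (f (x + h)); rewrite (nm_sym (f x)) -/N; lra.
have fh0 : f (x + h) != 0 by rewrite -nm_gt0; lra.
have -> : (f (x + h))^-1 - (f x)^-1 = - ((f (x + h) - f x) / (f (x + h) * f x)).
  by field; rewrite fx0.
rewrite nmN nm_div nmM -/N ltr_pdivrMr; last by rewrite mulr_gt0 //; lra.
apply: lt_le_trans h2 _.
have -> : e * N ^+ 2 / 2 = e * (N / 2 * N) by ring.
by rewrite ler_pM2l // ler_pM2r // ltW.
Qed.

Lemma cont_ext f g x : f =1 g -> cont f x -> cont g x.
Proof. by move=> fg cf e /cf; apply: nr_mono => h; rewrite !fg. Qed.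

Lemma der_ext f g x d : f =1 g -> der f x d -> der g x d.
Proof. by move=> fg cf e /cf; apply: nr_mono => h; rewrite !fg. Qed.

Lemma der_near f g x d : f x = g x -> nr (fun h => f (x + h) = g (x + h)) ->
  der f x d -> der g x d.
Proof.
move=> fgx fg df e e0.
by apply: nr_mono (nr_and fg (df _ e0)) => h [<-]; rewrite fgx.
Qed.

Lemma der_eq f x d d' : d = d' -> der f x d -> der f x d'.
Proof. by move->. Qed.

Lemma der_cont f x d : der f x d -> cont f x.
Proof.
move=> df e e0.
have nd := nm_ge0 d.
have dd0 : 0 < e / (nm d + 2) by rewrite divr_gt0 //; lra.
apply: nr_mono (nr_and (nr_lt dd0) (df _ ltr01)) => h [].
rewrite ltr_pdivlMr; last lra.
move=> h1 h2.
have -> : f (x + h) - f x = (f (x + h) - f x - em h * d) + em h * d by ring.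
apply: le_lt_trans (nmD _ _) _; rewrite nmM.
have := nm_ge0 (em h); nra.
Qed.

Lemma der_const c x : der (fun=> c) x 0.
Proof.
move=> e e0; apply: nr_all => h; rewrite subrr mulr0 subr0 nm0.
by rewrite mulr_ge0 ?nm_ge0 ?ltW.
Qed.

Lemma derD f g x d d' : der f x d -> der g x d' ->
  der (fun y => f y + g y) x (d + d').
Proof.
move=> df dg e e0; have e2 : 0 < e / 2 by lra.
apply: nr_mono (nr_and (df _ e2) (dg _ e2)) => h [h1 h2].
have -> : f (x + h) + g (x + h) - (f x + g x) - em h * (d + d') =
  (f (x + h) - f x - em h * d) + (g (x + h) - g x - em h * d') by ring.
apply: le_trans (nmD _ _) _; lra.
Qed.

Lemma derN f x d : der f x d -> der (fun y => - f y) x (- d).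
Proof.
move=> df e e0; apply: nr_mono (df _ e0) => h.
by rewrite mulrN -!opprD nmN.
Qed.

Lemma derB f g x d d' : der f x d -> der g x d' ->
  der (fun y => f y - g y) x (d - d').
Proof. by move=> df dg; apply: derD df (derN dg). Qed.

Lemma derM f g x d d' : der f x d -> der g x d' ->
  der (fun y => f y * g y) x (d * g x + f x * d').
Proof.
move=> df dg e e0.
have cg := der_cont dg.
pose K := nm (f x) + nm (g x) + nm d + 2.
have fx0 := nm_ge0 (f x); have gx0 := nm_ge0 (g x); have d0 := nm_ge0 d.
have K0 : 0 < K by rewrite /K; lra.
pose e' := e / (3 * K).
have e'0 : 0 < e' by rewrite /e' divr_gt0 // mulr_gt0.
have e'K : e' * K = e / 3 by rewrite /e'; field; rewrite gt_eqF.
have m0 : 0 < Num.min 1 e' by rewrite lt_min ltr01.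
apply: nr_mono (nr_and (nr_and (df _ e'0) (dg _ e'0)) (cg _ m0)) => h [[h1 h2]].
rewrite lt_min => /andP[h3 h4].
have -> : f (x + h) * g (x + h) - f x * g x - em h * (d * g x + f x * d') =
  (f (x + h) - f x - em h * d) * g (x + h) + f x * (g (x + h) - g x - em h * d')
  + em h * d * (g (x + h) - g x) by ring.
apply: le_trans (nmD _ _) _; apply: le_trans (lerD (nmD _ _) (lexx _)) _.
rewrite !nmM.
have h5 : nm (g (x + h)) <= nm (g x) + 1.
  by have := nm_geB (g (x + h)) (g x); lra.
have g1 := nm_ge0 (g (x + h)).
set G := nm (g (x + h)) in h5 g1 *.
set A := nm (_ - em h * d) in h1 *.
set B := nm (_ - em h * d') in h2 *.
set E := nm (_ - g x) in h3 h4 *.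
have A0 : 0 <= A by exact: nm_ge0.
have B0 : 0 <= B by exact: nm_ge0.
have E0 : 0 <= E by exact: nm_ge0.
have H0 := nm_ge0 (em h); set H := nm (em h) in H0 h1 h2 *.
have t1 : A * G <= (e' * H) * K.
  by apply: ler_pM => //; rewrite /K; lra.
have t2 : nm (f x) * B <= K * (e' * H).
  by apply: ler_pM => //; rewrite /K; lra.
have t3 : H * nm d * E <= (H * K) * e'.
  apply: ler_pM => //; [exact: mulr_ge0| |exact: ltW].
  by rewrite ler_wpM2l // /K; lra.
have -> : e * H = 3 * (e' * K) * H by rewrite e'K; field.
nra.
Qed.

Lemma derV f x d : f x != 0 -> der f x d ->
  der (fun y => (f y)^-1) x (- d / f x ^+ 2).
Proof.
move=> fx0 df e e0.
have cV := contV fx0 (der_cont df).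
have N0 : 0 < nm (f x) by rewrite nm_gt0.
set N := nm (f x) in N0.
have d0 := nm_ge0 d.
pose M := N^-1 + 1.
have M0 : 0 < M by rewrite /M addr_gt0 ?invr_gt0.
pose e2 := e * N / (2 * M).
pose e3 := e * N / (2 * (nm d + 1)).
have e20 : 0 < e2 by rewrite /e2 divr_gt0 ?mulr_gt0.
have d1 : 0 < nm d + 1 by lra.
have e30 : 0 < e3 by rewrite /e3 divr_gt0 ?mulr_gt0.
have m0 : 0 < Num.min 1 e3 by rewrite lt_min ltr01.
have cf := der_cont df.
apply: nr_mono (nr_and (cf _ N0) (nr_and (df _ e20) (cV _ m0))) => h [hc [h1]].
rewrite lt_min => /andP[h2 h3].
have fh0 : f (x + h) != 0.
  rewrite -nm_gt0; have := nm_geB (f x) (f (x + h)); rewrite nm_sym -/N; lra.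
have -> : (f (x + h))^-1 - (f x)^-1 - em h * (- d / f x ^+ 2) =
  - ((f (x + h) - f x - em h * d) * (f (x + h))^-1 / f x)
  - em h * d / f x * ((f (x + h))^-1 - (f x)^-1).
  by field; rewrite fx0.
apply: le_trans (nmD _ _) _; rewrite !nmN !nmM (nmV (f x)) -/N.
have h4 : nm (f (x + h))^-1 <= M.
  have := nm_geB (f (x + h))^-1 (f x)^-1; rewrite (nmV (f x)) /M -/N; lra.
set A := nm (_ - em h * d) in h1 *.
set B := nm (f (x + h))^-1 in h4 *.
set E := nm (_ - _) in h2 h3 *.
have A0 : 0 <= A by exact: nm_ge0.
have B0 : 0 <= B by exact: nm_ge0.
have E0 : 0 <= E by exact: nm_ge0.
have H0 := nm_ge0 (em h); set H := nm (em h) in H0 h1 *.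
have Ni : 0 < N^-1 by rewrite invr_gt0.
have t1 : A * B / N <= e / 2 * H.
  have -> : e / 2 * H = (e2 * H) * M / N by rewrite /e2; field; rewrite !gt_eqF.
  by apply: ler_wpM2r; [exact: ltW|exact: ler_pM].
have t2 : H * nm d / N * E <= e / 2 * H.
  have -> : e / 2 * H = (H * (nm d + 1) / N) * e3.
    by rewrite /e3; field; rewrite !gt_eqF.
  apply: ler_pM => //; last exact: ltW.
    by rewrite !mulr_ge0 // ltW.
  by apply: ler_wpM2r; [exact: ltW|apply: ler_wpM2l => //; lra].
lra.
Qed.

Lemma der_div f g x d d' : g x != 0 -> der f x d -> der g x d' ->
  der (fun y => f y / g y) x ((d * g x - f x * d') / g x ^+ 2).
Proof.
move=> gx0 df dg; apply: der_eq (derM df (derV gx0 dg)).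
by field.
Qed.

Lemma derX f x d n : der f x d -> der (fun y => f y ^+ n) x (n%:R * f x ^+ n.-1 * d).
Proof.
move=> df; elim: n => [|n IH].
  apply: der_eq (der_ext _ (der_const 1 x)); first by rewrite mul0r mul0r.
  by move=> y; rewrite expr0.
apply: der_eq (der_ext _ (derM df IH)); last by move=> y; rewrite exprS.
case: n {IH} => [|n] /=; first by rewrite expr0; ring.
by rewrite exprS -[in RHS]natr1; ring.
Qed.

Lemma derZ c f x d : der f x d -> der (fun y => c * f y) x (c * d).
Proof.
by move=> df; apply: der_eq (derM (der_const c x) df); rewrite mul0r add0r.
Qed.

Lemma der_em x : (forall a b, em (a + b) = em a + em b) -> der em x 1.
Proof.
move=> emD e e0; apply: nr_all => h; rewrite emD mulr1.
have -> : em x + em h - em x - em h = 0 by ring.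
by rewrite nm0 mulr_ge0 ?nm_ge0 // ltW.
Qed.

Lemma cont_em x : (forall a b, em (a + b) = em a + em b) -> cont em x.
Proof. by move=> /(der_em x)/der_cont. Qed.

End Near.

Section Compose.
Variables (R : realType) (D : zmodType) (em : D -> CC R).
Local Notation C := (CC R).
Local Notation idC := (fun z : C => z).

Lemma cont_comp (f : D -> C) (g : C -> C) x :
  cont em f x -> cont idC g (f x) -> cont em (fun y => g (f y)) x.
Proof.
move=> cf cg e e0; have [d d0 gd] := cg _ e0.
apply: nr_mono (cf _ d0) => h fh.
by have := gd _ fh; rewrite [f x + _]addrC subrK.
Qed.

Lemma der_comp (f : D -> C) (g : C -> C) x d d' :
  der em f x d -> der idC g (f x) d' -> der em (fun y => g (f y)) x (d' * d).
Proof.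
move=> df dg e e0.
have nd := nm_ge0 d; have nd' := nm_ge0 d'.
pose e1 := e / (2 * (nm d + 1)); pose e2 := Num.min 1 (e / (2 * (nm d' + 1))).
have e10 : 0 < e1 by rewrite /e1 divr_gt0 //; lra.
have e20 : 0 < e2 by rewrite /e2 lt_min ltr01 divr_gt0 //; lra.
have [dl dl0 gd] := dg _ e10.
apply: nr_mono (nr_and (der_cont df dl0) (df _ e20)) => h [h1 h2].
have := gd _ h1; rewrite [f x + _]addrC subrK.
set k := f (x + h) - f x in h1 h2 *; move=> h3.
have -> : g (f (x + h)) - g (f x) - em h * (d' * d) =
  (g (f (x + h)) - g (f x) - k * d') + (k - em h * d) * d' by ring.
apply: le_trans (nmD _ _) _; rewrite nmM.
have hk : nm k <= (nm d + 1) * nm (em h).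
  have -> : k = (k - em h * d) + em h * d by ring.
  apply: le_trans (nmD _ _) _; rewrite nmM.
  have : e2 <= 1 by rewrite /e2 ge_min lexx.
  have := nm_ge0 (em h); nra.
have t1 : e1 * nm k <= e / 2 * nm (em h).
  have -> : e / 2 * nm (em h) = e1 * ((nm d + 1) * nm (em h)).
    by rewrite /e1; field; rewrite gt_eqF //; lra.
  by rewrite ler_wpM2l // ltW.
have t2 : nm (k - em h * d) * nm d' <= e / 2 * nm (em h).
  have e2' : e2 <= e / (2 * (nm d' + 1)) by rewrite /e2 ge_min lexx orbT.
  have -> : e / 2 * nm (em h) = (e / (2 * (nm d' + 1)) * nm (em h)) * (nm d' + 1).
    by field; rewrite gt_eqF //; lra.
  apply: ler_pM; rewrite ?nm_ge0 //; last lra.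
  by apply: le_trans h2 _; rewrite ler_wpM2r ?nm_ge0.
lra.
Qed.

End Compose.

(** * Primitives and the mean value inequality for complex-valued functions *)

Section RealBridge.
Variable R : realType.
Local Notation C := (CC R).

Lemma cont_continuous (g : R -> C) x :
  cont (@rc R) g x -> {for x, continuous (fun t => re (g t))}
    /\ {for x, continuous (fun t => im (g t))}.
Proof.
move=> cg; split; apply/(@cvgrPdist_lt _ R^o) => e e0; have [d d0 gd] := cg _ e0;
  apply/nbhs_ballP; exists d => // t; rewrite /ball /= => xt.
- apply: le_lt_trans (gd (t - x) _).
    by rewrite [x + _]addrC subrK distrC -reB; exact: re_le_nm.
  by rewrite nm_rc distrC.
- apply: le_lt_trans (gd (t - x) _).
    by rewrite [x + _]addrC subrK distrC -imB; exact: im_le_nm.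
  by rewrite nm_rc distrC.
Qed.

Lemma is_derive_eps (G : R -> R) (x d : R) : is_derive x 1 G d <->
  (forall e, 0 < e -> exists2 dl : R, 0 < dl &
    forall h, `|h| < dl -> `|G (x + h) - G x - h * d| <= e * `|h|).
Proof.
split=> [dG e e0|H].
  have /cvgrPdist_lt /(_ _ e0) : (h^-1 *: (G (h *: 1 + x) - G x)) @[h --> 0^'] --> d.
    by have [dd <-] := dG; exact: dd.
  move=> /nbhs_ballP[dl /= dl0 Hd]; exists dl => // h hd.
  have [->|h0] := eqVneq h 0; first by rewrite addr0 subrr mul0r subrr normr0 mulr0.
  have := Hd h; rewrite /ball /= sub0r normrN => /(_ hd h0) => Hh.
  have -> : G (x + h) - G x - h * d = - (h * (d - h^-1 *: (G (h *: 1 + x) - G x))).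
    rewrite /GRing.scale /= mulr1 (addrC h x); field; exact: h0.
  by rewrite normrN normrM mulrC ler_wpM2r // ltW.
have cv : (h^-1 *: (G (h *: 1 + x) - G x)) @[h --> 0^'] --> d.
  apply/cvgrPdist_lt => e e0.
  have e2 : 0 < e / 2 by lra.
  have [dl dl0 Hd] := H _ e2.
  apply/nbhs_ballP; exists dl => //= h; rewrite /ball /= sub0r normrN => hd h0.
  have -> : d - h^-1 *: (G (h *: 1 + x) - G x) = - ((G (x + h) - G x - h * d) / h).
    rewrite /GRing.scale /= mulr1 (addrC h x); field; exact: h0.
  rewrite normrN normrM normfV ltr_pdivrMr ?normr_gt0 //.
  apply: le_lt_trans (Hd _ hd) _.
  by rewrite ltr_pM2r ?normr_gt0 //; lra.
apply: DeriveDef; last by apply: cvg_lim cv; exact: Rhausdorff.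
by apply/cvg_ex; exists d.
Qed.

(** Real functionals of the form [re (u * _)] give access to the real mean value theorem. *)
Lemma der_re (G : R -> C) (x : R) (d u : C) : der (@rc R) G x d ->
  is_derive x 1 (fun t => re (u * G t)) (re (u * d)).
Proof.
move=> dG; apply/is_derive_eps => e e0.
have [dl dl0 H] := derZ u dG e0; exists dl => // h hd.
have := H h; rewrite nm_rc => /(_ hd); apply: le_trans.
apply: le_trans (re_le_nm _).
by rewrite !reB [re (rc h * _)]reM re_rc im_rc mul0r subr0.
Qed.

Lemma prim_real (g : R -> R) (a b : R) : continuous g ->
  exists G : R -> R, forall x : R, a <= x <= b -> is_derive x 1 G (g x).
Proof.
move=> cg; pose mu := @lebesgue_measure R.
(* Starting at [a - 1] makes every point of [[a, b]] interior, end points included. *)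
exists (fun y => (\int[mu]_(t in `[a - 1, y]) g t)%R) => x /andP[ax xb].
have [||||dF FE] := @continuous_FTC1_closed R g (a - 1) x (b + 1).
- lra.
- apply: continuous_compact_integrable; first exact: segment_compact.
  exact: continuous_subspaceT.
- lra.
- exact: cg.
- by split; [exact: dF|rewrite -derive1E].
Qed.

(** Composition with it extends a function continuous on [[a, b]] to the whole line, so that a
    primitive has two-sided derivatives at the end points as well. *)
Definition clamp (a b t : R) := Num.max a (Num.min b t).

Lemma clamp_id a b t : a <= t <= b -> clamp a b t = t.
Proof. by move=> /andP[h1 h2]; rewrite /clamp (min_idPr h2) (max_idPr h1). Qed.

Lemma clamp_in a b t : a <= b -> a <= clamp a b t <= b.
Proof.
move=> ab; rewrite /clamp le_max lexx /= ge_max ab /=.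
by rewrite ge_min lexx.
Qed.

Lemma clamp_lip a b t s : `|clamp a b t - clamp a b s| <= `|t - s|.
Proof.
rewrite /clamp /Num.max /Num.min.
have := ler_norm (t - s); have := ler_norm (s - t); rewrite (distrC s t) => h1 h2.
by rewrite ler_norml; apply/andP; split;
  case: (ltP b t) => bt; case: (ltP b s) => bs;
  case: ltP => ?; case: ltP => ?; lra.
Qed.

Lemma prim_exists (g : R -> C) (a b : R) : (forall x, a <= x <= b -> cont (@rc R) g x) ->
  exists G : R -> C, forall x, a <= x <= b -> der (@rc R) G x (g x).
Proof.
move=> cg; have [ab|ba] := leP a b; last first.
  by exists (fun=> 0) => x; lra.
pose k t := g (clamp a b t).
have ck x : cont (@rc R) k x.
  move=> e e0; have [d d0 H] := cg _ (clamp_in x ab) _ e0.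
  exists d => // h; rewrite nm_rc => hd; rewrite /k.
  have -> : clamp a b (x + h) = clamp a b x + (clamp a b (x + h) - clamp a b x) by ring.
  apply: H; rewrite nm_rc; apply: le_lt_trans hd.
  by apply: le_trans (clamp_lip _ _ _ _) _; rewrite addrAC subrr add0r.
have [G1 H1] : exists G : R -> R, forall x : R, a <= x <= b -> is_derive x 1 G (re (k x)).
  by apply: prim_real => x; have [] := cont_continuous (ck x).
have [G2 H2] : exists G : R -> R, forall x : R, a <= x <= b -> is_derive x 1 G (im (k x)).
  by apply: prim_real => x; have [] := cont_continuous (ck x).
exists (fun t => rc (G1 t) + 'i%C * rc (G2 t)) => x xab e e0.
have e2 : 0 < e / 2 by lra.
have /is_derive_eps /(_ _ e2) [d1 d10 D1] := H1 x xab.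
have /is_derive_eps /(_ _ e2) [d2 d20 D2] := H2 x xab.
exists (Num.min d1 d2); first by rewrite lt_min d10.
move=> h; rewrite nm_rc lt_min => /andP[hd1 hd2].
have -> : g x = rc (re (k x)) + 'i%C * rc (im (k x)).
  by rewrite -rcE /k clamp_id.
have -> : rc (G1 (x + h)) + 'i%C * rc (G2 (x + h)) - (rc (G1 x) + 'i%C * rc (G2 x)) -
  rc h * (rc (re (k x)) + 'i%C * rc (im (k x))) =
  rc (G1 (x + h) - G1 x - h * re (k x)) + 'i%C * rc (G2 (x + h) - G2 x - h * im (k x)).
  by rewrite !rcB !rcM; ring.
apply: le_trans (nmD _ _) _; rewrite nmM nm_i mul1r !nm_rc.
have := D1 _ hd1; have := D2 _ hd2; lra.
Qed.

(** The mean value theorem fails for complex values; it is applied to the real part of [G] times the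
    conjugate of the increment [D], which grows by [nm D ^+ 2]. *)
Lemma prim_bound (G g : R -> C) (a b M : R) : a <= b ->
  (forall x, a <= x <= b -> der (@rc R) G x (g x)) ->
  (forall x, a <= x <= b -> nm (g x) <= M) -> nm (G b - G a) <= M * (b - a).
Proof.
move=> ab dG gM; set D := G b - G a.
have [->|D0] := eqVneq D 0.
  rewrite nm0 mulr_ge0 ?subr_ge0 //.
  by apply: le_trans (gM a _); rewrite ?nm_ge0 // lexx.
pose u := cj D; pose psi t := re (u * G t).
have dpsi x : a <= x <= b -> is_derive x 1 psi (re (u * g x)).
  by move=> xab; apply: der_re; exact: dG.
have [||c /itvP cab] := @MVT_segment R psi (fun x => re (u * g x)) a b ab.
- by move=> x /itvP xab; apply: dpsi; rewrite !xab.
- apply: derivable_within_continuous => x /itvP xab.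
  by have [|] := dpsi x; first by rewrite !xab.
have -> : psi b - psi a = nm D ^+ 2.
  rewrite /psi -reB -mulrBr -/D /u mulrC mul_cj re_rc; by [].
move=> E.
have : nm D ^+ 2 <= nm D * M * (b - a).
  rewrite E ler_wpM2r ?subr_ge0 //; apply: le_trans (ler_norm _) _.
  apply: le_trans (re_le_nm _) _; rewrite nmM /u nm_cj ler_wpM2l ?nm_ge0 //.
  by apply: gM; rewrite !cab.
by rewrite expr2 -mulrA ler_pM2l // nm_gt0.
Qed.

End RealBridge.

(** * Integrals and Goursat's theorem *)

Section Integral.
Variable R : realType.
Local Notation C := (CC R).
Local Notation cid := (fun z : C => z).
Implicit Types (f g G : R -> C) (a b c M : R).

Definition prim G g a b := forall x, a <= x <= b -> der (@rc R) G x (g x).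
Definition icont g a b := forall x, a <= x <= b -> cont (@rc R) g x.
(** The integral is the increment of a primitive, whichever it is by [IntE]; the rules of
    integration thus become rules of derivation. *)
Definition Int g a b : C :=
  let G := xget (fun=> 0) [set G | prim G g a b] in G b - G a.

Lemma IntE G g a b : a <= b -> prim G g a b -> Int g a b = G b - G a.
Proof.
move=> ab GP; rewrite /Int; case: xgetP => [K _ KP|/(_ G)//].
apply/eqP; rewrite -subr_eq0 -nm_eq0E.
have -> : K b - K a - (G b - G a) = (K b - G b) - (K a - G a) by ring.
have := @prim_bound R (fun x => K x - G x) (fun=> 0) a b 0 ab.
rewrite mul0r => H; rewrite eq_le nm_ge0 andbT; apply: H => x xab.
  by apply: der_eq (derB (KP x xab) (GP x xab)); rewrite subrr.
by rewrite nm0.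
Qed.

Lemma IntP g a b : icont g a b -> exists G, prim G g a b.
Proof. exact: prim_exists. Qed.

Lemma IntD f g a b : a <= b -> icont f a b -> icont g a b ->
  Int (fun x => f x + g x) a b = Int f a b + Int g a b.
Proof.
move=> ab /IntP[F FP] /IntP[G GP].
rewrite (IntE ab FP) (IntE ab GP) (@IntE (fun x => F x + G x)) //; first by ring.
by move=> x xab; apply: derD; [exact: FP|exact: GP].
Qed.

Lemma IntZ (c : C) g a b : a <= b -> icont g a b ->
  Int (fun x => c * g x) a b = c * Int g a b.
Proof.
move=> ab /IntP[G GP]; rewrite (IntE ab GP) (@IntE (fun x => c * G x)) //.
  by ring.
by move=> x xab; apply: derZ; exact: GP.
Qed.

Lemma IntB f g a b : a <= b -> icont f a b -> icont g a b ->
  Int (fun x => f x - g x) a b = Int f a b - Int g a b.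
Proof.
move=> ab /IntP[F FP] /IntP[G GP].
rewrite (IntE ab FP) (IntE ab GP) (@IntE (fun x => F x - G x)) //; first by ring.
by move=> x xab; apply: derB; [exact: FP|exact: GP].
Qed.

Lemma Int_bound g a b M : a <= b -> icont g a b ->
  (forall x, a <= x <= b -> nm (g x) <= M) -> nm (Int g a b) <= M * (b - a).
Proof.
by move=> ab /IntP[G GP] gM; rewrite (IntE ab GP); exact: prim_bound gM.
Qed.

Lemma Int_chasles g a c b : a <= c <= b -> icont g a b ->
  Int g a b = Int g a c + Int g c b.
Proof.
move=> /andP[ac cb] /IntP[G GP]; have ab := le_trans ac cb.
rewrite (IntE ab GP) (@IntE G _ a c) //; last first.
  by move=> x /andP[h1 h2]; apply: GP; rewrite h1 (le_trans h2).
rewrite (@IntE G _ c b) //; first by ring.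
by move=> x /andP[h1 h2]; apply: GP; rewrite h2 (le_trans ac).
Qed.

Lemma Int_const (c : C) a b : a <= b -> Int (fun=> c) a b = rc (b - a) * c.
Proof.
move=> ab; rewrite (@IntE (fun x => rc x * c)) //; first by rewrite rcB mulrBl.
move=> x _; apply: der_eq (derM (der_em _ _) (der_const _ _ _)).
  by rewrite mulr0 addr0 mul1r.
exact: rcD.
Qed.

End Integral.

(** * Bisection of rectangles *)

Section NestedRectangles.
Variable R : realType.

Lemma nested_point (u v : nat -> R) : (forall n, u n <= u n.+1) ->
  (forall n, v n.+1 <= v n) -> (forall n, u n <= v n) ->
  exists x, forall n, u n <= x <= v n.
Proof.
move=> uS vS uv.
have umono m n : (m <= n)%N -> u m <= u n.
  elim: n => [|n IH]; first by rewrite leqn0 => /eqP->.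
  by rewrite leq_eqVlt => /orP[/eqP->//|/IH h]; exact: le_trans h (uS n).
have vmono m n : (m <= n)%N -> v n <= v m.
  elim: n => [|n IH]; first by rewrite leqn0 => /eqP->.
  by rewrite leq_eqVlt => /orP[/eqP->//|/IH h]; exact: le_trans (vS n) h.
have ub m n : u m <= v n.
  have [mn|/ltnW nm] := leqP m n; first exact: le_trans (umono _ _ mn) (uv n).
  exact: le_trans (uv m) (vmono _ _ nm).
have hs : has_sup (range u).
  by split; [exists (u 0%N), 0%N|exists (v 0%N) => _ [n _ <-]].
exists (sup (range u)) => n; apply/andP; split.
  by apply: sup_upper_bound => //; exists n.
by apply: ge_sup; [exists (u 0%N), 0%N|move=> _ [m _ <-]].
Qed.

(* Heine-Borel for rectangles, as an induction principle. *)
Lemma rect_induction (P : R -> R -> R -> R -> Prop) (a b c d : R) :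
  a <= b -> c <= d ->
  (forall s1 s2 t1 t2, a <= s1 -> s1 <= s2 -> s2 <= b -> c <= t1 -> t1 <= t2 -> t2 <= d ->
    let s := (s1 + s2) / 2 in let t := (t1 + t2) / 2 in
    P s1 s t1 t -> P s s2 t1 t -> P s1 s t t2 -> P s s2 t t2 -> P s1 s2 t1 t2) ->
  (forall s t, a <= s <= b -> c <= t <= d -> exists2 e : R, 0 < e &
    forall s1 s2 t1 t2, a <= s1 -> s1 <= s -> s <= s2 -> s2 <= b ->
      c <= t1 -> t1 <= t -> t <= t2 -> t2 <= d ->
      s2 - s1 < e -> t2 - t1 < e -> P s1 s2 t1 t2) ->
  P a b c d.
Proof.
move=> ab cd split loc; apply: contrapT => nP.
pose T : Type := (R * R * R * R)%type.
pose PP (q : T) := P q.1.1.1 q.1.1.2 q.1.2 q.2.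
pose ms (q : T) := (q.1.1.1 + q.1.1.2) / 2.
pose mt (q : T) := (q.1.2 + q.2) / 2.
pose q1 (q : T) : T := (q.1.1.1, ms q, q.1.2, mt q).
pose q2 (q : T) : T := (ms q, q.1.1.2, q.1.2, mt q).
pose q3 (q : T) : T := (q.1.1.1, ms q, mt q, q.2).
pose q4 (q : T) : T := (ms q, q.1.1.2, mt q, q.2).
(* The first quarter on which [P] fails; when the first three satisfy [P], the last one has to
   fail. *)
pose step q := if `[< PP (q1 q) >] then
  if `[< PP (q2 q) >] then if `[< PP (q3 q) >] then q4 q else q3 q else q2 q else q1 q.
pose Q n := iter n step (a, b, c, d).
pose A n := (Q n).1.1.1; pose B n := (Q n).1.1.2.
pose D n := (Q n).1.2; pose E n := (Q n).2.
have stepE q : [\/ step q = q1 q, step q = q2 q, step q = q3 q | step q = q4 q].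
  rewrite /step; case: asboolP => _; last by constructor 1.
  case: asboolP => _; last by constructor 2.
  by case: asboolP => _; [constructor 4|constructor 3].
have mid (x y : R) : x <= y -> x <= (x + y) / 2 /\ (x + y) / 2 <= y.
  by move=> xy; split; lra.
have inv n : [/\ a <= A n, A n <= B n, B n <= b & [/\ c <= D n, D n <= E n, E n <= d & ~ PP (Q n)]].
  elim: n => [|n [h1 h2 h3 [h4 h5 h6 h7]]]; first by split.
  have N : ~ PP (step (Q n)).
    rewrite /step; case: asboolP => // p1; case: asboolP => // p2.
    case: asboolP => // p3 p4; apply: h7.
    exact: split p1 p2 p3 p4.
  rewrite /A /B /D /E /Q iterS -/(Q n).
  move: N; rewrite /A /B /D /E in h1 h2 h3 h4 h5 h6.
  have [m1 m2] := mid _ _ h2; have [n1 n2] := mid _ _ h5.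
  have t1 := le_trans h1 m1; have t2 := le_trans m2 h3.
  have t3 := le_trans h4 n1; have t4 := le_trans n2 h6.
  by case: (stepE (Q n)) => -> N; rewrite /q1 /q2 /q3 /q4 /ms /mt /=.
have mono n : [/\ A n <= A n.+1, B n.+1 <= B n, D n <= D n.+1 & E n.+1 <= E n].
  have [h1 h2 h3 [h4 h5 h6 h7]] := inv n.
  have [m1 m2] := mid _ _ h2; have [n1 n2] := mid _ _ h5.
  rewrite /A /B /D /E /Q iterS -/(Q n) in m1 m2 n1 n2 *.
  by case: (stepE (Q n)) => ->; rewrite /q1 /q2 /q3 /q4 /ms /mt /=; split.
have len n : B n - A n = (b - a) / 2 ^+ n /\ E n - D n = (d - c) / 2 ^+ n.
  elim: n => [|n [IH1 IH2]]; first by rewrite expr0 !divr1.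
  rewrite exprS invfM (mulrC 2^-1) !mulrA -IH1 -IH2.
  rewrite /A /B /D /E /Q iterS -/(Q n).
  by case: (stepE (Q n)) => ->; rewrite /q1 /q2 /q3 /q4 /ms /mt /=; split; field.
have [s Hs] : exists x, forall n, A n <= x <= B n.
  by apply: nested_point => n; [have [] := mono n|have [] := mono n|have [] := inv n].
have [t Ht] : exists x, forall n, D n <= x <= E n.
  apply: nested_point => n; [by have [] := mono n|by have [] := mono n|].
  by have [_ _ _ []] := inv n.
have [e e0 He] := loc s t (Hs 0%N) (Ht 0%N).
have small (l : R) : 0 <= l -> exists n0, forall n, (n0 <= n)%N -> l / 2 ^+ n < e.
  move=> l0; pose k := Num.truncn (l / e); exists k => n kn.
  have le0 : 0 <= l / e by rewrite divr_ge0 // ltW.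
  have hk : l / e < k.+1%:R by have := truncn_itv le0 => /andP[].
  rewrite ltr_pdivrMr ?exprn_gt0 // mulrC -ltr_pdivrMr //.
  apply: lt_le_trans hk _; rewrite -natrX ler_nat.
  by apply: leq_ltn_trans kn _; exact: ltn_expl.
have [n1 H1] := small (b - a) ltac:(lra).
have [n2 H2] := small (d - c) ltac:(lra).
pose n := maxn n1 n2.
have [h1 h2 h3 [h4 h5 h6 h7]] := inv n.
have [l1 l2] := len n.
have /andP[s1 s2] := Hs n; have /andP[t1 t2] := Ht n.
apply: h7; apply: He => //; rewrite -/(A n) -/(B n) -/(D n) -/(E n).
  by rewrite l1 H1 // leq_maxl.
by rewrite l2 H2 // leq_maxr.
Qed.

End NestedRectangles.

Section Goursat.
Variable R : realType.
Local Notation C := (CC R).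
Local Notation idC := (fun z : C => z).
Implicit Types (H : C -> C) (s t : R).

Definition pt s t : C := rc s + 'i%C * rc t.
Definition vside H s t1 t2 := Int (fun t => H (pt s t)) t1 t2.
Definition hside H t s1 s2 := Int (fun s => H (pt s t)) s1 s2.
(** The counterclockwise integral of [H dz] along the boundary; [dz] is ['i dt] on the vertical
    sides. *)
Definition rect H s1 s2 t1 t2 : C :=
  'i%C * (vside H s2 t1 t2 - vside H s1 t1 t2) - (hside H t2 s1 s2 - hside H t1 s1 s2).

Lemma der_pts s t : der (@rc R) (fun s => pt s t) s 1.
Proof.
apply: der_eq (derD (der_em _ (@rcD R)) (der_const _ _ _)); exact: addr0.
Qed.

Lemma der_ptt s t : der (@rc R) (fun t => pt s t) t 'i%C.
Proof.
apply: der_eq (derD (der_const _ _ _) (derZ _ (der_em _ (@rcD R)))).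
by rewrite add0r mulr1.
Qed.

Lemma nm_pt s t : nm (pt s t) <= `|s| + `|t|.
Proof. by apply: le_trans (nmD _ _) _; rewrite nmM nm_i mul1r !nm_rc. Qed.

Lemma ptB s t s' t' : pt s t - pt s' t' = pt (s - s') (t - t').
Proof. by rewrite /pt !rcB; ring. Qed.

Lemma ptE z : z = pt (re z) (im z).
Proof. exact: rcE. Qed.

Definition rcont H s1 s2 t1 t2 := forall s t, s1 <= s <= s2 -> t1 <= t <= t2 ->
  cont idC H (pt s t).

Section Fixed.
Variables (s1 s2 t1 t2 : R).
Hypotheses (s12 : s1 <= s2) (t12 : t1 <= t2).

Lemma icont_v H s : rcont H s1 s2 t1 t2 -> s1 <= s <= s2 ->
  icont (fun t => H (pt s t)) t1 t2.
Proof.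
move=> cH hs t ht; apply: (@cont_comp _ _ (@rc R) (fun t => pt s t) H).
  exact: der_cont (der_ptt _ _).
exact: cH.
Qed.

Lemma icont_h H t : rcont H s1 s2 t1 t2 -> t1 <= t <= t2 ->
  icont (fun s => H (pt s t)) s1 s2.
Proof.
move=> cH ht s hs; apply: (@cont_comp _ _ (@rc R) (fun s => pt s t) H).
  exact: der_cont (der_pts _ _).
exact: cH.
Qed.

Let ls1 : s1 <= s1 <= s2. Proof. by rewrite lexx. Qed.
Let ls2 : s1 <= s2 <= s2. Proof. by rewrite lexx andbT. Qed.
Let lt1 : t1 <= t1 <= t2. Proof. by rewrite lexx. Qed.
Let lt2 : t1 <= t2 <= t2. Proof. by rewrite lexx andbT. Qed.

Lemma rectD H K : rcont H s1 s2 t1 t2 -> rcont K s1 s2 t1 t2 ->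
  rect (fun z => H z + K z) s1 s2 t1 t2 = rect H s1 s2 t1 t2 + rect K s1 s2 t1 t2.
Proof.
move=> cH cK; rewrite /rect /vside /hside !IntD //;
  do ?[by apply: icont_v | by apply: icont_h].
ring.
Qed.

Lemma rect_bound H M : rcont H s1 s2 t1 t2 ->
  (forall s t, s1 <= s <= s2 -> t1 <= t <= t2 -> nm (H (pt s t)) <= M) ->
  nm (rect H s1 s2 t1 t2) <= 2 * M * ((s2 - s1) + (t2 - t1)).
Proof.
move=> cH HM.
have v1 := Int_bound t12 (icont_v cH ls1) (fun t => HM s1 t ls1).
have v2 := Int_bound t12 (icont_v cH ls2) (fun t => HM s2 t ls2).
have h1 := Int_bound s12 (icont_h cH lt1) (fun s hs => HM s t1 hs lt1).
have h2 := Int_bound s12 (icont_h cH lt2) (fun s hs => HM s t2 hs lt2).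
rewrite /rect; apply: le_trans (nmB _ _) _; rewrite nmM nm_i mul1r.
apply: le_trans (lerD (nmB _ _) (nmB _ _)) _.
rewrite /vside /hside; lra.
Qed.

Lemma rect_prim H A : (forall s t, s1 <= s <= s2 -> t1 <= t <= t2 ->
    der idC A (pt s t) (H (pt s t))) -> rcont H s1 s2 t1 t2 ->
  rect H s1 s2 t1 t2 = 0.
Proof.
move=> dA cH.
have hE t : t1 <= t <= t2 -> hside H t s1 s2 = A (pt s2 t) - A (pt s1 t).
  move=> ht; rewrite /hside (@IntE _ (fun s => A (pt s t))) // => s hs.
  by apply: der_eq (der_comp (der_pts _ _) (dA _ _ hs ht)); rewrite mulr1.
have vE s : s1 <= s <= s2 -> 'i%C * vside H s t1 t2 = A (pt s t2) - A (pt s t1).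
  move=> hs; rewrite /vside -IntZ //; last exact: icont_v.
  rewrite (@IntE _ (fun t => A (pt s t))) // => t ht.
  by apply: der_eq (der_comp (der_ptt _ _) (dA _ _ hs ht)); rewrite mulrC.
rewrite /rect mulrBr !vE // !hE //; ring.
Qed.

End Fixed.

Lemma rcont_sub H a b c d s1 s2 t1 t2 : rcont H a b c d ->
  a <= s1 -> s2 <= b -> c <= t1 -> t2 <= d -> rcont H s1 s2 t1 t2.
Proof.
move=> cH h1 h2 h3 h4 s t /andP[h5 h6] /andP[h7 h8]; apply: cH.
  by rewrite (le_trans h1) // (le_trans h6).
by rewrite (le_trans h3) // (le_trans h8).
Qed.

Lemma rect_split H s1 s s2 t1 t t2 : s1 <= s <= s2 -> t1 <= t <= t2 ->
  rcont H s1 s2 t1 t2 ->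
  rect H s1 s2 t1 t2 = rect H s1 s t1 t + rect H s s2 t1 t
    + rect H s1 s t t2 + rect H s s2 t t2.
Proof.
move=> hs ht cH; have /andP[s1s ss2] := hs; have /andP[t1t tt2] := ht.
have s12 := le_trans s1s ss2; have t12 := le_trans t1t tt2.
have v x : s1 <= x <= s2 -> vside H x t1 t2 = vside H x t1 t + vside H x t t2.
  by move=> hx; rewrite /vside (Int_chasles ht) //; exact: icont_v cH hx.
have h y : t1 <= y <= t2 -> hside H y s1 s2 = hside H y s1 s + hside H y s s2.
  by move=> hy; rewrite /hside (Int_chasles hs) //; exact: icont_h cH hy.
rewrite /rect !v ?lexx ?s12 // !h ?lexx ?t12 //; ring.
Qed.

(** A bound by [e] times the squared semi-perimeter is additive under quartering, as each quarter
    has half the semi-perimeter. Around a point it holds because the affine part of [H] has a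
    primitive and the rest is small. Then [e] is arbitrary. *)
Lemma goursat H a b c d : a <= b -> c <= d ->
  (forall s t, a <= s <= b -> c <= t <= d -> exists l, der idC H (pt s t) l) ->
  rect H a b c d = 0.
Proof.
move=> ab cd dH.
have cH : rcont H a b c d by move=> s t hs ht; have [l] := dH s t hs ht; apply: der_cont.
suff main e : 0 < e -> nm (rect H a b c d) <= e * ((b - a) + (d - c)) ^+ 2.
  apply: nm_eq0; apply/eqP; rewrite eq_le nm_ge0 andbT.
  set L := (b - a + (d - c)) ^+ 2 in main.
  have L0 : 0 <= L by rewrite sqr_ge0.
  rewrite leNgt; apply/negP => N0.
  have K0 : 0 < nm (rect H a b c d) / (2 * (L + 1)) by rewrite divr_gt0 //; lra.
  have := main _ K0; apply/negP; rewrite -ltNge.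
  rewrite mulrAC ltr_pdivrMr; last lra.
  by rewrite ltr_pM2l //; lra.
move=> e0.
apply: (@rect_induction R (fun s1 s2 t1 t2 =>
  nm (rect H s1 s2 t1 t2) <= e * ((s2 - s1) + (t2 - t1)) ^+ 2)) => //.
  move=> s1 s2 t1 t2 h1 h2 h3 h4 h5 h6 s t p1 p2 p3 p4.
  have hs : s1 <= s <= s2 by rewrite /s; apply/andP; split; lra.
  have ht : t1 <= t <= t2 by rewrite /t; apply/andP; split; lra.
  rewrite (rect_split hs ht); last exact: rcont_sub cH _ _ _ _.
  apply: le_trans (nmD _ _) _; apply: le_trans (lerD (nmD _ _) (lexx _)) _.
  apply: le_trans (lerD (lerD (nmD _ _) (lexx _)) (lexx _)) _.
  have -> : e * (s2 - s1 + (t2 - t1)) ^+ 2 =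
    e * (s - s1 + (t - t1)) ^+ 2 + e * (s2 - s + (t - t1)) ^+ 2
    + e * (s - s1 + (t2 - t)) ^+ 2 + e * (s2 - s + (t2 - t)) ^+ 2.
    by rewrite /s /t; field.
  lra.
move=> s t hs ht; have [l Hl] := dH s t hs ht.
have e2 : 0 < e / 2 by lra.
have [dl dl0 Hd] := Hl _ e2.
exists (dl / 2); first lra.
move=> s1 s2 t1 t2 as1 s1s ss2 s2b ct1 t1t tt2 t2d hd1 hd2.
have s12 := le_trans s1s ss2; have t12 := le_trans t1t tt2.
pose p := pt s t.
pose aff z : C := H p + (z - p) * l.
pose er z := H z - H p - (z - p) * l.
have caff z : cont idC aff z.
  apply: contD; first exact: cont_const.
  apply: contM; last exact: cont_const.
  by apply: contB; [exact: cont_em|exact: cont_const].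
have cHs : rcont H s1 s2 t1 t2 by exact: rcont_sub cH _ _ _ _.
have cer : rcont er s1 s2 t1 t2.
  move=> x y hx hy; apply: contB; last first.
    apply: contM; last exact: cont_const.
    by apply: contB; [exact: cont_em|exact: cont_const].
  by apply: contB; [exact: cHs|exact: cont_const].
have -> : H = (fun z => aff z + er z).
  by apply/funext => z; rewrite /aff /er; ring.
have cra : rcont aff s1 s2 t1 t2 by move=> x y _ _; exact: caff.
rewrite (rectD s12 t12 cra cer).
have -> : rect aff s1 s2 t1 t2 = 0.
  apply: (@rect_prim s1 s2 t1 t2 s12 t12 aff
    (fun z => H p * z + (z - p) ^+ 2 / 2 * l)) => // x y _ _.
  apply: der_eq (derD (derZ _ (der_em _ _)) (derM (derM (derX _ (derB (der_em _ _) (der_const _ _ _))) (der_const _ _ _)) (der_const _ _ _))) => //.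
  by rewrite /aff /=; field.
rewrite add0r.
apply: le_trans (rect_bound (M := e / 2 * (s2 - s1 + (t2 - t1))) s12 t12 cer _) _; last first.
  by rewrite le_eqVlt; apply/orP; left; apply/eqP; field.
move=> x y /andP[hx1 hx2] /andP[hy1 hy2]; rewrite /er /p.
have np : nm (pt x y - pt s t) <= s2 - s1 + (t2 - t1).
  rewrite ptB; apply: le_trans (nm_pt _ _) _; apply: lerD; rewrite ler_norml; lra.
have := Hd (pt x y - pt s t).
rewrite [pt s t + _]addrC subrK => Hd'.
apply: le_trans (Hd' _) _; first by apply: le_lt_trans np _; lra.
by rewrite ler_wpM2l //; lra.
Qed.

(** By periodicity the horizontal sides cancel in Goursat's theorem. For [H z = g (cexp z)] the
    vertical sides are circles around 0, whence means over circles do not depend on the radius. *)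
Lemma vside_periodic H a b c d : a <= b -> c <= d ->
  (forall s t, a <= s <= b -> c <= t <= d -> exists l, der idC H (pt s t) l) ->
  (forall s, H (pt s c) = H (pt s d)) -> vside H a c d = vside H b c d.
Proof.
move=> ab cd dH per; have := goursat ab cd dH; rewrite /rect.
have -> : hside H c a b = hside H d a b by congr Int; apply/funext => s.
rewrite subrr subr0 => /eqP; rewrite mulf_eq0 subr_eq0 => /orP[|/eqP->//].
by rewrite -nm_eq0E nm_i oner_eq0.
Qed.

End Goursat.

(** * Compactness of a segment *)

Section IntervalCompactness.
Variable R : realType.
Local Notation C := (CC R).

Lemma itv_induction (P : R -> R -> Prop) (c d : R) : c <= d ->
  (forall t1 t t2, c <= t1 -> t1 <= t -> t <= t2 -> t2 <= d ->
    P t1 t -> P t t2 -> P t1 t2) ->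
  (forall t, c <= t <= d -> exists2 e : R, 0 < e &
    forall t1 t2, c <= t1 -> t1 <= t -> t <= t2 -> t2 <= d ->
      t2 - t1 < e -> P t1 t2) ->
  P c d.
Proof.
move=> cd split loc.
apply: (@rect_induction R (fun _ _ t1 t2 => P t1 t2) 0 0 c d) => //.
  move=> s1 s2 t1 t2 _ _ _ h1 h2 h3 s t p1 _ p2 _.
  apply: (split t1 t t2) => //; rewrite /t; lra.
move=> s t _ ht; have [e e0 H] := loc t ht.
by exists e => // s1 s2 t1 t2 _ _ _ _ h1 h2 h3 h4 _; exact: H.
Qed.

Lemma icont_bounded (g : R -> C) (a b : R) : a <= b -> icont g a b ->
  exists2 M : R, 0 < M & forall t, a <= t <= b -> nm (g t) <= M.
Proof.
move=> ab cg.
apply: (@itv_induction (fun t1 t2 => exists2 M : R, 0 < M &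
  forall t, t1 <= t <= t2 -> nm (g t) <= M) a b) => //.
  move=> t1 t t2 _ h1 h2 _ [M M0 HM] [N N0 HN].
  exists (M + N) => [|x /andP[x1 x2]]; first lra.
  have [xt|/ltW tx] := leP x t.
    by have := HM x; rewrite x1 xt => /(_ isT); lra.
  by have := HN x; rewrite x2 tx => /(_ isT); lra.
move=> t ht; have [e e0 He] := cg t ht _ ltr01.
exists e => // t1 t2 _ h1 h2 _ h3; exists (nm (g t) + 1).
  by have := nm_ge0 (g t); lra.
move=> x /andP[x1 x2]; have := He (x - t); rewrite [t + _]addrC subrK nm_rc.
have xt : `|x - t| < e by rewrite ltr_norml; lra.
by move=> /(_ xt) h; have := nm_geB (g x) (g t); lra.
Qed.

Lemma uniform_in_parameter (K : R -> R -> C) (s0 a b : R) : a <= b ->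
  (forall t e, a <= t <= b -> 0 < e -> exists2 d : R, 0 < d &
    forall h k, `|h| < d -> `|k| < d -> nm (K (s0 + h) (t + k) - K s0 t) < e) ->
  forall e, 0 < e -> exists2 d : R, 0 < d & forall h t, `|h| < d -> a <= t <= b ->
    nm (K (s0 + h) t - K s0 t) <= e.
Proof.
move=> ab cK e e0.
apply: (@itv_induction (fun t1 t2 => exists2 d : R, 0 < d & forall h t,
  `|h| < d -> t1 <= t <= t2 -> nm (K (s0 + h) t - K s0 t) <= e) a b) => //.
  move=> t1 t t2 _ _ _ _ [d d0 Hd] [d' d'0 Hd'].
  exists (Num.min d d'); first by rewrite lt_min d0.
  move=> h x; rewrite lt_min => /andP[h1 h2] /andP[x1 x2].
  have [xt|/ltW tx] := leP x t; [apply: Hd|apply: Hd'] => //.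
    by rewrite x1.
  by rewrite tx.
move=> t ht; have e2 : 0 < e / 2 by lra.
have [d d0 Hd] := cK t _ ht e2.
exists d => // t1 t2 _ h1 h2 _ h3; exists d => // h x hd /andP[x1 x2].
have xt : `|x - t| < d by rewrite ltr_norml; lra.
have z0 : `|(0 : R)| < d by rewrite normr0.
have := Hd h _ hd xt; have := Hd 0 _ z0 xt.
rewrite addr0 [t + _]addrC subrK => k1 k2.
have -> : K (s0 + h) x - K s0 x = (K (s0 + h) x - K s0 t) - (K s0 x - K s0 t) by ring.
apply: le_trans (nmB _ _) _; lra.
Qed.

End IntervalCompactness.

(** * The complex exponential *)

Section ComplexExponential.
Variable R : realType.
Local Notation C := (CC R).
Local Notation idC := (fun z : C => z).

Lemma re_iM (z : C) : re ('i%C * z) = - im z.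
Proof. by rewrite reM re_i im_i mul0r mul1r sub0r. Qed.

Lemma im_iM (z : C) : im ('i%C * z) = re z.
Proof. by rewrite imM re_i im_i mul0r mul1r add0r. Qed.

Lemma re_pt (s t : R) : re (pt s t) = s.
Proof. by rewrite reD re_iM im_rc oppr0 addr0. Qed.

Lemma im_pt (s t : R) : im (pt s t) = t.
Proof. by rewrite imD im_iM im_rc add0r. Qed.

Lemma re_cexp (z : C) : re (cexp z) = expR (re z) * cos (im z).
Proof. by []. Qed.

Lemma im_cexp (z : C) : im (cexp z) = expR (re z) * sin (im z).
Proof. by []. Qed.

Lemma cexpD (z w : C) : cexp (z + w) = cexp z * cexp w.
Proof.
by apply: C_eq; rewrite ?reM ?imM ?re_cexp ?im_cexp reD imD expRD ?cosD ?sinD; ring.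
Qed.

Lemma cexp0 : cexp (0 : C) = 1.
Proof. by apply: C_eq; rewrite ?re_cexp ?im_cexp /= expR0 ?cos0 ?sin0 mul1r. Qed.

Lemma nm_cexp (z : C) : nm (cexp z) = expR (re z).
Proof.
rewrite nmE re_cexp im_cexp !exprMn -mulrDr cos2Dsin2 mulr1 sqrtr_sqr.
by rewrite ger0_norm // expR_ge0.
Qed.

Lemma cexp_neq0 (z : C) : cexp z != 0.
Proof. by rewrite -nm_gt0 nm_cexp expR_gt0. Qed.

Lemma cexpN (z : C) : cexp (- z) = (cexp z)^-1.
Proof.
apply: (mulfI (cexp_neq0 z)); rewrite -cexpD subrr cexp0 divff //.
exact: cexp_neq0.
Qed.

Lemma cexp_rc (x : R) : cexp (rc x) = rc (expR x).
Proof. by apply: C_eq; rewrite ?re_cexp ?im_cexp /= ?cos0 ?sin0 ?mulr1 ?mulr0. Qed.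

Lemma cexp_2pi : cexp ('i%C * rc (2 * pi)) = 1 :> C.
Proof.
by apply: C_eq; rewrite ?re_cexp ?im_cexp re_iM im_iM im_rc re_rc oppr0 expR0
  mul1r mulr_natl ?cos2pi ?sin2pi.
Qed.

Lemma cexp_surj (w : C) : w != 0 -> exists z, cexp z = w.
Proof.
move=> w0; have n0 : 0 < nm w by rewrite nm_gt0.
pose c := re w / nm w; pose s := im w / nm w.
have cs : c ^+ 2 + s ^+ 2 = 1.
  rewrite /c /s !expr_div_n -mulrDl -nm_sqr divff // expf_neq0 // gt_eqF //.
have c1 : -1 <= c <= 1.
  rewrite -ler_norml -(@ler_pXn2r _ 2) ?nnegrE ?normr_ge0 // expr1n real_normK ?num_real //.
  by have := sqr_ge0 s; lra.
have hs : sin (acos c) = Num.sqrt (1 - c ^+ 2) by rewrite sin_acos.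
have s2 : Num.sqrt (1 - c ^+ 2) = `|s| by rewrite -cs addrAC subrr add0r sqrtr_sqr.
have [th [Hc Hs]] : exists th, cos th = c /\ sin th = s.
  (* [acos] covers the upper half circle only; a negative sine needs the opposite angle. *)
  have [s0|s0] := leP 0 s.
    by exists (acos c); rewrite acosK // hs s2 ger0_norm.
  exists (- acos c); rewrite cosN sinN acosK // hs s2 ltr0_norm // opprK.
  by [].
exists (pt (ln (nm w)) th).
apply: C_eq; rewrite ?re_cexp ?im_cexp re_pt im_pt lnK ?posrE // ?Hc ?Hs.
  by rewrite /c mulrC divfK // gt_eqF.
by rewrite /s mulrC divfK // gt_eqF.
Qed.

Lemma der_cexp0 : der idC (@cexp R) 0 1.
Proof.
move=> e e0; have e4 : 0 < e / 8 by lra.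
have m0 : 0 < Num.min 1 (e / 8) by rewrite lt_min ltr01.
have [d1 d10 H1] := (is_derive_eps _ _ _).1 (is_derive_expR (0 : R)) _ m0.
have [d2 d20 H2] := (is_derive_eps _ _ _).1 (is_derive_cos (0 : R)) _ m0.
have [d3 d30 H3] := (is_derive_eps _ _ _).1 (is_derive_sin (0 : R)) _ m0.
pose d := Num.min (Num.min d1 d2) (Num.min d3 (Num.min 1 (e / 8))).
have d0 : 0 < d by rewrite /d !lt_min d10 d20 d30 ltr01.
exists d => // h; rewrite /d !lt_min => /andP[/andP[h1 h2] /and3P[h3 h4 h5]].
rewrite add0r cexp0 mulr1.
pose x := re h; pose y := im h.
have xh := re_le_nm h; have yh := im_le_nm h; rewrite -/x -/y in xh yh.
have := H1 x (le_lt_trans xh h1); have := H2 y (le_lt_trans yh h2).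
have := H3 y (le_lt_trans yh h3).
rewrite !add0r expR0 cos0 sin0 oppr0 mulr0 !mulr1 !subr0 ?addr0.
set m := Num.min 1 (e / 8) in m0 *.
have m8 : m <= e / 8 by rewrite /m ge_min lexx orbT.
move=> S Co E.
have x0 := normr_ge0 x; have y0 := normr_ge0 y.
pose W := rc (cos y) + 'i%C * rc (sin y).
have W1 : nm W = 1.
  by rewrite nmE /W re_pt im_pt cos2Dsin2 sqrtr1.
(* Three second-order pieces: the error of [expR], those of [cos] and [sin], and the product of [x]
   and [y]. *)
have -> : cexp h - 1 - h = rc (expR x - 1 - x) * W
   + (1 + rc x) * (rc (cos y - 1) + 'i%C * rc (sin y - y)) + 'i%C * rc x * rc y.
  have -> : cexp h = rc (expR x) * W.
    apply: C_eq; rewrite ?reM ?imM ?re_cexp ?im_cexp -/x -/y /W re_pt im_pt re_rc im_rc; ring.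
  rewrite {1}(rcE h) -/x -/y /W !rcB rc1; ring.
apply: le_trans (nmD _ _) _; apply: le_trans (lerD (nmD _ _) (lexx _)) _.
rewrite !nmM W1 mulr1 nm_i mul1r !nm_rc.
have t2 : nm (rc (cos y - 1) + 'i%C * rc (sin y - y)) <= 2 * (e / 8) * `|y|.
  apply: le_trans (nmD _ _) _; rewrite nmM nm_i mul1r !nm_rc.
  have my : m * `|y| <= e / 8 * `|y| by rewrite ler_wpM2r.
  lra.
have t1 : nm (1 + rc x) <= 2.
  by apply: le_trans (nmD _ _) _; rewrite nm1 nm_rc; lra.
have t3 : nm (1 + rc x) * nm (rc (cos y - 1) + 'i%C * rc (sin y - y)) <=
   2 * (2 * (e / 8) * `|y|) by apply: ler_pM; rewrite ?nm_ge0.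
have t4 : `|x| * `|y| <= (e / 8) * nm h by apply: ler_pM => //; lra.
have t5 : m * `|x| <= e / 8 * nm h by apply: ler_pM => //; lra.
have t6 : e / 8 * `|y| <= e / 8 * nm h by rewrite ler_wpM2l //; lra.
have t7 : 0 <= e * nm h by rewrite mulr_ge0 ?nm_ge0 // ltW.
lra.
Qed.

Lemma der_cexp (z : C) : der idC (@cexp R) z (cexp z).
Proof.
apply: (@der_ext _ _ _ (fun w => cexp z * cexp (w - z))).
  by move=> w; rewrite -cexpD addrC subrK.
apply: der_eq (derZ _ (der_comp (derB (der_em _ _) (der_const _ _ _)) _)) => //.
  by instantiate (1 := 1); rewrite subr0 !mulr1.
by rewrite subrr; exact: der_cexp0.
Qed.

End ComplexExponential.

(** * Cauchy's formula and its consequences *)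

Section CircleMean.
Variable R : realType.
Local Notation C := (CC R).
Local Notation idC := (fun z : C => z).
Implicit Types (f g h : C -> C) (r : R) (z w : C).

Lemma der_id z : der idC idC z 1.
Proof. exact: der_em. Qed.

Lemma der_subc w z : der idC (fun y => y - w) z 1.
Proof. by apply: der_eq (derB (der_id z) (der_const _ w z)); rewrite subr0. Qed.

Definition circ r (t : R) : C := rc r * cexp ('i%C * rc t).
(** The form taken by contour integrals: since [dz = 'i z dt] on a circle around 0, the Cauchy
    integral of [f] at [w] is the mean of [f z * (z / (z - w))]. *)
Definition mean g r : C := (rc (2 * pi))^-1 * Int (fun t => g (circ r t)) 0 (2 * pi).
Definition ccont g r := forall z, nm z = r -> cont idC g z.

Lemma twopi_gt0 : 0 < 2 * pi :> R.
Proof. by rewrite mulr_gt0 ?pi_gt0. Qed.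

Lemma twopi_ge0 : 0 <= 2 * pi :> R.
Proof. exact: ltW twopi_gt0. Qed.

Lemma rc_eq0 (x : R) : (rc x == 0) = (x == 0).
Proof. by apply/eqP/eqP => [/rc_inj|->]. Qed.

Lemma rc2pi_neq0 : rc (2 * pi) != 0 :> C.
Proof. by rewrite rc_eq0 gt_eqF // twopi_gt0. Qed.

Lemma nm_circ r t : 0 <= r -> nm (circ r t) = r.
Proof.
by move=> r0; rewrite nmM nm_rc nm_cexp re_iM im_rc oppr0 expR0 mulr1 ger0_norm.
Qed.

Lemma circ_ln r t : 0 < r -> circ r t = cexp (pt (ln r) t).
Proof. by move=> r0; rewrite /pt cexpD cexp_rc lnK ?posrE. Qed.

Lemma cont_circ r t : cont (@rc R) (circ r) t.
Proof.
apply: contM; first exact: cont_const.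
apply: (@cont_comp _ _ (@rc R) (fun t => 'i%C * rc t) (@cexp R)).
  by apply: contM; [exact: cont_const|apply: cont_em; exact: rcD].
exact: der_cont (der_cexp _).
Qed.

Lemma icont_circ g r : 0 <= r -> ccont g r -> icont (fun t => g (circ r t)) 0 (2 * pi).
Proof.
move=> r0 cg t _; apply: (@cont_comp _ _ (@rc R) (circ r) g); first exact: cont_circ.
by apply: cg; exact: nm_circ.
Qed.

Section Linear.
Variable r : R.
Hypothesis r0 : 0 <= r.

Lemma meanD g h : ccont g r -> ccont h r ->
  mean (fun z => g z + h z) r = mean g r + mean h r.
Proof.
by move=> cg ch; rewrite /mean (IntD twopi_ge0 (icont_circ r0 cg) (icont_circ r0 ch)) mulrDr.
Qed.

Lemma meanB g h : ccont g r -> ccont h r ->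
  mean (fun z => g z - h z) r = mean g r - mean h r.
Proof.
by move=> cg ch; rewrite /mean (IntB twopi_ge0 (icont_circ r0 cg) (icont_circ r0 ch)) mulrBr.
Qed.

Lemma meanZ c g : ccont g r -> mean (fun z => c * g z) r = c * mean g r.
Proof.
by move=> cg; rewrite /mean (IntZ c twopi_ge0 (icont_circ r0 cg)) mulrCA.
Qed.

Lemma mean_cst c : mean (fun=> c) r = c.
Proof.
rewrite /mean Int_const ?twopi_ge0 // subr0 mulrA mulVf ?mul1r //.
exact: rc2pi_neq0.
Qed.

Lemma mean_bound g M : ccont g r -> (forall z, nm z = r -> nm (g z) <= M) ->
  nm (mean g r) <= M.
Proof.
move=> cg gM; rewrite /mean nmM nmV nm_rc ger0_norm ?twopi_ge0 //.
rewrite mulrC ler_pdivrMr ?twopi_gt0 //.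
have := @Int_bound _ _ 0 (2 * pi) M twopi_ge0 (icont_circ r0 cg).
by rewrite subr0; apply => t _; apply: gM; exact: nm_circ.
Qed.

Lemma mean_ext g h : (forall z, nm z = r -> g z = h z) -> mean g r = mean h r.
Proof.
by move=> gh; congr (_ * Int _ _ _); apply/funext => t; apply: gh; exact: nm_circ.
Qed.

Lemma ccontB g h : ccont g r -> ccont h r -> ccont (fun z => g z - h z) r.
Proof. by move=> cg ch z hz; apply: contB; [exact: cg|exact: ch]. Qed.

Lemma ccontM g h : ccont g r -> ccont h r -> ccont (fun z => g z * h z) r.
Proof. by move=> cg ch z hz; apply: contM; [exact: cg|exact: ch]. Qed.

Lemma ccont_cst c : ccont (fun=> c) r.
Proof. by move=> z _; exact: cont_const. Qed.

Lemma ccont_id : ccont idC r.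
Proof. by move=> z _; exact: cont_em. Qed.

Lemma ccontV g : (forall z, nm z = r -> g z != 0) -> ccont g r ->
  ccont (fun z => (g z)^-1) r.
Proof. by move=> g0 cg z hz; apply: contV; [exact: g0|exact: cg]. Qed.

Lemma ccontX g n : ccont g r -> ccont (fun z => g z ^+ n) r.
Proof.
move=> cg; elim: n => [|n IH] z hz.
  by apply: (@cont_ext _ _ _ (fun=> 1)) => [y|]; rewrite ?expr0 //; exact: cont_const.
apply: (@cont_ext _ _ _ (fun y => g y * g y ^+ n)) => [y|]; first by rewrite exprS.
by apply: contM; [exact: cg|exact: IH].
Qed.

Lemma ccont_bounded g : ccont g r ->
  exists2 M : R, 0 < M & forall z, nm z = r -> nm (g z) <= M.
Proof.
move=> cg.
have [M M0 HM] := icont_bounded twopi_ge0 (icont_circ r0 cg).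
exists M => // z hz; have [z0|z0] := eqVneq z 0.
  move: hz; rewrite z0 nm0 => r00.
  by have := HM 0; rewrite lexx twopi_ge0 /circ -r00 mul0r => /(_ isT).
have [v Ev] := cexp_surj z0.
have rz : expR (re v) = r by rewrite -nm_cexp Ev.
pose k := Num.floor (im v / (2 * pi)).
have p0 := twopi_gt0; have pn0 : 2 * pi != 0 :> R by rewrite gt_eqF.
pose t := im v - k%:~R * (2 * pi).
have tin : 0 <= t <= 2 * pi.
  have /andP[] := floor_itv (im v / (2 * pi)).
  rewrite -/k rmorphD /= ler_pdivlMr // ltr_pdivrMr // /t => h1 h2.
  apply/andP; split; lra.
have per (j : nat) : cexp ('i%C * rc (j%:R * (2 * pi))) = 1 :> C.
  elim: j => [|j IH]; first by rewrite mul0r rc0 mulr0 cexp0.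
  by rewrite -natr1 mulrDl mul1r rcD mulrDr cexpD IH cexp_2pi mulr1.
have perz : cexp ('i%C * rc (k%:~R * (2 * pi))) = 1 :> C.
  case: k {t tin} => j; first exact: per.
  by rewrite NegzE mulrNz mulNr rcN mulrN cexpN per invr1.
suff -> : z = circ r t by exact: HM.
rewrite -Ev [v in LHS]ptE /pt cexpD cexp_rc rz /circ /t; congr (_ * _).
by rewrite rcB mulrBr cexpD cexpN perz invr1 mulr1.
Qed.

End Linear.

Lemma mean_annulus g r1 r2 : 0 < r1 -> r1 <= r2 ->
  (forall z, r1 <= nm z <= r2 -> exists l, der idC g z l) -> mean g r1 = mean g r2.
Proof.
move=> r10 r12 dg; have r20 := lt_le_trans r10 r12.
have E r : 0 < r -> mean g r = (rc (2 * pi))^-1 * vside (fun z => g (cexp z)) (ln r) 0 (2 * pi).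
  by move=> r0; congr (_ * Int _ _ _); apply/funext => t; rewrite circ_ln.
apply: etrans (E _ r10) (etrans _ (esym (E _ r20))).
apply: (congr1 (fun c => (rc (2 * pi))^-1 * c)).
apply: (@vside_periodic R (fun z => g (cexp z))).
- by rewrite ler_ln ?posrE.
- exact: twopi_ge0.
- move=> s t /andP[h1 h2] _.
  have [|l Hl] := dg (cexp (pt s t)).
    by rewrite nm_cexp re_pt -[r1]lnK ?posrE // -[r2]lnK ?posrE // !ler_expR h1.
  by exists (l * cexp (pt s t)); apply: der_comp Hl; exact: der_cexp.
move=> s; rewrite /pt !cexpD cexp_2pi rc0 mulr0 cexp0 //.
Qed.

Lemma mean_cont_radius g R0 r : 0 < r -> r < R0 ->
  (forall z, nm z < R0 -> cont idC g z) ->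
  forall e, 0 < e -> exists2 d : R, 0 < d &
    forall r', `|r' - r| < d -> nm (mean g r' - mean g r) <= e.
Proof.
move=> r0 rR cg e e0.
have [|d d0 Hd] := @uniform_in_parameter R (fun s t => g (circ s t)) r 0 (2 * pi) twopi_ge0 _ _ e0.
  move=> t e1 _ e10.
  have [|d1 d10 H1] := cg (circ r t) _ _ e10; first by rewrite nm_circ // ltW.
  have c1 : cont (@rc R) (fun t => cexp ('i%C * rc t)) t.
    apply: (@cont_comp _ _ (@rc R) (fun t => 'i%C * rc t) (@cexp R)).
      by apply: contM; [exact: cont_const|apply: cont_em; exact: rcD].
    exact: der_cont (der_cexp _).
  have k0 : 0 < d1 / (2 * r) by rewrite divr_gt0 // mulr_gt0.
  have [d2 d20 H2] := c1 _ k0.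
  exists (Num.min (d1 / 2) d2); first by rewrite lt_min divr_gt0.
  move=> h k; rewrite !lt_min => /andP[h1 _] /andP[_ h2].
  set z' := circ (r + h) (t + k).
  have -> : z' = circ r t + (z' - circ r t) by ring.
  apply: H1.
  have -> : z' - circ r t = rc h * cexp ('i%C * rc (t + k)) +
    rc r * (cexp ('i%C * rc (t + k)) - cexp ('i%C * rc t)).
    by rewrite /z' /circ rcD; ring.
  apply: le_lt_trans (nmD _ _) _; rewrite !nmM !nm_rc nm_cexp re_iM im_rc oppr0 expR0 mulr1.
  have := H2 k; rewrite nm_rc => /(_ h2).
  rewrite ltr_pdivlMr ?mulr_gt0 // (gtr0_norm r0) => h3.
  set X := nm _ in h3 *; lra.
have m0 : 0 < Num.min d (Num.min r (R0 - r)) by rewrite !lt_min d0 r0 subr_gt0.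
exists (Num.min d (Num.min r (R0 - r))) => // r'; rewrite !lt_min => /and3P[h1 h2 h3].
have r'0 : 0 < r' by move: h2; rewrite ltr_norml; lra.
have r'R : r' < R0 by move: h3; rewrite ltr_norml; lra.
have c s : s < R0 -> ccont g s by move=> sR z hz; apply: cg; rewrite hz.
rewrite /mean -mulrBr nmM nmV nm_rc ger0_norm ?twopi_ge0 // mulrC.
rewrite ler_pdivrMr ?twopi_gt0 // -IntB ?twopi_ge0 //; last 2 first.
- by apply: icont_circ; [exact: ltW|exact: c].
- by apply: icont_circ; [exact: ltW|exact: c].
have := @Int_bound R (fun t => g (circ r' t) - g (circ r t)) 0 (2 * pi) e twopi_ge0.
rewrite subr0; apply.
  by move=> t ht; apply: contB; apply: icont_circ => //; rewrite ?ltW //; exact: c.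
by move=> t ht; have := Hd _ t h1 ht; rewrite [r + _]addrC subrK.
Qed.

(** The mean is constant for radii below [nm w], constant for radii above, and continuous at [nm w];
    for small radii it is close to [k 0 = 0]. *)
Lemma mean_punctured k R0 w r : nm w < r -> r < R0 -> k 0 = 0 ->
  (forall z, nm z < R0 -> cont idC k z) ->
  (forall z, nm z < R0 -> z != w -> exists l, der idC k z l) ->
  mean k r = 0.
Proof.
move=> wr rR k0 ck dk; have w0 := nm_ge0 w; have r0 := le_lt_trans w0 wr.
have R00 := lt_trans r0 rR.
suff main e : 0 < e -> nm (mean k r) <= 3 * e.
  apply: nm_eq0; apply/eqP; rewrite eq_le nm_ge0 andbT leNgt; apply/negP => N0.
  have := main (nm (mean k r) / 6); rewrite divr_gt0 // => /(_ isT); lra.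
move=> e0.
have [|d d0 Hd] := ck 0 _ _ e0; first by rewrite nm0.
have small r' : 0 < r' -> r' < d -> r' < R0 -> nm (mean k r') <= e.
  move=> r'0 r'd r'R; apply: mean_bound; first exact: ltW.
    by move=> z hz; apply: ck; rewrite hz.
  by move=> z hz; have := Hd z; rewrite add0r k0 subr0 hz => /(_ r'd)/ltW.
have [nw0|nw] := eqVneq (nm w) 0.
  pose r' := Num.min (d / 2) r.
  have r'0 : 0 < r' by rewrite /r' lt_min divr_gt0.
  have r'r : r' <= r by rewrite /r' ge_min lexx orbT.
  have r'd : r' <= d / 2 by rewrite /r' ge_min lexx.
  rewrite -(@mean_annulus _ r' r) //; last first.
    move=> z /andP[z1 z2]; apply: dk; first exact: le_lt_trans z2 rR.
    by apply: contraTneq z1 => ->; rewrite -ltNge nw0.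
  apply: le_trans (small r' r'0 _ _) _; lra.
have nw0 : 0 < nm w by rewrite lt_def nw.
have [d1 d10 H1] := mean_cont_radius nw0 (lt_trans wr rR) ck e0.
pose h := Num.min (d1 / 2) (Num.min (nm w / 2) ((r - nm w) / 2)).
have h0 : 0 < h by rewrite /h !lt_min !divr_gt0 // subr_gt0.
have hd : h <= d1 / 2 by rewrite /h ge_min lexx.
have hw : h <= nm w / 2 by rewrite /h !ge_min lexx orbT.
have hr : h <= (r - nm w) / 2 by rewrite /h !ge_min lexx !orbT.
rewrite -(@mean_annulus _ (nm w + h) r); [|lra|lra|]; last first.
  move=> z /andP[z1 z2]; apply: dk; first exact: le_lt_trans z2 rR.
  by apply: contraTneq z1 => ->; rewrite -ltNge; lra.
have A1 := H1 (nm w + h); have A2 := H1 (nm w - h).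
have B1 : `|nm w + h - nm w| < d1 by rewrite ltr_norml; lra.
have B2 : `|nm w - h - nm w| < d1 by rewrite ltr_norml; lra.
move: (A1 B1) (A2 B2) => {A1 A2}.
pose r' := Num.min (d / 2) (nm w - h).
have r'0 : 0 < r' by rewrite /r' lt_min divr_gt0 //; lra.
have r'r : r' <= nm w - h by rewrite /r' ge_min lexx orbT.
have r'd : r' <= d / 2 by rewrite /r' ge_min lexx.
rewrite -(@mean_annulus _ r' (nm w - h)) //; last first.
  move=> z /andP[z1 z2]; apply: dk; first by lra.
  by apply: contraTneq z2 => ->; rewrite -ltNge; lra.
move=> A1 A2; have A3 := small r' r'0 ltac:(lra) ltac:(lra).
set X := mean k (nm w + h) in A1 *; set Y := mean k (nm w) in A1 A2 *.
set Z := mean k r' in A2 A3 *.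
have -> : X = (X - Y) - (Z - Y) + Z by ring.
apply: le_trans (nmD _ _) _; apply: le_trans (lerD (nmB _ _) (lexx _)) _; lra.
Qed.

(** In [z / (z - w) = 1 + w / (z - w)] the last term has a mean independent of the radius, which
    tends to 0 as the radius grows. *)
Lemma mean_cauchy_kernel w r : nm w < r -> mean (fun z => z / (z - w)) r = 1.
Proof.
move=> wr; have w0 := nm_ge0 w; have r0 := le_lt_trans w0 wr.
have zw z s : nm w < s -> s <= nm z -> z - w != 0.
  by move=> ws sz; rewrite -nm_gt0; have := nm_geB z w; lra.
have cK s : nm w < s -> ccont (fun z => w / (z - w)) s.
  move=> ws; apply: ccontM; first exact: ccont_cst.
  apply: ccontV; last by apply: ccontB; [exact: ccont_id|exact: ccont_cst].
  by move=> z hz; apply: zw ws _; rewrite hz.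
have -> : mean (fun z => z / (z - w)) r = mean (fun z => 1 + w / (z - w)) r.
  apply: mean_ext; first exact: ltW.
  by move=> z hz; field; apply: zw wr _; rewrite hz.
rewrite (meanD (ltW r0) (@ccont_cst r 1) (cK r wr)) mean_cst //.
suff -> : mean (fun z => w / (z - w)) r = 0 by rewrite addr0.
suff main e : 0 < e -> nm (mean (fun z => w / (z - w)) r) <= e.
  apply: nm_eq0; apply/eqP; rewrite eq_le nm_ge0 andbT leNgt; apply/negP => N0.
  have := main (nm (mean (fun z => w / (z - w)) r) / 2).
  by rewrite divr_gt0 // => /(_ isT); lra.
move=> e0; pose s := r + nm w + nm w / e.
have we0 : 0 <= nm w / e by rewrite divr_ge0 // ltW.
rewrite (@mean_annulus _ r s) //; last first.
- move=> z /andP[z1 z2]; have z0 := zw z r wr z1.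
  eexists; apply: der_div => //; first exact: der_const.
  by apply: derB; [exact: der_em|exact: der_const].
- by rewrite /s; lra.
apply: mean_bound; [by rewrite /s; lra|by apply: cK; rewrite /s; lra|].
move=> z hz; rewrite nm_div.
have h1 : nm w / e < nm (z - w) by have := nm_geB z w; rewrite hz /s; lra.
rewrite ler_pdivrMr; last by apply: le_lt_trans h1.
by rewrite mulrC -ler_pdivrMr // ltW.
Qed.

Definition hol_on (R0 : R) f := forall z, nm z < R0 -> exists l, der idC f z l.

Lemma hol_ccont R0 f r : hol_on R0 f -> r < R0 -> ccont f r.
Proof. by move=> hf rR z hz; have [|l /der_cont//] := hf z; rewrite hz. Qed.

(** The difference quotient [q], completed at [w] by the derivative, is continuous there.
    [mean_punctured] applies to [q z * z], the factor [z] providing the value 0 at 0. *)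
Theorem cauchy_formula R0 f r w : hol_on R0 f -> nm w < r -> r < R0 ->
  mean (fun z => f z * (z / (z - w))) r = f w.
Proof.
move=> hf wr rR; have w0 := nm_ge0 w; have r0 := le_lt_trans w0 wr.
have wR := lt_trans wr rR.
have [l Hl] := hf w wR.
pose q z := if z == w then l else (f z - f w) / (z - w).
have dq z : nm z < R0 -> z != w -> exists l, der idC q z l.
  move=> zR zw; have [m Hm] := hf z zR.
  have zw0 : z - w != 0 by rewrite subr_eq0.
  have Dn : der idC (fun y => f y - f w) z (m - 0) by apply: derB Hm (der_const _ _ _).
  have Dd := der_div (g := fun y => y - w) zw0 Dn (der_subc w z).
  eexists; refine (der_near (g := q) _ _ Dd).
    by rewrite /q (negbTE zw).
  exists (nm (z - w)); first by rewrite nm_gt0.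
  move=> h hh; rewrite /q ifN //; apply: contraTneq hh => E.
  by rewrite -leNgt -E opprD addrA subrr sub0r nmN.
have cq z : nm z < R0 -> cont idC q z.
  move=> zR; have [->|zw] := eqVneq z w; last first.
    by have [m /der_cont] := dq z zR zw.
  move=> e e0; have e2 : 0 < e / 2 by lra.
  have [d d0 Hd] := Hl _ e2; exists d => // h hd.
  rewrite /q eqxx; case: eqP => [|/eqP hw]; first by rewrite subrr nm0.
  have h0 : h != 0 by apply: contraNneq hw => ->; rewrite addr0.
  have -> : w + h - w = h by ring.
  have -> : (f (w + h) - f w) / h - l = (f (w + h) - f w - h * l) / h by field.
  rewrite nm_div ltr_pdivrMr ?nm_gt0 //; apply: le_lt_trans (Hd _ hd) _.
  by rewrite ltr_pM2r ?nm_gt0 //; lra.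
have K0 := @mean_punctured (fun z => q z * z) R0 w r wr rR.
have {K0}K0 : mean (fun z => q z * z) r = 0.
  apply: K0; first by rewrite mulr0.
  - by move=> z zR; apply: contM; [exact: cq|exact: cont_em].
  - move=> z zR zw; have [m Hm] := dq z zR zw.
    by eexists; apply: derM Hm _; exact: der_em.
have zw0 z : nm z = r -> z - w != 0.
  by move=> hz; rewrite -nm_gt0; have := nm_geB z w; lra.
have ck : ccont (fun z => z / (z - w)) r.
  apply: ccontM; first exact: ccont_id.
  by apply: ccontV => //; apply: ccontB; [exact: ccont_id|exact: ccont_cst].
have E : mean (fun z => q z * z) r =
   mean (fun z => f z * (z / (z - w)) - f w * (z / (z - w))) r.
  apply: mean_ext; first exact: ltW.
  move=> z hz; have := zw0 z hz => z0; rewrite /q ifN; first by field.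
  by rewrite -subr_eq0.
move: K0; rewrite E (meanB (ltW r0) (ccontM (hol_ccont hf rR) ck)
  (ccontM (@ccont_cst r (f w)) ck)) (meanZ (ltW r0) _ ck).
rewrite mean_cauchy_kernel // mulr1.
by move=> /eqP; rewrite subr_eq0 => /eqP.
Qed.

End CircleMean.

(** * Derivatives, Taylor estimates and the maximum principle *)

Section Holomorphic.
Variable R : realType.
Local Notation C := (CC R).
Local Notation idC := (fun z : C => z).
Implicit Types (f g : C -> C) (r : R) (z w h : C).

Lemma der_uniq f z l l' : der idC f z l -> der idC f z l' -> l = l'.
Proof.
move=> d1 d2; apply/eqP; rewrite -subr_eq0 -nm_eq0E eq_le nm_ge0 andbT.
rewrite leNgt; apply/negP => N0; set N := nm (l - l') in N0.
have e0 : 0 < N / 4 by lra.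
have [d dp H] := nr_and (d1 _ e0) (d2 _ e0).
have [|H1 H2] := H (rc (d / 2)); first by rewrite nm_rc ger0_norm; lra.
set k := rc (d / 2) in H1 H2.
have k0 : 0 < nm k by rewrite nm_rc ger0_norm; lra.
have : nm (k * (l - l')) <= nm k * (N / 2).
  have -> : k * (l - l') = (f (z + k) - f z - k * l') - (f (z + k) - f z - k * l) by ring.
  apply: le_trans (nmB _ _) _; lra.
rewrite nmM ler_pM2l // -/N; lra.
Qed.

Definition dv f z : C := xget 0 [set l | der idC f z l].

Lemma dvE f z l : der idC f z l -> dv f z = l.
Proof.
move=> dl; rewrite /dv; case: xgetP => [m _ dm|/(_ l)//].
exact: der_uniq dm dl.
Qed.

Lemma hol_dv R0 f z : hol_on R0 f -> nm z < R0 -> der idC f z (dv f z).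
Proof. by move=> hf zR; have [l Hl] := hf z zR; rewrite (dvE Hl). Qed.

(** A uniform quadratic remainder, explicit for the Cauchy kernels, takes the place of a domination
    argument. *)
Lemma Int_param (K : R -> C -> C) (K' : R -> C) (a b : R) z (d B : R) :
  a <= b -> 0 < d ->
  (forall h, nm h < d -> icont (fun t => K t (z + h)) a b) -> icont K' a b ->
  (forall h t, nm h < d -> a <= t <= b ->
    nm (K t (z + h) - K t z - h * K' t) <= B * nm h ^+ 2) ->
  der idC (fun w => Int (fun t => K t w) a b) z (Int K' a b).
Proof.
move=> ab d0 cK cK' HB e e0.
have ba : 0 <= b - a by rewrite subr_ge0.
have Bn := normr_ge0 B.
pose B' := `|B| * (b - a) + 1.
have B'0 : 0 < B' by rewrite /B'; have := mulr_ge0 Bn ba; lra.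
have c0 : icont (fun t => K t z) a b.
  by have := cK 0; rewrite nm0 addr0; apply.
exists (Num.min d (e / B')); first by rewrite lt_min d0 divr_gt0.
move=> h; rewrite lt_min => /andP[h1 h2].
have h0 := nm_ge0 h.
rewrite -(IntB ab (cK h h1) c0) -(IntZ h ab cK').
have ch : icont (fun t => h * K' t) a b.
  by move=> t ht; apply: contM; [exact: cont_const|exact: cK'].
have cd : icont (fun t => K t (z + h) - K t z) a b.
  by move=> t ht; apply: contB; [exact: cK|exact: c0].
rewrite -(IntB ab cd ch).
apply: le_trans (@Int_bound _ _ a b (`|B| * nm h ^+ 2) ab _ _) _.
- by move=> t ht; apply: contB; [exact: cd|exact: ch].
- move=> t ht; apply: le_trans (HB h t h1 ht) _.
  by rewrite ler_wpM2r ?sqr_ge0 // ler_norm.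
rewrite expr2 mulrA mulrAC ler_wpM2r //.
move: h2; rewrite ltr_pdivlMr // /B' => h2; nra.
Qed.

Lemma mean_param (K : C -> C -> C) (K' : C -> C) r z (d B : R) :
  0 <= r -> 0 < d -> (forall h, nm h < d -> ccont (fun y => K y (z + h)) r) ->
  ccont K' r ->
  (forall h y, nm h < d -> nm y = r ->
    nm (K y (z + h) - K y z - h * K' y) <= B * nm h ^+ 2) ->
  der idC (fun w => mean (fun y => K y w) r) z (mean K' r).
Proof.
move=> r0 d0 cK cK' HB; apply: derZ.
apply: (@Int_param (fun t w => K (circ r t) w) (fun t => K' (circ r t)) 0 (2 * pi) z d B) => //.
- exact: twopi_ge0.
- by move=> h hd; apply: (icont_circ r0 (cK h hd)).
- exact: icont_circ.
- by move=> h t hd _; apply: HB => //; rewrite nm_circ.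
Qed.

Lemma circ_away w r z : nm z = r -> r - nm w <= nm (z - w).
Proof. by move=> <-; exact: nm_geB. Qed.

Lemma circ_neq0 w r z : nm w < r -> nm z = r -> z - w != 0.
Proof.
by move=> wr zr; rewrite -nm_gt0; apply: lt_le_trans (circ_away w zr); rewrite subr_gt0.
Qed.

Lemma ccont_kernel n w r : nm w < r -> ccont (fun z => z / (z - w) ^+ n) r.
Proof.
move=> wr; apply: ccontM; first exact: ccont_id.
apply: ccontV => [z zr|]; first by rewrite expf_neq0 // (circ_neq0 wr zr).
by apply: ccontX; apply: ccontB; [exact: ccont_id|exact: ccont_cst].
Qed.

Lemma nm_kernel n w r z : nm w < r -> nm z = r ->
  nm (z / (z - w) ^+ n) <= r / (r - nm w) ^+ n.
Proof.
move=> wr zr; rewrite nm_div nmX zr ler_wpM2l //; first by rewrite -zr nm_ge0.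
have rw : 0 < r - nm w by rewrite subr_gt0.
have zw := lt_le_trans rw (circ_away w zr).
rewrite lef_pV2 ?posrE ?exprn_gt0 //.
by apply: lerXn2r; rewrite ?nnegrE ?(ltW rw) ?(ltW zw) // circ_away.
Qed.

Lemma ccont_kernel1 w r : nm w < r -> ccont (fun z => z / (z - w)) r.
Proof.
move=> wr; rewrite (_ : (fun z => _) = fun z => z / (z - w) ^+ 1).
  exact: ccont_kernel.
by apply/funext => z; rewrite expr1.
Qed.

Lemma nm_kernel1 w r z : nm w < r -> nm z = r -> nm (z / (z - w)) <= r / (r - nm w).
Proof. by move=> wr zr; have := nm_kernel 1 wr zr; rewrite !expr1. Qed.

(** As [g] is merely continuous on the circle, this covers derivatives, removable singularities and
    Schwarz's formula at once. The remainder is bounded for [h] within half the distance [p] from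
    [w] to the circle. *)
Lemma der_mean_kernel1 g w r : ccont g r -> nm w < r ->
  der idC (fun w => mean (fun z => g z * (z / (z - w))) r) w
    (mean (fun z => g z * (z / (z - w) ^+ 2)) r).
Proof.
move=> cg wr; have r0 : 0 < r := le_lt_trans (nm_ge0 w) wr.
have [M M0 HM] := ccont_bounded (ltW r0) cg.
pose p := r - nm w; have p0 : 0 < p by rewrite subr_gt0.
have near h : nm h < p / 2 -> nm (w + h) < r.
  by move=> hp; have := nmD w h; rewrite /p in hp p0; lra.
apply: (@mean_param (fun z w => g z * (z / (z - w))) _ r w (p / 2)
   (M * (r * (2 / p ^+ 3)))) => //; [exact: ltW|lra| | |].
- move=> h hp; apply: ccontM => //.
  exact: ccont_kernel1 (near h hp).
- by apply: ccontM => //; exact: ccont_kernel.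
move=> h z hp zr.
have z0 := circ_neq0 wr zr; have z1 := circ_neq0 (near h hp) zr.
have -> : g z * (z / (z - (w + h))) - g z * (z / (z - w)) - h * (g z * (z / (z - w) ^+ 2))
  = g z * (z * ((z - w) ^- 2 / (z - (w + h)))) * h ^+ 2.
  by field; rewrite ?z0 ?z1.
rewrite nmM nmX (nmM (g z)) (nmM z); apply: ler_wpM2r; first exact: sqr_ge0.
apply: ler_pM; rewrite ?nm_ge0 //; first by rewrite mulr_ge0 ?nm_ge0.
  exact: HM.
rewrite zr ler_wpM2l ?(ltW r0) //.
have a1 := circ_away w zr.
have a2 : p / 2 <= nm (z - (w + h)).
  have -> : z - (w + h) = (z - w) - h by ring.
  have := nm_geB (z - w) h; rewrite /p in hp *; lra.
rewrite nmM !nmV nmX -invfM.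
have -> : 2 / p ^+ 3 = (p ^+ 2 * (p / 2))^-1 by field; rewrite gt_eqF.
have u0 : 0 < nm (z - w) by rewrite nm_gt0.
have u1 : 0 < nm (z - (w + h)) by rewrite nm_gt0.
rewrite lef_pV2 ?posrE ?mulr_gt0 ?exprn_gt0 ?divr_gt0 //.
apply: ler_pM => //; [exact: sqr_ge0|lra|].
by apply: lerXn2r; rewrite ?nnegrE ?nm_ge0 // ltW.
Qed.

Lemma der_mean_kernel2 g w r : ccont g r -> nm w < r ->
  der idC (fun w => mean (fun z => g z * (z / (z - w) ^+ 2)) r) w
    (mean (fun z => g z * (2 * (z / (z - w) ^+ 3))) r).
Proof.
move=> cg wr; have r0 : 0 < r := le_lt_trans (nm_ge0 w) wr.
have [M M0 HM] := ccont_bounded (ltW r0) cg.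
pose p := r - nm w; have p0 : 0 < p by rewrite subr_gt0.
have near h : nm h < p / 2 -> nm (w + h) < r.
  by move=> hp; have := nmD w h; rewrite /p in hp p0; lra.
apply: (@mean_param (fun z w => g z * (z / (z - w) ^+ 2)) _ r w (p / 2)
   (M * (r * (16 / p ^+ 4)))) => //; [exact: ltW|lra| | |].
- by move=> h hp; apply: ccontM => //; exact: ccont_kernel (near h hp).
- apply: ccontM => //; apply: ccontM; first exact: ccont_cst.
  exact: ccont_kernel.
move=> h z hp zr.
have z0 := circ_neq0 wr zr; have z1 := circ_neq0 (near h hp) zr.
have -> : g z * (z / (z - (w + h)) ^+ 2) - g z * (z / (z - w) ^+ 2)
    - h * (g z * (2 * (z / (z - w) ^+ 3)))
  = g z * (z * ((3 * (z - w) - 2 * h) * (z - w) ^- 3 * (z - (w + h)) ^- 2)) * h ^+ 2.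
  by field; rewrite ?z0 ?z1.
rewrite nmM nmX (nmM (g z)) (nmM z); apply: ler_wpM2r; first exact: sqr_ge0.
have a1 := circ_away w zr; rewrite -/p in a1.
have a2 : nm (z - w) / 2 <= nm (z - (w + h)).
  have -> : z - (w + h) = (z - w) - h by ring.
  have := nm_geB (z - w) h; lra.
set u := nm (z - w) in a1 a2 *.
have u0 : 0 < u by exact: lt_le_trans a1.
apply: ler_pM; rewrite ?nm_ge0 //; first by rewrite !mulr_ge0 ?nm_ge0.
  exact: HM.
rewrite zr ler_wpM2l ?(ltW r0) // !nmM !nmV !nmX -/u.
have t1 : nm (3 * (z - w) - 2 * h) <= 4 * u.
  apply: le_trans (nmB _ _) _; rewrite !nmM -/u.
  have -> : nm (3 : C) = 3 by rewrite -(rcn R 3) nm_rc ger0_norm.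
  have -> : nm (2 : C) = 2 by rewrite -(rcn R 2) nm_rc ger0_norm.
  lra.
have t2 : (nm (z - (w + h)) ^+ 2)^-1 <= ((u / 2) ^+ 2)^-1.
  have u2 : 0 < u / 2 by lra.
  rewrite lef_pV2 ?posrE ?exprn_gt0 //; last by exact: lt_le_trans a2.
  by apply: lerXn2r; rewrite ?nnegrE ?nm_ge0 // ltW.
apply: (@le_trans _ _ (4 * u * (u ^+ 3)^-1 * ((u / 2) ^+ 2)^-1)).
  apply: ler_pM => //; rewrite ?mulr_ge0 ?nm_ge0 ?invr_ge0 ?exprn_ge0 ?nm_ge0 ?(ltW u0) //.
  by rewrite ler_wpM2r // invr_ge0 exprn_ge0 // ltW.
have -> : 4 * u * (u ^+ 3)^-1 * ((u / 2) ^+ 2)^-1 = 16 / u ^+ 4.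
  by field; rewrite gt_eqF.
rewrite ler_wpM2l // lef_pV2 ?posrE ?exprn_gt0 //.
by apply: lerXn2r; rewrite ?nnegrE ?(ltW p0) ?(ltW u0).
Qed.

Section Disc.
Variables (R0 : R) (f : C -> C).
Hypothesis hf : hol_on R0 f.

Lemma nr_disc w r : nm w < r -> nr idC (fun h => nm (w + h) < r).
Proof.
move=> wr; exists (r - nm w); first by rewrite subr_gt0.
by move=> h hr; have := nmD w h; lra.
Qed.

Lemma cauchy_derivative w r : nm w < r -> r < R0 ->
  dv f w = mean (fun z => f z * (z / (z - w) ^+ 2)) r.
Proof.
move=> wr rR; apply: dvE.
have D := der_mean_kernel1 (hol_ccont hf rR) wr.
refine (der_near (g := f) _ _ D); first exact: cauchy_formula wr rR.
by apply: nr_mono (nr_disc wr) => h hr; exact: cauchy_formula hr rR.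
Qed.

Lemma hol_derivative : hol_on R0 (dv f).
Proof.
move=> w wR; pose r := (nm w + R0) / 2.
have wr : nm w < r by rewrite /r; lra.
have rR : r < R0 by rewrite /r; lra.
have D := der_mean_kernel2 (hol_ccont hf rR) wr.
eexists; refine (der_near (g := dv f) _ _ D).
  by rewrite (cauchy_derivative wr rR).
by apply: nr_mono (nr_disc wr) => h hr; rewrite (cauchy_derivative hr rR).
Qed.

Lemma cauchy_estimate w r M : nm w < r -> r < R0 ->
  (forall z, nm z = r -> nm (f z) <= M) -> nm (dv f w) <= M * (r / (r - nm w) ^+ 2).
Proof.
move=> wr rR HM; have r0 : 0 < r := le_lt_trans (nm_ge0 w) wr.
rewrite (cauchy_derivative wr rR); apply: mean_bound; first exact: ltW.
  by apply: ccontM; [exact: hol_ccont rR|exact: ccont_kernel].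
move=> z zr; rewrite nmM; apply: ler_pM; rewrite ?nm_ge0 //; first exact: HM.
exact: nm_kernel.
Qed.

Lemma taylor2 w h r M : nm w + nm h < r -> r < R0 ->
  (forall z, nm z = r -> nm (f z) <= M) ->
  nm (f (w + h) - f w - h * dv f w) <=
    M * (r / ((r - nm w) ^+ 2 * (r - nm w - nm h))) * nm h ^+ 2.
Proof.
move=> whr rR HM; have h0 := nm_ge0 h.
have wr : nm w < r by lra.
have whr' : nm (w + h) < r by apply: le_lt_trans (nmD _ _) _.
have r0 : 0 < r := le_lt_trans (nm_ge0 w) wr.
have cf := hol_ccont hf rR.
have c1 := ccontM cf (ccont_kernel1 whr'); have c2 := ccontM cf (ccont_kernel1 wr).
have c3 := ccontM cf (ccont_kernel 2 wr).
have z0 z : nm z = r -> z - w != 0 := circ_neq0 wr.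
have z1 z : nm z = r -> z - (w + h) != 0 := circ_neq0 whr'.
rewrite -(cauchy_formula hf whr' rR) -(cauchy_formula hf wr rR).
rewrite (cauchy_derivative wr rR) -(meanZ (ltW r0) h c3).
rewrite -(meanB (ltW r0) c1 c2).
rewrite -(meanB (ltW r0) (ccontB c1 c2) (ccontM (@ccont_cst _ r h) c3)).
apply: mean_bound; first exact: ltW.
  apply: ccontB; first by apply: ccontB; [exact: c1|exact: c2].
  by apply: ccontM; [exact: ccont_cst|exact: c3].
move=> z zr.
have -> : f z * (z / (z - (w + h))) - f z * (z / (z - w)) - h * (f z * (z / (z - w) ^+ 2))
  = f z * (z * ((z - w) ^- 2 / (z - (w + h)))) * h ^+ 2.
  by field; rewrite ?z0 ?z1.
rewrite nmM nmX (nmM (f z)) (nmM z); apply: ler_wpM2r; first exact: sqr_ge0.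
apply: ler_pM; rewrite ?nm_ge0 //; first by rewrite mulr_ge0 ?nm_ge0.
  exact: HM.
rewrite zr ler_wpM2l ?(ltW r0) // nmM !nmV nmX -invfM.
have p0 : 0 < r - nm w by rewrite subr_gt0.
have p1 : 0 < r - nm w - nm h by lra.
have a1 := circ_away w zr.
have a2 : r - nm w - nm h <= nm (z - (w + h)).
  have -> : z - (w + h) = (z - w) - h by ring.
  have := nm_geB (z - w) h; lra.
have u0 : 0 < nm (z - w) by rewrite nm_gt0 z0.
have u1 : 0 < nm (z - (w + h)) by rewrite nm_gt0 z1.
rewrite lef_pV2 ?posrE ?mulr_gt0 ?exprn_gt0 //.
apply: ler_pM => //; [exact: sqr_ge0|exact: ltW|].
by apply: lerXn2r; rewrite ?nnegrE ?nm_ge0 // ltW.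
Qed.

End Disc.

Lemma hol_X R0 f n : hol_on R0 f -> hol_on R0 (fun z => f z ^+ n).
Proof. by move=> hf z zR; have [l Hl] := hf z zR; eexists; apply: derX Hl. Qed.

Lemma pow_le (x y K : R) : 0 <= x -> 0 <= y -> (forall n, x ^+ n <= K * y ^+ n) -> x <= y.
Proof.
move=> x0 y0 H; rewrite leNgt; apply/negP => yx.
have [y00|yn0] := eqVneq y 0.
  by have := H 1%N; rewrite !expr1 y00 mulr0; lra.
have yp : 0 < y by rewrite lt_def yn0.
pose d := x / y - 1.
have d0 : 0 < d by rewrite /d subr_gt0 ltr_pdivlMr // mul1r.
have K0 : 0 <= `|K| / d by rewrite divr_ge0 // ltW.
pose n := (Num.truncn (`|K| / d)).+1.
have hn : `|K| < n%:R * d.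
  by rewrite -ltr_pdivrMr //; have /andP[] := truncn_itv K0.
have h1 : x ^+ n / y ^+ n <= K.
  by rewrite ler_pdivrMr ?exprn_gt0.
have h2 : 1 + n%:R * d <= (x / y) ^+ n.
  have -> : x / y = 1 + d by rewrite /d; ring.
  elim: n {hn h1} => [|n IH]; first by rewrite expr0; lra.
  rewrite exprS -natr1.
  have n0 : 0 <= n%:R * d by rewrite mulr_ge0 // ltW.
  nra.
rewrite expr_div_n in h2; have := ler_norm K; lra.
Qed.

(** Cauchy's formula for the powers of [f] gives [nm (f w) ^ n <= K M ^ n] with [K] independent of
    [n]; letting [n] grow removes [K]. *)
Lemma max_principle R0 f r w M : hol_on R0 f -> nm w <= r -> r < R0 -> 0 <= M ->
  (forall z, nm z = r -> nm (f z) <= M) -> nm (f w) <= M.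
Proof.
move=> hf; rewrite le_eqVlt => /orP[/eqP wr _ _|wr rR M0 HM]; first by apply.
have r0 : 0 < r := le_lt_trans (nm_ge0 w) wr.
apply: (@pow_le _ _ (r / (r - nm w))); rewrite ?nm_ge0 // => n.
rewrite -nmX -(cauchy_formula (hol_X n hf) wr rR) mulrC.
apply: mean_bound; first exact: ltW.
  apply: ccontM; first exact: hol_ccont (hol_X n hf) rR.
  exact: ccont_kernel1 wr.
move=> z zr; rewrite nmM; apply: ler_pM; rewrite ?nm_ge0 //.
  by rewrite nmX; apply: lerXn2r; rewrite ?nnegrE ?nm_ge0 // HM.
exact: nm_kernel1 wr zr.
Qed.

Lemma hol_bounded R0 f r : hol_on R0 f -> 0 <= r -> r < R0 ->
  exists2 M : R, 0 < M & forall z, nm z <= r -> nm (f z) <= M.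
Proof.
move=> hf r0 rR; have [M M0 HM] := ccont_bounded r0 (hol_ccont hf rR).
by exists M => // z zr; apply: max_principle hf zr rR (ltW M0) HM.
Qed.

End Holomorphic.

(** * Quotients, primitives, logarithms and the Borel-Caratheodory inequality *)

Section HolomorphicTools.
Variable R : realType.
Local Notation C := (CC R).
Local Notation idC := (fun z : C => z).
Implicit Types (f g : C -> C) (r : R) (z w h : C).

Definition quo f (a : C) z : C := if z == a then dv f a else f z / (z - a).

Lemma quoE f a z : f a = 0 -> f z = (z - a) * quo f a z.
Proof.
rewrite /quo => fa; case: eqP => [->|/eqP za]; first by rewrite fa subrr mul0r.
by rewrite mulrC divfK // subr_eq0.
Qed.

(** Near [a] the quotient is the Cauchy integral of [f z / (z - a)] over a larger circle, where this
    function is continuous; such integrals are differentiable inside. *)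
Lemma hol_quo R0 f a : hol_on R0 f -> nm a < R0 -> f a = 0 -> hol_on R0 (quo f a).
Proof.
move=> hf aR fa w wR; have [wa|wa] := eqVneq w a; last first.
  have [l Hl] := hf w wR; have wa0 : w - a != 0 by rewrite subr_eq0.
  have Dd := der_div (g := fun y => y - a) wa0 Hl (der_subc a w).
  eexists; refine (der_near (g := quo f a) _ _ Dd); first by rewrite /quo (negbTE wa).
  exists (nm (w - a)); first by rewrite nm_gt0.
  move=> h hh; rewrite /quo ifN //; apply: contraTneq hh => E.
  by rewrite -leNgt -E opprD addrA subrr sub0r nmN.
rewrite wa in wR *; pose r := (nm a + R0) / 2.
have ar : nm a < r by rewrite /r; lra.
have rR : r < R0 by rewrite /r; lra.
have r0 : 0 < r := le_lt_trans (nm_ge0 a) ar.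
have cf := hol_ccont hf rR.
have cg : ccont (fun z => f z / (z - a)) r.
  apply: ccontM => //; apply: ccontV; first by move=> z zr; exact: circ_neq0 ar zr.
  by apply: ccontB; [exact: ccont_id|exact: ccont_cst].
have E x : nm x < r -> mean (fun z => f z / (z - a) * (z / (z - x))) r = quo f a x.
  move=> xr; rewrite /quo; case: eqP => [->|/eqP xa].
    rewrite (cauchy_derivative hf ar rR); apply: mean_ext; first exact: ltW.
    by move=> z zr; field; exact: circ_neq0 ar zr.
  have xa0 : x - a != 0 by rewrite subr_eq0.
  apply: (mulfI xa0); rewrite mulrC [RHS]mulrC divfK // mulrC.
  rewrite -(meanZ (ltW r0) _ (ccontM cg (ccont_kernel1 xr))).
  have c1 := ccontM cf (ccont_kernel1 xr); have c2 := ccontM cf (ccont_kernel1 ar).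
  have -> : f x = f x - f a by rewrite fa subr0.
  rewrite -(cauchy_formula hf xr rR) -(cauchy_formula hf ar rR) -(meanB (ltW r0) c1 c2).
  apply: mean_ext; first exact: ltW.
  move=> z zr; have z0 := circ_neq0 ar zr; have z1 := circ_neq0 xr zr.
  by field; rewrite ?z0 ?z1.
have D := der_mean_kernel1 cg ar.
eexists; refine (der_near (g := quo f a) _ _ D); first exact: E.
by apply: nr_mono (nr_disc ar) => h hr; exact: E.
Qed.

Lemma der_ray (z : C) (t : R) : der (@rc R) (fun t => rc t * z) t z.
Proof.
apply: der_eq (derM (der_em _ (@rcD R)) (der_const _ _ _)).
by rewrite mulr0 addr0 mul1r.
Qed.

Lemma nm_ray R0 (z : C) (t : R) : nm z < R0 -> 0 <= t <= 1 -> nm (rc t * z) < R0.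
Proof.
move=> zR /andP[t0 t1]; rewrite nmM nm_rc ger0_norm //.
apply: le_lt_trans zR; have := nm_ge0 z; nra.
Qed.

Lemma const_on_disc R0 f z : (forall w, nm w < R0 -> der idC f w 0) -> nm z < R0 ->
  f z = f 0.
Proof.
move=> df zR; apply/eqP; rewrite -subr_eq0 -nm_eq0E eq_le nm_ge0 andbT.
have := @prim_bound R (fun t => f (rc t * z)) (fun=> 0) 0 1 0 ler01.
rewrite rc1 rc0 mul1r !mul0r; apply; last by rewrite nm0.
move=> t ht; apply: der_eq (der_comp (der_ray z t) (df _ (nm_ray zR ht))).
by rewrite mul0r.
Qed.

Definition primitive f z : C := Int (fun t => z * f (rc t * z)) 0 1.

Lemma der_primitive R0 f z : hol_on R0 f -> nm z < R0 -> der idC (primitive f) z (f z).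
Proof.
move=> hf zR; have z0 := nm_ge0 z.
have hf' := hol_derivative hf.
pose p := (R0 - nm z) / 4; have p0 : 0 < p by rewrite /p; lra.
pose r := nm z + 2 * p; have rR : r < R0 by rewrite /r /p; lra.
have r0 : 0 <= r by rewrite /r; lra.
have [M M0 HM] := hol_bounded hf r0 rR.
have [N N0 HN] := hol_bounded hf' r0 rR.
have cray g w (t : R) : hol_on R0 g -> nm w < R0 -> 0 <= t <= 1 ->
    cont (@rc R) (fun t => g (rc t * w)) t.
  move=> hg wR ht; apply: (@cont_comp _ _ (@rc R) (fun t => rc t * w) g).
    exact: der_cont (der_ray w t).
  have [l] := hg _ (nm_ray wR ht); exact: der_cont.
(* [K'] is the derivative of [z * f (rc t * z)] in [z], and also that of [rc t * f (rc t * z)] in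
   [t], so its integral over [[0, 1]] is [f z]. *)
pose K' t := f (rc t * z) + rc t * z * dv f (rc t * z).
have cK' : icont K' 0 1.
  move=> t ht; apply: contD; first exact: cray.
  apply: contM; first exact: der_cont (der_ray z t).
  exact: cray.
have -> : f z = Int K' 0 1.
  rewrite (@IntE _ (fun t => rc t * f (rc t * z))) ?ler01 //.
    by rewrite rc1 rc0 !mul1r !mul0r subr0.
  move=> t ht; apply: der_eq (derM (der_em _ (@rcD R)) (der_comp (der_ray z t) (hol_dv hf (nm_ray zR ht)))).
  by rewrite /K'; ring.
pose A := M * (r / ((r - nm z) ^+ 2 * (r - nm z - p))).
have A0 : 0 <= A.
  rewrite /A mulr_ge0 ?divr_ge0 ?mulr_ge0 ?exprn_ge0 ?(ltW M0) // /r; lra.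
apply: (@Int_param _ (fun t w => w * f (rc t * w)) K' 0 1 z p (r * A + (N + p * A))) => //.
- move=> h hp t ht; apply: contM; first exact: cont_const.
  apply: cray => //; apply: le_lt_trans (nmD _ _) _; rewrite /p in hp; lra.
move=> h t hp /andP[t0 t1].
set u := rc t * z; set k := rc t * h.
have uz : nm u <= nm z by rewrite nmM nm_rc ger0_norm //; nra.
have kh : nm k <= nm h by rewrite nmM nm_rc ger0_norm //; have := nm_ge0 h; nra.
have h0 := nm_ge0 h; have k0 := nm_ge0 k; have u0 := nm_ge0 u.
pose T := f (u + k) - f u - k * dv f u.
have HT : nm T <= A * nm h ^+ 2.
  have ukr : nm u + nm k < r by rewrite /r; lra.
  have HMr y : nm y = r -> nm (f y) <= M by move=> hy; apply: HM; rewrite hy.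
  apply: le_trans (taylor2 hf ukr rR HMr) _.
  have t2 : 0 < r - nm u by rewrite /r; lra.
  have t3 : 0 < r - nm u - nm k by lra.
  have t4 : 0 < r - nm z by rewrite /r; lra.
  have t5 : 0 < r - nm z - p by rewrite /r; lra.
  apply: ler_pM; rewrite ?sqr_ge0 //.
  - by rewrite mulr_ge0 ?(ltW M0) // divr_ge0 // mulr_ge0 ?exprn_ge0 // ltW.
  - rewrite /A ler_wpM2l ?(ltW M0) // ler_wpM2l // lef_pV2 ?posrE ?mulr_gt0 ?exprn_gt0 //.
    apply: ler_pM; rewrite ?exprn_ge0 ?(ltW t4) ?(ltW t5) //; last by lra.
    by apply: lerXn2r; rewrite ?nnegrE ?(ltW t4) ?(ltW t2) //; lra.
  - by apply: lerXn2r; rewrite ?nnegrE.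
have -> : (z + h) * f (rc t * (z + h)) - z * f u - h * (f u + u * dv f u) =
   z * T + h * (k * dv f u + T).
  have -> : rc t * (z + h) = u + k by rewrite mulrDr.
  by rewrite /T /u /k; ring.
apply: le_trans (nmD _ _) _; rewrite !nmM.
have HT0 := nm_ge0 T.
have Nu : nm (dv f u) <= N by apply: HN; rewrite /r; lra.
have s1 : nm z * nm T <= r * (A * nm h ^+ 2).
  by apply: ler_pM => //; rewrite /r; lra.
have s2 : nm (k * dv f u + T) <= nm h * N + nm h * (p * A).
  apply: le_trans (nmD _ _) _; apply: lerD.
    by rewrite nmM; apply: ler_pM; rewrite ?nm_ge0.
  apply: le_trans HT _; rewrite expr2 mulrCA [_ * (p * A)]mulrA.
  rewrite [A * _]mulrC mulrA ler_wpM2r // ler_wpM2l // ltW //.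
have s3 : nm h * nm (k * dv f u + T) <= nm h * (nm h * N + nm h * (p * A)).
  by rewrite ler_wpM2l.
apply: le_trans (lerD s1 s3) _; rewrite le_eqVlt; apply/orP; left; apply/eqP; ring.
Qed.

Lemma hol_log R0 f : 0 < R0 -> hol_on R0 f -> (forall z, nm z < R0 -> f z != 0) ->
  exists k, forall z, nm z < R0 ->
    der idC k z (dv f z / f z) /\ f z = f 0 * cexp (k z).
Proof.
move=> R00 hf f0; pose q z := dv f z / f z.
have hq : hol_on R0 q.
  move=> z zR; have [l Hl] := hol_derivative hf zR.
  by eexists; exact: der_div (f0 z zR) Hl (hol_dv hf zR).
exists (primitive q) => z zR; split; first exact: der_primitive hq zR.
pose g w := f w * cexp (- primitive q w).
have dg w : nm w < R0 -> der idC g w 0.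
  move=> wR; have D := der_comp (derN (der_primitive hq wR)) (der_cexp _).
  apply: der_eq (derM (hol_dv hf wR) D).
  by rewrite /q; field; exact: f0.
have P0 : primitive q 0 = 0.
  rewrite /primitive (@IntE _ (fun=> 0)) ?ler01 ?subrr // => t _.
  by rewrite mul0r; exact: der_const.
have := const_on_disc dg zR; rewrite /g P0 oppr0 cexp0 mulr1 => <-.
by rewrite -mulrA -cexpD addNr cexp0 mulr1.
Qed.

Lemma der_cj (D : zmodType) (em : D -> C) (G : D -> C) x d :
  (forall y, cj (em y) = em y) -> der em G x d -> der em (fun y => cj (G y)) x (cj d).
Proof.
move=> emJ dG e e0; apply: nr_mono (dG _ e0) => h.
by rewrite -(nm_cj (G (x + h) - G x - _)) !cjD !cjN cjM emJ.
Qed.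

Lemma Int_cj (g : R -> C) (a b : R) : a <= b -> icont g a b ->
  Int (fun t => cj (g t)) a b = cj (Int g a b).
Proof.
move=> ab /IntP[G GP]; rewrite (IntE ab GP) (@IntE _ (fun t => cj (G t))) //.
  by rewrite cjD cjN.
by move=> x xab; apply: der_cj; [exact: cj_rc|exact: GP].
Qed.

Lemma mean_cj g r : 0 <= r -> ccont g r -> mean (fun z => cj (g z)) r = cj (mean g r).
Proof.
move=> r0 cg; rewrite /mean cjM (Int_cj (@twopi_ge0 R) (icont_circ r0 cg)) -rcV cj_rc //.
Qed.

(** The bound varies with [t], so the mean value theorem is applied to the real part of
    [cj D * P - nm D * Q], with primitives [P] of [g] and [Q] of the bound. *)
Lemma Int_dom (g : R -> C) (G : R -> R) (a b : R) : a <= b -> icont g a b ->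
  icont (fun t => rc (G t)) a b -> (forall t, a <= t <= b -> nm (g t) <= G t) ->
  nm (Int g a b) <= re (Int (fun t => rc (G t)) a b).
Proof.
move=> ab /IntP[P HP] /IntP[Q HQ] gG; rewrite (IntE ab HP) (IntE ab HQ).
set D := P b - P a.
have dpsi x : a <= x <= b -> is_derive x 1
    (fun t => re (cj D * P t - rc (nm D) * Q t)) (re (cj D * g x - rc (nm D) * rc (G x))).
  move=> xab.
  have := der_re 1 (derB (derZ (cj D) (HP x xab)) (derZ (rc (nm D)) (HQ x xab))).
  by rewrite mul1r; under eq_fun do rewrite mul1r.
have [||c /itvP cab] := @MVT_segment R (fun t => re (cj D * P t - rc (nm D) * Q t))
  (fun x => re (cj D * g x - rc (nm D) * rc (G x))) a b ab.
- by move=> x /itvP xab; apply: dpsi; rewrite !xab.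
- apply: derivable_within_continuous => x /itvP xab.
  by have [|] := dpsi x; first by rewrite !xab.
rewrite -reB => E.
have Ec : a <= c <= b by rewrite !cab.
have : re (cj D * g c - rc (nm D) * rc (G c)) <= 0.
  rewrite reB -rcM re_rc subr_le0; apply: le_trans (ler_norm _) _.
  by apply: le_trans (re_le_nm _) _; rewrite nmM nm_cj ler_wpM2l ?nm_ge0 // gG.
move=> Hc; have : re (cj D * P b - rc (nm D) * Q b - (cj D * P a - rc (nm D) * Q a)) <= 0.
  by rewrite E mulr_le0_ge0 // subr_ge0.
have -> : cj D * P b - rc (nm D) * Q b - (cj D * P a - rc (nm D) * Q a) =
  cj D * D - rc (nm D) * (Q b - Q a) by rewrite /D; ring.
have -> : re (cj D * D - rc (nm D) * (Q b - Q a)) = nm D * nm D - nm D * re (Q b - Q a).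
  by rewrite (mulrC (cj D)) mul_cj [LHS]reB [re (rc (nm D) * _)]reM !re_rc im_rc mul0r subr0 expr2.
rewrite subr_le0.
have [->|D0] := eqVneq D 0; last by rewrite ler_pM2l // nm_gt0.
rewrite nm0 => _.
have dQ x : a <= x <= b -> is_derive x 1 (fun t => re (Q t)) (G x).
  by move=> xab; have := der_re 1 (HQ x xab); rewrite mul1r; under eq_fun do rewrite mul1r.
have [||d /itvP dab] := @MVT_segment R (fun t => re (Q t)) G a b ab.
- by move=> x /itvP xab; apply: dQ; rewrite !xab.
- apply: derivable_within_continuous => x /itvP xab.
  by have [|] := dQ x; first by rewrite !xab.
have Ed : a <= d <= b by rewrite !dab.
rewrite reB => ->; rewrite mulr_ge0 ?subr_ge0 //.
exact: le_trans (nm_ge0 _) (gG d Ed).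
Qed.

Lemma mean_dom g (G : C -> R) r : 0 <= r -> ccont g r -> ccont (fun z => rc (G z)) r ->
  (forall z, nm z = r -> nm (g z) <= G z) ->
  nm (mean g r) <= re (mean (fun z => rc (G z)) r).
Proof.
move=> r0 cg cG gG; rewrite /mean -rcV reM re_rc im_rc mul0r subr0.
rewrite nmM nm_rc ger0_norm ?invr_ge0 ?twopi_ge0 // ler_wpM2l ?invr_ge0 ?twopi_ge0 //.
apply: (@Int_dom _ (fun t => G (circ r t))); rewrite ?twopi_ge0 //.
- exact: icont_circ.
- exact: icont_circ r0 cG.
- by move=> t _; apply: gG; exact: nm_circ.
Qed.

Lemma cont_cj g z : cont idC g z -> cont idC (fun y => cj (g y)) z.
Proof.
by move=> cg e e0; apply: nr_mono (cg e e0) => h; rewrite -cjN -cjD nm_cj.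
Qed.

Lemma cont_re g z : cont idC g z -> cont idC (fun y => rc (re (g y))) z.
Proof.
move=> cg e e0; apply: nr_mono (cg e e0) => h; apply: le_lt_trans.
by rewrite -rcB nm_rc -reB; exact: re_le_nm.
Qed.

Section SchwarzFormula.
Variables (R0 : R) (f : C -> C) (r : R).
Hypotheses (hf : hol_on R0 f) (rR : r < R0).

Let kernel_cj w z : nm z = r -> nm w < r ->
  cj (z / (z - w)) = rc (r ^+ 2) / (rc (r ^+ 2) - cj w * z).
Proof.
move=> zr wr; have z0 : z != 0.
  by rewrite -nm_gt0 zr; exact: le_lt_trans (nm_ge0 w) wr.
have zw := circ_neq0 wr zr.
have czw : cj z - cj w != 0 by rewrite -cjN -cjD -nm_eq0E nm_cj nm_eq0E.
have -> : rc (r ^+ 2) = z * cj z by rewrite mul_cj zr.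
have -> : cj (z / (z - w)) = cj z / (cj z - cj w).
  rewrite cjM; congr (_ * _); rewrite /cj [in LHS](conjc_inv (z - w)).
  by congr (_^-1); exact: rmorphB.
have -> : z * cj z - cj w * z = z * (cj z - cj w) by ring.
by field; rewrite ?z0 ?czw.
Qed.

(** On the circle the conjugate of the Cauchy kernel equals [r ^ 2 / (r ^ 2 - cj w * z)], which is
    holomorphic in the disc; the conjugated mean is thus the value at 0 of a holomorphic
    function. *)
Lemma mean_cj_kernel w : nm w < r ->
  mean (fun z => cj (f z) * (z / (z - w))) r = cj (f 0).
Proof.
move=> wr; have w0 := nm_ge0 w; have r0 : 0 < r := le_lt_trans w0 wr.
have cf := hol_ccont hf rR.
pose F z := f z * (rc (r ^+ 2) / (rc (r ^+ 2) - cj w * z)).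
(* A radius beyond [r] but short of the pole at distance [r ^ 2 / nm w]; this form also makes sense
   for [w = 0]. *)
pose R1 := Num.min R0 (2 * r ^+ 2 / (nm w + r)).
have wr0 : 0 < nm w + r by lra.
have rR1 : r < R1.
  rewrite /R1 lt_min rR /= ltr_pdivlMr //; nra.
have dn z : nm z < R1 -> rc (r ^+ 2) - cj w * z != 0.
  rewrite /R1 lt_min => /andP[_]; rewrite ltr_pdivlMr // => h.
  have z0 := nm_ge0 z.
  rewrite -nm_gt0; apply: lt_le_trans (nm_geB _ _).
  rewrite nm_rc ger0_norm ?sqr_ge0 // nmM nm_cj subr_gt0; nra.
have hF : hol_on R1 F.
  move=> z zR; have [|l Hl] := hf (z := z); first by move: zR; rewrite /R1 lt_min => /andP[].
  eexists; apply: derM Hl _.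
  apply: (der_div (f := fun=> rc (r ^+ 2)) (g := fun z => rc (r ^+ 2) - cj w * z)).
  - exact: dn.
  - exact: der_const.
  - by apply: derB; [exact: der_const|apply: derZ; exact: der_id].
have := cauchy_formula hF (w := 0) (r := r); rewrite nm0 => /(_ r0 rR1).
rewrite {2}/F mulr0 subr0 divff ?rc_eq0 ?expf_neq0 ?gt_eqF // mulr1 => <-.
rewrite -mean_cj ?(ltW r0) //; last first.
  apply: ccontM; first exact: hol_ccont hF rR1.
  by apply: ccont_kernel1; rewrite nm0.
apply: mean_ext; first exact: ltW.
move=> z zr; have z0 : z != 0 by rewrite -nm_gt0 zr.
rewrite subr0 divff // mulr1 /F cjM -(kernel_cj zr wr) cjK //.
Qed.

(** The means of [f] and of its conjugate against the Cauchy kernel add up to [f x + cj (f 0)],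
    expressed by the real part of [f]; the constant disappears on derivation. *)
Lemma schwarz_derivative w : nm w < r ->
  dv f w = mean (fun z => rc (2 * re (f z)) * (z / (z - w) ^+ 2)) r.
Proof.
move=> wr; have r0 : 0 < r := le_lt_trans (nm_ge0 w) wr.
have cf := hol_ccont hf rR.
have c2 : ccont (fun z => rc (2 * re (f z))) r.
  move=> z zr; apply: (@cont_ext _ _ _ (fun y => rc 2 * rc (re (f y)))).
    by move=> y; rewrite rcM.
  by apply: contM; [exact: cont_const|apply: cont_re; exact: cf].
have ccj : ccont (fun z => cj (f z)) r by move=> z zr; apply: cont_cj; exact: cf.
have E x : nm x < r -> mean (fun z => rc (2 * re (f z)) * (z / (z - x))) r = f x + cj (f 0).
  move=> xr; rewrite -(mean_cj_kernel xr) -(cauchy_formula hf xr rR).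
  rewrite -(meanD (ltW r0) (ccontM cf (ccont_kernel1 xr)) (ccontM ccj (ccont_kernel1 xr))).
  apply: mean_ext; first exact: ltW.
  by move=> z zr; rewrite -addr_cj mulrDl.
apply: dvE; have D := der_mean_kernel1 c2 wr.
have D2 : der idC (fun x => f x + cj (f 0)) w (mean (fun z => rc (2 * re (f z)) * (z / (z - w) ^+ 2)) r).
  refine (der_near _ _ D); first exact: E.
  by apply: nr_mono (nr_disc wr) => h hr; exact: E.
have := derB D2 (der_const _ (cj (f 0)) w); rewrite subr0.
by apply: der_ext => x; rewrite addrK.
Qed.

(** Constants have mean 0 against the derived kernel, so [2 re f] may be replaced by [2 (re f - L)],
    which has constant sign; its modulus has mean [2 (L - re (f 0))]. *)
Theorem borel_caratheodory w L : nm w < r ->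
  (forall z, nm z = r -> re (f z) <= L) ->
  nm (dv f w) <= 2 * (L - re (f 0)) * (r / (r - nm w) ^+ 2).
Proof.
move=> wr HL; have r0 : 0 < r := le_lt_trans (nm_ge0 w) wr.
have cf := hol_ccont hf rR.
have ck := ccont_kernel 2 wr.
have cre : ccont (fun z => rc (re (f z))) r by move=> z zr; apply: cont_re; exact: cf.
have c2 : ccont (fun z => rc (2 * re (f z))) r.
  move=> z zr; apply: (@cont_ext _ _ _ (fun y => rc 2 * rc (re (f y)))).
    by move=> y; rewrite rcM.
  by apply: contM; [exact: cont_const|exact: cre].
have cL : ccont (fun z => rc (2 * (L - re (f z)))) r.
  move=> z zr; apply: (@cont_ext _ _ _ (fun y => rc (2 * L) - rc (2 * re (f y)))).
    by move=> y; rewrite -rcB mulrBr.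
  by apply: contB; [exact: cont_const|exact: c2].
have K0 : mean (fun z => rc (2 * L) * (z / (z - w) ^+ 2)) r = 0.
  have h1 : hol_on (r + 1) (fun=> rc (2 * L)) by move=> z _; eexists; exact: der_const.
  rewrite -(cauchy_derivative h1 wr); last lra.
  by apply: dvE; exact: der_const.
have -> : dv f w = - mean (fun z => rc (2 * (L - re (f z))) * (z / (z - w) ^+ 2)) r.
  rewrite (schwarz_derivative wr); apply/eqP; rewrite eq_sym eqr_oppLR -sub0r -K0.
  rewrite -(meanB (ltW r0) (ccontM (@ccont_cst _ r _) ck) (ccontM c2 ck)); apply/eqP.
  apply: mean_ext; first exact: ltW.
  by move=> z zr; rewrite mulrBr rcB mulrBl.
rewrite nmN; set B := r / (r - nm w) ^+ 2.
have cB : ccont (fun z => rc (2 * (L - re (f z)) * B)) r.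
  move=> z zr; apply: (@cont_ext _ _ _ (fun y => rc (2 * (L - re (f y))) * rc B)).
    by move=> y; rewrite -rcM.
  by apply: contM; [exact: cL|exact: cont_const].
apply: le_trans (mean_dom (G := fun z => 2 * (L - re (f z)) * B) (ltW r0) _ cB _) _.
- exact: ccontM.
- move=> z zr; rewrite nmM nm_rc ger0_norm; last first.
    by rewrite mulr_ge0 // subr_ge0 HL.
  by rewrite ler_wpM2l ?nm_kernel // mulr_ge0 // subr_ge0 HL.
have mf : mean (fun z => rc (2 * re (f z))) r = rc (2 * re (f 0)).
  rewrite -addr_cj; have w0 : nm (0 : C) < r by rewrite nm0.
  rewrite -(mean_cj_kernel w0) -[f 0 in RHS](cauchy_formula hf w0 rR).
  have ccj : ccont (fun z => cj (f z)) r by move=> z zr; apply: cont_cj; exact: cf.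
  rewrite -(meanD (ltW r0) (ccontM cf (ccont_kernel1 w0)) (ccontM ccj (ccont_kernel1 w0))).
  apply: mean_ext; first exact: ltW.
  move=> z zr; have z0 : z != 0 by rewrite -nm_gt0 zr.
  by rewrite subr0 divff // !mulr1 addr_cj.
have -> : mean (fun z => rc (2 * (L - re (f z)) * B)) r = rc (2 * (L - re (f 0)) * B).
  have -> : rc (2 * (L - re (f 0)) * B) = rc B * (rc (2 * L) - rc (2 * re (f 0))).
    by rewrite -rcB -rcM; congr rc; ring.
  rewrite -mf -[in RHS](mean_cst r (rc (2 * L))).
  rewrite -(meanB (ltW r0) (@ccont_cst _ r _) c2).
  rewrite -(meanZ (ltW r0) _ (ccontB (@ccont_cst _ r _) c2)).
  apply: mean_ext; first exact: ltW.
  by move=> z zr; rewrite -rcB -rcM; congr rc; ring.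
exact: lexx.
Qed.

End SchwarzFormula.

End HolomorphicTools.

(** * Logarithmic derivatives away from zeros *)

Section LogarithmicDerivative.
Variable R : realType.
Local Notation C := (CC R).
Local Notation idC := (fun z : C => z).
Implicit Types (f g w : C -> C) (r : R) (z a : C).

(** The logarithmic derivative of the product of the Blaschke factors
    [r (z - a) / (r ^ 2 - cj a * z)]. *)
Definition pole_sum (r : R) (s : seq C) z : C :=
  \sum_(a <- s) ((z - a)^-1 + cj a / (rc (r ^+ 2) - cj a * z)).

Lemma blaschke_denom_ge a z r s : nm a <= r -> nm z <= s -> s <= r ->
  r * (r - s) <= nm (rc (r ^+ 2) - cj a * z).
Proof.
move=> ar zs sr; apply: le_trans (nm_geB _ _).
rewrite nm_rc ger0_norm ?sqr_ge0 // nmM nm_cj.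
have := nm_ge0 a; have := nm_ge0 z; nra.
Qed.

Lemma blaschke_denom_circle a z r : nm z = r ->
  nm (rc (r ^+ 2) - cj a * z) = r * nm (z - a).
Proof.
move=> zr; have -> : rc (r ^+ 2) - cj a * z = z * cj (z - a).
  by rewrite cjD cjN mulrBr mul_cj zr (mulrC z (cj a)).
by rewrite nmM nm_cj zr.
Qed.

(* Dividing out a zero [a] by a Blaschke factor multiplies the modulus at 0 by at
   least [q], so this has to stop, and counts the zeros on the way. *)
Lemma blaschke_extraction (R0 r' r q M : R) N g : 0 < r' -> r' < r -> r < R0 ->
  q * r' <= r -> 0 <= q -> hol_on R0 g -> g 0 != 0 ->
  (forall z, nm z = r -> nm (g z) <= M) -> M < nm (g 0) * q ^+ N ->
  exists s w, [/\ (size s <= N)%N, {in s, forall a, nm a <= r'}, hol_on R0 w,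
    (forall z, nm z <= r' -> w z != 0)
    & [/\ (forall z, nm z = r -> nm (w z) <= M), nm (g 0) <= nm (w 0) &
      forall z, nm z < r -> z \notin s -> w z != 0 ->
        g z != 0 /\ dv g z = g z * (dv w z / w z + pole_sum r s z)]].
Proof.
move=> r'0 r'r rR qr q0; have r0 := lt_trans r'0 r'r.
have r'R := lt_trans r'r rR.
elim: N g => [|N IH] g hg g0 gM MN.
  (* No factor [q] is left: [M < nm (g 0)] contradicts the maximum principle. *)
  exfalso; move: MN; rewrite expr0 mulr1; apply/negP; rewrite -leNgt.
  have M0 : 0 <= M by apply: le_trans (gM (rc r) _); rewrite ?nm_ge0 // nm_rc gtr0_norm.
  by apply: (max_principle hg _ rR M0 gM); rewrite nm0 ltW.
have [[a [ar ga]]|nz] := pselect (exists a, nm a <= r' /\ g a = 0); last first.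
  exists [::], g; split=> //; first by move=> z zr; apply/eqP => gz; apply: nz; exists z.
  split=> // z zr _ gz; split=> //.
  by rewrite /pole_sum big_nil addr0 mulrC divfK.
have a0 : a != 0 by apply: contraNneq g0 => E; move: ga; rewrite E => ->.
have na0 : 0 < nm a by rewrite nm_gt0.
have aR : nm a < R0 := le_lt_trans ar r'R.
have hq := hol_quo hg aR ga.
(* [w1] is [g] divided by the Blaschke factor of [a]: the modulus is unchanged on the circle, while
   at 0 it is multiplied by [r / nm a], at least [q]. *)
pose b z := (rc (r ^+ 2) - cj a * z) / rc r.
pose w1 z := quo g a z * b z.
have db z : der idC b z (- cj a / rc r).
  apply: der_eq (derM (derB (der_const _ (rc (r ^+ 2)) z) (derZ (cj a) (der_id z))) (der_const _ _ _)).
  by rewrite mulr0 addr0 mulr1 sub0r.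
have hw1 : hol_on R0 w1.
  by move=> z zR; have [l Hl] := hq z zR; eexists; exact: derM Hl (db z).
have rc0' : rc r != 0 by rewrite rc_eq0 gt_eqF.
have w10 : nm (w1 0) = nm (g 0) * (r / nm a).
  rewrite /w1 /b mulr0 subr0 nmM nm_div !nm_rc (gtr0_norm r0) ger0_norm ?sqr_ge0 //.
  rewrite (quoE 0 ga) nmM sub0r nmN; field; rewrite !gt_eqF //.
have [|z zr||s [w [sN sr hw wz [wM w0 Hw]]]] := IH w1 hw1.
- by rewrite -nm_eq0E w10 mulf_neq0 ?nm_eq0E // gt_eqF // divr_gt0.
- rewrite /w1 nmM nm_div (blaschke_denom_circle _ zr) nm_rc (gtr0_norm r0).
  have := gM z zr; rewrite (quoE z ga) nmM; congr (_ <= _).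
  by field; rewrite gt_eqF.
- apply: lt_le_trans MN _; rewrite w10 exprS mulrA ler_wpM2r ?exprn_ge0 //.
  rewrite ler_wpM2l ?nm_ge0 // ler_pdivlMr //; apply: le_trans qr.
  by rewrite ler_wpM2l.
exists (a :: s), w; split=> //.
  by move=> x; rewrite inE => /orP[/eqP->|/sr].
split=> //.
  apply: le_trans w0; rewrite w10 ler_peMr ?nm_ge0 // ler_pdivlMr // mul1r.
  exact: le_trans ar (ltW r'r).
move=> z zr; rewrite inE negb_or => /andP[za zs] wz0.
have [w1z Ew1] := Hw z zr zs wz0.
have za0 : z - a != 0 by rewrite subr_eq0.
have zR : nm z < R0 := lt_trans zr rR.
have bz : rc (r ^+ 2) - cj a * z != 0.
  rewrite -nm_gt0; apply: lt_le_trans (blaschke_denom_ge (le_trans ar (ltW r'r)) (lexx _) (ltW zr)).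
  by rewrite mulr_gt0 // subr_gt0.
have qz : quo g a z != 0 by apply: contraNneq w1z => qz; rewrite /w1 qz mul0r.
split; first by rewrite (quoE z ga) mulf_neq0.
have dq := hol_dv hq zR.
have Ew1' : dv w1 z = dv (quo g a) z * b z + quo g a z * (- cj a / rc r).
  by apply: dvE; exact: derM.
have Eg : dv g z = quo g a z + (z - a) * dv (quo g a) z.
  apply: dvE; apply: (@der_ext _ _ _ (fun z => (z - a) * quo g a z)).
    by move=> x; rewrite -quoE.
  by apply: der_eq (derM (der_subc a z) dq); rewrite mul1r.
have Edq : dv (quo g a) z = quo g a z * (dv w z / w z + pole_sum r s z + cj a / (rc (r ^+ 2) - cj a * z)).
  have bb : b z != 0 by rewrite mulf_neq0 // invr_neq0.
  apply: (mulIf bb); apply/eqP; rewrite -(inj_eq (addIr (quo g a z * (- cj a / rc r)))) -Ew1'.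
  rewrite Ew1 /w1 /b; apply/eqP; set X := dv w z / w z; set Y := pole_sum r s z.
  move: bz rc0'; set D := rc (r ^+ 2) - cj a * z; set rr := rc r; set ca := cj a.
  by move: D rr ca => D rr ca D0 rr0; field; rewrite ?D0 ?rr0.
rewrite Eg Edq (quoE z ga) /pole_sum big_cons -/(pole_sum r s z).
set X := dv w z / w z; set Y := pole_sum r s z.
move: bz; set D := rc (r ^+ 2) - cj a * z; set ca := cj a.
by move: D ca => D ca D0; field; rewrite ?za0 ?D0.
Qed.

(** This is Borel-Caratheodory for the logarithm of [w / w 0], whose real part is 0 at the origin
    and at most [L] on the circle. *)
Lemma zero_free_log_derivative (r r1 L : R) w z : 0 < r -> hol_on r w ->
  (forall z, nm z < r -> w z != 0) -> nm z < r1 -> r1 < r ->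
  (forall z, nm z = r1 -> nm (w z) <= nm (w 0) * expR L) ->
  nm (dv w z / w z) <= 2 * L * (r1 / (r1 - nm z) ^+ 2).
Proof.
move=> r0 hw w0 zr1 r1r HL.
have [k Hk] := hol_log r0 hw w0.
have hk : hol_on r k by move=> x xr; have [dk _] := Hk x xr; eexists; exact: dk.
have zr := lt_trans zr1 r1r.
have [dk _] := Hk z zr; rewrite -(dvE dk).
have n0 : nm (0 : C) < r by rewrite nm0.
have w00 := w0 _ n0.
have re0 : re (k 0) = 0.
  have [_ E] := Hk 0 n0; have : cexp (k 0) = 1.
    by apply: (mulfI w00); rewrite -E mulr1.
  move=> /(congr1 (@nm R)); rewrite nm_cexp nm1 => h.
  by apply: expR_inj; rewrite h expR0.
have := borel_caratheodory hk r1r zr1 (L := L); rewrite re0 subr0; apply.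
move=> y yr1; have [|_ E] := Hk y; first by rewrite yr1.
by have := HL y yr1; rewrite E nmM nm_cexp ler_pM2l ?nm_gt0 // ler_expR.
Qed.

(** Pigeonhole: the candidates are [2 h] apart, so a point of [s] excludes at most one of them, and
    there is one candidate more than points. *)
Lemma avoid_points (s : seq R) (x h : R) : 0 < h ->
  exists2 j : nat, (j <= size s)%N & {in s, forall y : R, h <= `|x + 2 * h * j%:R - y|}.
Proof.
move=> h0; apply: contrapT => H.
have bad (j : 'I_(size s).+1) : exists i : 'I_(size s), `|x + 2 * h * j%:R - s`_i| < h.
  apply: contrapT => nb; apply: H; exists j; first by rewrite -ltnS.
  move=> a /(nthP 0)[i ilt <-]; rewrite leNgt; apply/negP => hi.
  by apply: nb; exists (Ordinal ilt).
have [F HF] := choice bad.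
have inj : injective F.
  move=> i j Fij; have := HF i; have := HF j; rewrite Fij => h1 h2.
  have h3 : `|2 * h * (i%:R - j%:R)| < 2 * h.
    have -> : 2 * h * (i%:R - j%:R) = (x + 2 * h * i%:R - s`_(F j)) - (x + 2 * h * j%:R - s`_(F j)) by ring.
    apply: le_lt_trans (ler_normB _ _) _; lra.
  rewrite normrM gtr0_norm in h3; last lra.
  have h4 : `|(i%:R - j%:R : R)| < 1 by rewrite -(ltr_pM2l (x := 2 * h)) ?mulr1 //; lra.
  apply/val_inj => /=; move: h4; rewrite ltr_norml => /andP[h5 h6].
  apply/eqP; rewrite eqn_leq; apply/andP; split; rewrite -ltnS -(ltr_nat R) -natr1; lra.
by have := leq_card F inj; rewrite !card_ord ltnn.
Qed.

Definition entire1 f := forall z, exists l, der idC f z l.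

Lemma entire1_hol f R0 : entire1 f -> hol_on R0 f.
Proof. by move=> ef z _; exact: ef. Qed.

Lemma bernoulli_pow2 (p : nat) : (0 < p)%N -> 2 <= (1 + p%:R^-1 : R) ^+ p.
Proof.
move=> p0; have x0 : 0 < (p%:R^-1 : R) by rewrite invr_gt0 ltr0n.
have B (n : nat) : 1 + n%:R * p%:R^-1 <= (1 + p%:R^-1 : R) ^+ n.
  elim: n => [|n IH]; first by rewrite expr0; lra.
  rewrite exprS -natr1.
  have n0 : 0 <= n%:R * (p%:R^-1 : R) by rewrite mulr_ge0 // ltW.
  nra.
have := B p; rewrite divff ?pnatr_eq0 -?lt0n //; lra.
Qed.

(* [s] lists the moduli of the zeros and [d] is the distance to be kept from them. *)
Lemma log_derivative_off_zeros g (c : nat) : entire1 g -> g 0 != 0 ->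
  1 <= nm (g 0) * 2 ^+ c -> forall (L p : nat) r, (0 < p)%N -> 0 < r ->
  (forall z, nm z = r * (1 + 3 / p%:R) -> nm (g z) <= 2 ^+ L) ->
  exists2 s : seq R, (size s <= (p + 2) * (L + c).+1)%N &
    forall (d : R) z, 0 < d -> {in s, forall y : R, d <= `|nm z - y|} ->
      nm z <= r * (1 + 1 / p%:R) ->
      g z != 0 /\ nm (dv g z) <= nm (g z) *
        (20 * (L + c).+1%:R * p%:R ^+ 2 / r
         + ((p + 2) * (L + c).+1)%N%:R * (d^-1 + p%:R / r)).
Proof.
move=> eg g0 gc L p r p0 r0 gL; set N := ((p + 2) * (L + c).+1)%N.
have P0 : 0 < p%:R :> R by rewrite ltr0n.
have P1 : 1 <= p%:R :> R by rewrite ler1n.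
have Pi : 0 < (p%:R^-1 : R) by rewrite invr_gt0.
have Pi1 : (p%:R^-1 : R) <= 1 by rewrite invf_le1.
set x := (p%:R^-1 : R) in Pi Pi1.
(* With [x = 1 / p], three nested radii: the estimate is made up to [r (1 + x)], zeros are divided
   out up to [r'], and [g] is bounded on the circle [rr]. *)
pose r' := r * (1 + 2 * x); pose rr := r * (1 + 3 * x).
have r'0 : 0 < r' by rewrite mulr_gt0 //; lra.
have r'rr : r' < rr by rewrite /r' /rr ltr_pM2l //; lra.
have rr0 : 0 < rr by lra.
(* Chosen so that [q * r' = rr]; by Bernoulli [q ^ (p + 2) >= 2], hence [q ^ N] reaches
   [2 ^ (L + c).+1]. *)
pose q := 1 + (p + 2)%:R^-1 : R.
have p2 : 0 < (p + 2)%:R :> R by rewrite ltr0n addn2.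
have q0 : 0 <= q by rewrite /q addr_ge0 // invr_ge0 ltW.
have qr : q * r' <= rr.
  rewrite le_eqVlt; apply/orP; left; apply/eqP; rewrite /q /r' /rr /x natrD.
  by field; rewrite gt_eqF //= gt_eqF // addr_gt0.
have ML : nm (g 0) * 2 ^+ (L + c).+1 = 2 ^+ L * (2 * (nm (g 0) * 2 ^+ c)).
  by rewrite exprS exprD; ring.
have MN : 2 ^+ L < nm (g 0) * q ^+ N.
  have q2 : 2 ^+ (L + c).+1 <= q ^+ N.
    rewrite /N exprM; apply: lerXn2r; rewrite ?nnegrE ?exprn_ge0 //.
    by apply: bernoulli_pow2; rewrite addn2.
  apply: lt_le_trans (_ : nm (g 0) * 2 ^+ (L + c).+1 <= _); last first.
    by rewrite ler_wpM2l ?nm_ge0.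
  by rewrite ML ltr_pMr ?exprn_gt0 //; lra.
have [|s [w [sN sr hw wz [wM w0 Hw]]]] :=
    @blaschke_extraction (rr + 1) r' rr q (2 ^+ L) N g r'0 r'rr _ qr q0 (@entire1_hol g (rr + 1) eg) g0 gL MN.
  by lra.
exists [seq nm a | a <- s]; first by rewrite size_map.
move=> d z d0 dz zr.
have zr' : nm z < r'.
  by apply: le_lt_trans zr _; rewrite /r' ltr_pM2l // div1r -/x; lra.
have zs : z \notin s.
  apply/negP => zs; have := dz (nm z); rewrite subrr normr0 => h.
  by have := h (map_f _ zs); lra.
have [gz ->] := Hw z (lt_trans zr' r'rr) zs (wz z (ltW zr')).
split=> //.
rewrite nmM ler_wpM2l ?nm_ge0 //; apply: le_trans (nmD _ _) _; apply: lerD.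
  (* Halfway between [r (1 + x)] and [r'], inside the disc where [w] has no zeros. *)
  pose r1 := r * (1 + 3 / 2 * x).
  have r1r' : r1 < r' by rewrite /r1 /r' ltr_pM2l //; lra.
  have zr1 : nm z <= r1 - r * x / 2.
    by apply: le_trans zr _; rewrite /r1 div1r -/x; nra.
  have rx : 0 < r * x by rewrite mulr_gt0.
  have zr1' : nm z < r1 by lra.
  pose L1 := (L + c).+1%:R : R.
  have L10 : 0 < L1 by rewrite /L1 ltr0n.
  have bw y : nm y = r1 -> nm (w y) <= nm (w 0) * expR L1.
    move=> yr1.
    have wL : nm (w y) <= 2 ^+ L.
      apply: (max_principle (r := rr) hw); rewrite ?exprn_ge0 //; last lra.
      by rewrite yr1; lra.
    apply: le_trans wL _; apply: le_trans (_ : nm (g 0) * expR L1 <= _); last first.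
      by rewrite ler_wpM2r // expR_ge0.
    have e2 : 2 ^+ (L + c).+1 <= expR L1 :> R.
      rewrite /L1 -[X in expR X]mulr1 expRM_natl; apply: lerXn2r; rewrite ?nnegrE ?expR_ge0 //.
      by have := expR_ge1Dx (1 : R); rewrite -[1 + 1]/(2 : R).
    apply: le_trans (_ : nm (g 0) * 2 ^+ (L + c).+1 <= _); last by rewrite ler_wpM2l ?nm_ge0.
    by rewrite ML ler_pMr ?exprn_gt0 //; lra.
  have hw' : hol_on r' w by move=> y yr; apply: hw; lra.
  apply: le_trans (zero_free_log_derivative r'0 hw' (fun y yr => wz y (ltW yr)) zr1' r1r' bw) _.
  have -> : 20 * L1 * p%:R ^+ 2 / r = 2 * L1 * (5 / 2 * r / (r * x / 2) ^+ 2).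
    by rewrite /x; field; rewrite !gt_eqF.
  rewrite ler_wpM2l //; first lra.
  apply: ler_pM.
  - by rewrite /r1 mulr_ge0 ?(ltW r0) //; lra.
  - by rewrite invr_ge0 sqr_ge0.
  - by rewrite /r1 [leRHS]mulrC ler_wpM2l ?(ltW r0) //; lra.
  rewrite lef_pV2 ?posrE ?exprn_gt0 ?divr_gt0 //; last by rewrite subr_gt0.
  apply: lerXn2r; rewrite ?nnegrE; lra.
rewrite /pole_sum.
have main : nm (\sum_(a <- s) ((z - a)^-1 + cj a / (rc (rr ^+ 2) - cj a * z))) <=
    (size s)%:R * (d^-1 + p%:R / r).
  elim: s {sN Hw zs} sr dz => [|a s IH] sr dz; first by rewrite big_nil nm0 mul0r.
  rewrite big_cons [size _]/= -natr1 mulrDl mul1r [leRHS]addrC.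
  apply: le_trans (nmD _ _) _; apply: lerD; last first.
    apply: IH => [b bs|b bs]; first by apply: sr; rewrite inE bs orbT.
    by apply: dz; rewrite inE bs orbT.
  have ar' : nm a <= r' by apply: sr; rewrite mem_head.
  have dza : d <= nm (z - a).
    apply: le_trans (nm_dist _ _); apply: dz; exact: mem_head.
  apply: le_trans (nmD _ _) _; apply: lerD.
    rewrite nmV lef_pV2 ?posrE //; exact: lt_le_trans dza.
  rewrite nm_div nm_cj.
  have a1 := blaschke_denom_ge (le_trans ar' (ltW r'rr)) (ltW zr') (ltW r'rr).
  have rrr' : rr - r' = r * x by rewrite /rr /r'; ring.
  have D0 : 0 < rr * (rr - r') by rewrite mulr_gt0 // subr_gt0.
  apply: le_trans (_ : rr / (rr * (rr - r')) <= _).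
    apply: ler_pM; rewrite ?nm_ge0 ?invr_ge0 ?nm_ge0 //; first lra.
    by rewrite lef_pV2 ?posrE //; exact: lt_le_trans a1.
  rewrite rrr' /x le_eqVlt; apply/orP; left; apply/eqP; field.
  by rewrite !gt_eqF.
apply: le_trans main _; rewrite ler_wpM2r ?ler_nat //.
by rewrite addr_ge0 // ?invr_ge0 ?divr_ge0 // ltW.
Qed.

End LogarithmicDerivative.

(** * Finiteness of zeros and choice of circles *)

Section ZerosAndGoodCircles.
Variable R : realType.
Local Notation C := (CC R).
Local Notation idC := (fun z : C => z).
Implicit Types (f g w : C -> C) (r : R) (z a c : C).

Lemma succ_add_leq (L c : nat) : ((L + c).+1 <= c.+1 * L.+1)%N.
Proof. nia. Qed.

Lemma zero_count_bound (T p m : nat) : (0 < T)%N -> (0 < p)%N ->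
  (20 * T * p ^ 2 + (p + 2) * T * (2 * p * (m * ((p + 2) * T)).+1 + p) <=
   (29 + 18 * m) * (T ^ 2 * p ^ 3))%N.
Proof.
move=> T0 p0.
have TT : (T <= T ^ 2)%N by rewrite -[X in (X <= _)%N]expn1 leq_pexp2l.
have pp : (p ^ 2 <= p ^ 3)%N by rewrite leq_pexp2l.
have : (20 * T * p ^ 2 <= 20 * (T ^ 2 * p ^ 3))%N.
  by rewrite -mulnA; apply: leq_mul => //; apply: leq_mul.
have : ((p + 2) * T * (2 * p * (m * ((p + 2) * T)).+1 + p) <= (9 + 18 * m) * (T ^ 2 * p ^ 3))%N.
  have h1 : (p + 2 <= 3 * p)%N by lia.
  apply: leq_trans (_ : 3 * p * T * (2 * p * (m * (3 * p * T) + 1) + p) <= _)%N.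
    have h2 : ((p + 2) * T <= 3 * p * T)%N by exact: leq_mul.
    rewrite -[(m * _).+1]addn1; apply: leq_mul => //; rewrite leq_add2r; apply: leq_mul => //.
    by rewrite leq_add2r; exact: leq_mul.
  have -> : (3 * p * T * (2 * p * (m * (3 * p * T) + 1) + p) =
      18 * m * (T ^ 2 * p ^ 3) + 9 * (T * p ^ 2))%N by rewrite !expnS !expn0; lia.
  by rewrite mulnDl addnC leq_add2r; apply: leq_mul => //; apply: leq_mul.
lia.
Qed.

Lemma pow2_unbounded (x : R) : exists n, x < 2 ^+ n.
Proof.
exists (Num.truncn `|x|).+1; apply: le_lt_trans (ler_norm _) _.
have /andP[_ h] := truncn_itv (normr_ge0 x).
apply: lt_le_trans h _; rewrite -natrX ler_nat; exact: ltnW (ltn_expl _ _).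
Qed.

(** Blaschke extraction with [q = 2]: every zero divided out at least doubles the modulus at 0,
    which is bounded. *)
Lemma zeros_finite g r : entire1 g -> g 0 != 0 ->
  exists s : seq C, forall z, nm z <= r -> g z = 0 -> z \in s.
Proof.
move=> eg g0; pose r' := `|r| + 1; pose rr := 2 * r'.
have r'0 : 0 < r' by rewrite /r'; have := normr_ge0 r; lra.
have hg : hol_on (rr + 1) g by exact: entire1_hol.
have [M M0 HM] : exists2 M : R, 0 < M & forall z, nm z <= rr -> nm (g z) <= M.
  apply: (hol_bounded hg); rewrite /rr; lra.
have [N HN] := pow2_unbounded (M / nm (g 0)).
have [||||||s [w [_ _ _ wz [_ _ Hw]]]] := @blaschke_extraction R (rr + 1) r' rr 2 M N g r'0 _ _ _ _ hg g0.
- by rewrite /rr; lra.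
- by lra.
- exact: lexx.
- by [].
- by move=> z hz; apply: HM; rewrite hz.
- by move: HN; rewrite ltr_pdivrMr ?nm_gt0 // mulrC.
exists s => z zr gz; apply: contraT => zs.
have zr' : nm z <= r' by rewrite /r'; have := ler_norm r; lra.
have zrr : nm z < rr by rewrite /rr; lra.
by have [] := Hw z zrr zs (wz z zr'); rewrite gz eqxx.
Qed.

Lemma der_shift f a z l : der idC f (z + a) l -> der idC (fun y => f (y + a)) z l.
Proof.
by move=> df e e0; apply: nr_mono (df e e0) => h; rewrite (addrAC z a h).
Qed.

Lemma entire1_shift f a : entire1 f -> entire1 (fun y => f (y + a)).
Proof. by move=> ef z; have [l Hl] := ef (z + a); exists l; exact: der_shift. Qed.

Lemma entire1_dv f z : entire1 f -> der idC f z (dv f z).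
Proof. by move=> ef; have [l Hl] := ef z; rewrite (dvE Hl). Qed.

Lemma entire1_derivative f : entire1 f -> entire1 (dv f).
Proof.
move=> ef z; apply: (hol_derivative (@entire1_hol R f (nm z + 1) ef)).
by rewrite ltrDl ltr01.
Qed.

Lemma entire1_cont f z : entire1 f -> cont idC f z.
Proof. by move=> ef; have [l] := ef z; exact: der_cont. Qed.

Lemma entire1D f g : entire1 f -> entire1 g -> entire1 (fun z => f z + g z).
Proof. by move=> ef eg z; eexists; apply: derD; exact: entire1_dv. Qed.
Lemma entire1B f g : entire1 f -> entire1 g -> entire1 (fun z => f z - g z).
Proof. by move=> ef eg z; eexists; apply: derB; exact: entire1_dv. Qed.
Lemma entire1M f g : entire1 f -> entire1 g -> entire1 (fun z => f z * g z).
Proof. by move=> ef eg z; eexists; apply: derM; exact: entire1_dv. Qed.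
Lemma entire1_cst c : entire1 (fun=> c).
Proof. by move=> z; eexists; exact: der_const. Qed.
Lemma entire1X f n : entire1 f -> entire1 (fun z => f z ^+ n).
Proof. by move=> ef z; eexists; apply: derX; exact: entire1_dv. Qed.
Lemma entire1V f : entire1 f -> (forall z, f z != 0) -> entire1 (fun z => (f z)^-1).
Proof. by move=> ef f0 z; eexists; apply: derV => //; exact: entire1_dv. Qed.

Lemma generic_point (n : nat) (G : nat -> C -> C) :
  (forall i, (i < n)%N -> entire1 (G i) /\ exists z, G i z != 0) ->
  exists z, forall i, (i < n)%N -> G i z != 0.
Proof.
elim: n => [|n IH] HG; first by exists 0.
have [z0 Hz0] := IH (fun i ilt => HG i (ltnW ilt)).
have [eg [z1 gz1]] := HG n (ltnSn n).
have [d d0 Hd] : exists2 d : R, 0 < d & forall h, nm h < d ->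
    forall i, (i < n)%N -> G i (z0 + h) != 0.
  elim: (n) HG Hz0 {IH eg gz1} => [|m IHm] HG Hz0; first by exists 1.
  have [d d0 Hd] := IHm (fun i ilt => HG i (ltnW ilt)) (fun i ilt => Hz0 i (ltnW ilt)).
  have [em _] := HG m (leqW (ltnSn m)).
  have gm0 : 0 < nm (G m z0) by rewrite nm_gt0 Hz0.
  have [d' d'0 Hd'] := entire1_cont z0 em gm0.
  exists (Num.min d d'); first by rewrite lt_min d0.
  move=> h; rewrite lt_min => /andP[h1 h2] i; rewrite ltnS leq_eqVlt => /orP[/eqP->|ilt].
    have := Hd' h h2; apply: contraTneq => ->; rewrite sub0r nmN ltxx //.
  exact: Hd.
have eg1 := entire1_shift z1 eg.
have [|s Hs] := zeros_finite (nm (z0 - z1) + d) eg1; first by rewrite add0r.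
(* Infinitely many points close to [z0], of which only finitely many can be zeros of [G n]. *)
pose pnt (k : nat) := z0 + rc (d / k.+2%:R).
have inj : injective (fun k => pnt k - z1).
  move=> i j /addIr /addrI /rc_inj /(mulfI (lt0r_neq0 d0)) /invr_inj /eqP.
  by rewrite eqr_nat => /eqP [].
have small k : nm (rc (d / k.+2%:R)) < d.
  rewrite nm_rc ger0_norm; last by rewrite divr_ge0 // ltW.
  by rewrite ltr_pdivrMr ?ltr0n // ltr_pMr // ltr1n.
have [k Hk] : exists k, G n (pnt k) != 0.
  apply: contrapT => H.
  have Hin k : pnt k - z1 \in s.
    apply: Hs.
      have -> : pnt k - z1 = (z0 - z1) + rc (d / k.+2%:R) by rewrite /pnt; ring.
      by apply: le_trans (nmD _ _) _; rewrite lerD2l ltW.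
    rewrite subrK; apply/eqP; apply: contraT => Hk; exfalso; apply: H; by exists k.
  have u : uniq [seq pnt k - z1 | k <- iota 0 (size s).+1].
    by rewrite map_inj_uniq ?iota_uniq.
  have := uniq_leq_size u (s2 := s); rewrite size_map size_iota => H'.
  have : ((size s).+1 <= size s)%N by apply: H' => x /mapP[k _ ->].
  by rewrite ltnn.
exists (pnt k) => i; rewrite ltnS leq_eqVlt => /orP[/eqP->//|ilt].
by apply: Hd.
Qed.

(** The identity theorem, in the form in which it serves later. *)
Lemma entire1_mul_eq0 f g : entire1 f -> entire1 g -> (forall z, f z * g z = 0) ->
  (forall z, f z = 0) \/ (forall z, g z = 0).
Proof.
move=> ef eg fg; have [|nf] := pselect (forall z, f z = 0); first by left.
have [|ng] := pselect (forall z, g z = 0); first by right.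
have nz k : ~ (forall z, k z = 0) -> exists z : C, k z != 0 :> C.
  by move=> H; apply: contrapT => H'; apply: H => z; apply/eqP; apply: contraT => kz;
    exfalso; apply: H'; exists z.
have [[|[|//]]|z Hz] := @generic_point 2 (fun i => if i == 0%N then f else g).
- by move=> _; split => //; exact: nz.
- by move=> _; split => //; exact: nz.
have := Hz 0%N isT; have := Hz 1%N isT; move=> /= gz fz.
by have /eqP := fg z; rewrite mulf_eq0 (negbTE gz) (negbTE fz).
Qed.

(** Zeros are counted against the value at 0, which must therefore not vanish; translating to a
    generic point brings a finite family to this form. *)
Definition zero_or_centered g := (forall z, g z = 0) \/ g 0 != 0.

(** The moduli of the zeros of all [m] functions are avoided at once. The annulus, of width [r / p],
    is shared out among at most [m * N] forbidden moduli, so the loss is polynomial in [L] and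
    [p]. *)
Lemma good_circle (m : nat) (G : nat -> C -> C) :
  (forall i, (i < m)%N -> entire1 (G i) /\ zero_or_centered (G i)) ->
  exists K : nat, forall (L p : nat) r, (0 < p)%N -> 0 < r ->
    (forall i z, (i < m)%N -> nm z <= r * (1 + 3 / p%:R) -> nm (G i z) <= 2 ^+ L) ->
    exists2 rho : R, r <= rho <= r * (1 + 1 / p%:R) &
      forall i z, (i < m)%N -> nm z = rho ->
        ((exists z, G i z != 0) -> G i z != 0) /\
        nm (dv (G i) z) * r <= (K * L.+1 ^ 2 * p ^ 3)%N%:R * nm (G i z).
Proof.
move=> HG.
(* [2 ^ - c] bounds from below the moduli at 0 of all members that are not identically zero. *)
have [c Hc] : exists c : nat, forall i, (i < m)%N -> (forall z, G i z = 0) \/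
    (G i 0 != 0 /\ 1 <= nm (G i 0) * 2 ^+ c).
  elim: m HG => [|n IH] HG; first by exists 0%N.
  have [c Hc] := IH (fun i ilt => HG i (ltnW ilt)).
  have [_ [z0|g0]] := HG n (ltnSn n).
    by exists c => i; rewrite ltnS leq_eqVlt => /orP[/eqP->|/Hc//]; left.
  have g00 : 0 < nm (G n 0) by rewrite nm_gt0.
  have [k Hk] := pow2_unbounded (nm (G n 0))^-1.
  exists (maxn c k) => i; rewrite ltnS leq_eqVlt => /orP[/eqP->|/Hc [|[h1 h2]]].
  - right; split=> //; have : (nm (G n 0))^-1 <= 2 ^+ maxn c k.
      by apply: le_trans (ltW Hk) _; rewrite ler_eXn2l ?leq_maxr // ltr1n.
    by move=> h; have := ler_wpM2l (ltW g00) h; rewrite divff // gt_eqF.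
  - by left.
  right; split=> //; apply: le_trans h2 _; rewrite ler_wpM2l ?nm_ge0 //.
  by rewrite ler_eXn2l ?leq_maxl // ltr1n.
exists ((29 + 18 * m) * c.+1 ^ 2)%N => L p r p0 r0 GL.
have P0 : 0 < p%:R :> R by rewrite ltr0n.
set T := (L + c).+1; set N := ((p + 2) * T)%N.
pose good (s : seq R) (g : C -> C) := (size s <= N)%N /\
  forall (d : R) z, 0 < d -> {in s, forall y : R, d <= `|nm z - y|} ->
      nm z <= r * (1 + 1 / p%:R) -> ((exists z, g z != 0) -> g z != 0) /\
      nm (dv g z) <= nm (g z) * (20 * T%:R * p%:R ^+ 2 / r + N%:R * (d^-1 + p%:R / r)).
have Hs i : exists s : seq R, (i < m)%N -> good s (G i).
  have [im|] := boolP (i < m)%N; last by exists [::].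
  have [eg _] := HG i im; have [g0|[g0 gc]] := Hc i im.
    exists [::] => _; split=> // d z _ _ _; split; first by move=> [x]; rewrite g0 eqxx.
    have -> : dv (G i) z = 0.
      by apply: dvE; apply: (@der_ext _ _ _ (fun=> 0)) => [x|]; [rewrite g0|exact: der_const].
    by rewrite g0 nm0 mul0r.
  have [|s sN Hs] := log_derivative_off_zeros eg g0 gc p0 r0 (L := L).
    by move=> z hz; apply: GL => //; rewrite hz.
  exists s => _; split=> // d z d0 dz zr; have [g1 g2] := Hs d z d0 dz zr.
  by split.
have [S HS] := choice Hs.
pose s := flatten [seq S i | i <- iota 0 m].
have sN : (size s <= m * N)%N.
  have flat (l : seq nat) : (forall i, i \in l -> (size (S i) <= N)%N) ->
      (size (flatten [seq S i | i <- l]) <= size l * N)%N.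
    elim: l => [|i l IH] //= H; rewrite size_cat mulSn leq_add //.
      by apply: H; rewrite mem_head.
    by apply: IH => x xl; apply: H; rewrite inE xl orbT.
  rewrite /s -{2}(size_iota 0 m); apply: flat => i.
  by rewrite mem_iota add0n => /andP[_ im]; have [] := HS i im.
(* With this [h] the [M] candidates, [2 h] apart, fill the annulus: [2 * h * M = r / p]. *)
pose M := (m * N).+1; pose h := r / (2 * p%:R * M%:R).
have M0 : 0 < M%:R :> R by rewrite ltr0n.
have h0 : 0 < h by rewrite divr_gt0 // !mulr_gt0.
have [j js Hj] := avoid_points s (r + h) h0.
pose rho := r + h + 2 * h * j%:R.
have jM : j%:R <= M%:R - 1 :> R.
  by rewrite /M -natr1 addrK ler_nat; exact: leq_trans js sN.
have j0 : 0 <= j%:R :> R by rewrite ler0n.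
have hM : 2 * h * M%:R = r / p%:R by rewrite /h; field; rewrite !gt_eqF.
have rho1 : r <= rho by rewrite /rho; nra.
have rho2 : rho <= r * (1 + 1 / p%:R).
  rewrite mulrDr mulr1 mulrA mulr1 -hM /rho; nra.
exists rho; first by rewrite rho1.
move=> i z im zr; have [Si Hi] := HS i im.
have [||g1 g2] := Hi h z h0 _ _.
- move=> y ys; rewrite zr; apply: Hj; rewrite /s; apply/flattenP.
  by exists (S i) => //; apply: map_f; rewrite mem_iota add0n.
- by rewrite zr.
split=> //; rewrite mulrC; apply: le_trans (_ : r * (nm (G i z) * _) <= _).
  by rewrite ler_wpM2l ?(ltW r0) //; exact: g2.
rewrite mulrCA [leRHS]mulrC ler_wpM2l ?nm_ge0 //.
have -> : r * (20 * T%:R * p%:R ^+ 2 / r + N%:R * (h^-1 + p%:R / r)) =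
   (20 * T * p ^ 2 + N * (2 * p * M + p))%N%:R.
  rewrite /h natrD !natrM [(_ + p)%:R]natrD [(p + 2)%:R]natrD !natrM; field; rewrite !gt_eqF //.
rewrite ler_nat.
have T2 : (T ^ 2 <= c.+1 ^ 2 * L.+1 ^ 2)%N by rewrite -expnMn leq_exp2r ?succ_add_leq.
apply: leq_trans (_ : (29 + 18 * m) * (T ^ 2 * p ^ 3) <= _)%N; last first.
  have -> : ((29 + 18 * m) * c.+1 ^ 2 * L.+1 ^ 2 * p ^ 3 =
      (29 + 18 * m) * (c.+1 ^ 2 * L.+1 ^ 2 * p ^ 3))%N by rewrite !mulnA.
  by apply: leq_mul => //; apply: leq_mul.
exact: zero_count_bound.
Qed.

End ZerosAndGoodCircles.

(** * Growth windows and small functions *)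

Section Windows.
Variable R : realType.

(* Otherwise the maximal radius for the bound number [k] would grow at most by the
   factor [1 + 1 / k ^ 2] at each step, hence stay bounded. *)
Lemma windows_exist (P : nat -> R -> Prop) (K0 : nat) :
  (forall k x y, P k x -> y <= x -> P k y) ->
  (forall k k' x, P k x -> (k <= k')%N -> P k' x) ->
  (forall x, exists k, P k x) -> (forall k, exists B, forall x, P k x -> x <= B) ->
  exists k x, [/\ (K0 <= k)%N, (1 < k)%N, 1 <= x,
    (forall y, y < x * (1 + 1 / k%:R ^+ 2) -> P k.+1 y)
    & (forall y, x < y -> ~ P k y)].
Proof.
move=> Pd Pm Pex Pb; apply: contrapT => H.
have [k1 Hk1] := Pex 1.
pose K := maxn K0 (maxn k1 2).
have KK0 : (K0 <= K)%N by rewrite leq_maxl.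
have Kk1 : (k1 <= K)%N by rewrite /K !leq_max leqnn orbT.
have K2 : (2 <= K)%N by rewrite /K !leq_max leqnn !orbT.
pose r k := sup [set x | P k x].
have hs k : (K <= k)%N -> has_sup [set x | P k x].
  move=> Kk; split; first by exists 1; apply: Pm Hk1 _; exact: leq_trans Kk.
  by have [B HB] := Pb k; exists B => x; exact: HB.
have r1 k : (K <= k)%N -> 1 <= r k.
  move=> Kk; apply: (sup_upper_bound (hs k Kk)).
  by apply: Pm Hk1 _; exact: leq_trans Kk.
have below k y : (K <= k)%N -> y < r k -> P k y.
  move=> Kk yr; have e0 : 0 < r k - y by rewrite subr_gt0.
  have [x Px] := sup_adherent e0 (hs k Kk); rewrite -/(r k) opprB addrC subrK => /ltW.
  exact: Pd Px.
have above k y : (K <= k)%N -> r k < y -> ~ P k y.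
  move=> Kk ry Py; have := sup_upper_bound (hs k Kk) Py.
  by rewrite -/(r k) leNgt ry.
(* The factor [k / (k - 1)] absorbs the growth by [1 + 1 / k ^ 2]: without windows [u] is
   nonincreasing from [K] on, so [r k <= u k <= u K]. *)
pose u k := r k * (k%:R / (k%:R - 1)).
have step k : (K <= k)%N -> r k.+1 < r k * (1 + 1 / k%:R ^+ 2).
  move=> Kk; rewrite ltNge; apply/negP => hr; apply: H; exists k, (r k); split.
  - exact: leq_trans Kk.
  - exact: leq_trans Kk.
  - exact: r1.
  - by move=> y yr; apply: below; [exact: leqW|exact: lt_le_trans hr].
  - by move=> y; exact: above.
have kR k : (K <= k)%N -> 2 <= k%:R :> R by move=> Kk; rewrite ler_nat (leq_trans K2).
have udec k : (K <= k)%N -> u k.+1 <= u k.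
  move=> Kk; have k2 := kR k Kk; have rk := r1 k Kk; have st := step k Kk.
  rewrite /u -natr1 addrK.
  set x := k%:R in k2 st *.
  have p1 : 0 < (x + 1) / x by rewrite divr_gt0 //; lra.
  apply: le_trans (_ : r k * (1 + 1 / x ^+ 2) * ((x + 1) / x) <= _).
    by rewrite ler_pM2r // ltW.
  rewrite -mulrA ler_wpM2l //; first lra.
  rewrite -subr_ge0.
  have -> : x / (x - 1) - (1 + 1 / x ^+ 2) * ((x + 1) / x) = 1 / (x ^+ 3 * (x - 1)).
    field; rewrite !gt_eqF //; lra.
  by rewrite divr_ge0 // mulr_ge0 ?exprn_ge0 //; lra.
have ub k : (K <= k)%N -> u k <= u K.
  elim: k => [|k IH]; first by rewrite leqn0 => /eqP->.
  rewrite leq_eqVlt => /orP[/eqP->//|]; rewrite ltnS => Kk.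
  exact: le_trans (udec k Kk) (IH Kk).
have ru k : (K <= k)%N -> r k <= u k.
  move=> Kk; have k2 := kR k Kk; have rk := r1 k Kk.
  rewrite /u ler_peMr //; first lra.
  by rewrite ler_pdivlMr; lra.
have [k Hk] := Pex (u K + 1).
have Kk' : (K <= maxn K k)%N by rewrite leq_maxl.
have := Pm _ (maxn K k) _ Hk (leq_maxr _ _); apply: above => //.
have := ru _ Kk'; have := ub _ Kk'; lra.
Qed.

(** The exponent 8 is that of [exponent_bound]: [k ^ 2] from the squared exponent [k * M], and
    [k ^ 6] from [p ^ 3] with [p] of order [k ^ 2]. *)
Lemma poly_lt_pow2 (c : nat) : exists K : nat, forall k, (K <= k)%N -> (c * k ^ 8 <= 2 ^ k)%N.
Proof.
move E : (9 ^ 9)%N => N; exists (c * N)%N => k Kk; pose i := (k %/ 9)%N.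
have hk : (k < 9 * i.+1)%N by rewrite mulnC /i -ltn_divLR.
have h1 : (i.+1 ^ 9 <= 2 ^ k)%N.
  apply: leq_trans (_ : (2 ^ i) ^ 9 <= _)%N.
    by rewrite leq_exp2r // ltn_expl.
  by rewrite -expnM leq_pexp2l // leq_divM.
have h2 : (k ^ 9 <= N * 2 ^ k)%N.
  apply: leq_trans (_ : (9 * i.+1) ^ 9 <= _)%N; first by rewrite leq_exp2r // ltnW.
  by rewrite expnMn E leq_mul2l h1 orbT.
have : (c * N * k ^ 8 <= N * 2 ^ k)%N.
  by apply: leq_trans h2; rewrite [(k ^ 9)%N]expnS leq_mul2r Kk orbT.
by rewrite mulnAC (mulnC _ N) leq_pmul2l // -E expn_gt0.
Qed.

End Windows.

(** * Pointwise consequences of the differential equation *)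

Section PointwiseBounds.
Variable R : realType.
Local Notation C := (CC R).
(** The values of [ph], [lam], [lam'], [Y] and [Y'] at a point of a good circle; [S] bounds there
    the logarithmic derivatives of [ph], [lam], [Y] and [Y - ph]. *)
Variables (S : R) (p l l1 Y Y' : C).
Hypotheses (S1 : 1 <= S) (p0 : p != 0) (l0 : l != 0) (Y0 : Y != 0).
Hypotheses (lS : nm l <= S) (l1S : nm l1 <= S * nm l) (YS : nm Y' <= S * nm Y)
  (yS : nm (Y' - l * p) <= S * nm (Y - p)).
Hypothesis ode :
  l * p * (Y - p + 1) * Y + l ^+ 2 * Y = (p - 1) * ((l ^+ 2 - l1) * Y + l * Y').

(** [b] is the logarithmic derivative of [lam], and [e] that of [Y * ph / lam]. *)
Let b := l1 / l.
Let e := Y' / Y + l - b.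

Let b_le : nm b <= S.
Proof. by rewrite /b nm_div ler_pdivrMr ?nm_gt0. Qed.

Let e_le : nm e <= 3 * S.
Proof.
have h : nm (Y' / Y) <= S by rewrite nm_div ler_pdivrMr ?nm_gt0.
apply: le_trans (nmB _ _) _; apply: le_trans (lerD (nmD _ _) (lexx _)) _.
apply: le_trans (lerD (lerD h lS) b_le) _; lra.
Qed.

(** The differential equation divided by [l * Y]. *)
Let ode_e : p * (Y - p + 1) = (p - 1) * e - l.
Proof.
apply: (mulfI (mulf_neq0 l0 Y0)); apply/eqP; rewrite -subr_eq0; apply/eqP.
have -> : l * Y * (p * (Y - p + 1)) - l * Y * ((p - 1) * e - l) =
  l * p * (Y - p + 1) * Y + l ^+ 2 * Y - (p - 1) * ((l ^+ 2 - l1) * Y + l * Y').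
  by rewrite /e /b; field; rewrite ?l0 ?Y0.
by rewrite ode subrr.
Qed.

Let pos : 0 < nm p. Proof. by rewrite nm_gt0. Qed.

Let y1_le : nm (Y - p + 1) <= 3 * S + 4 * S / nm p.
Proof.
have h : nm (p * (Y - p + 1)) <= (nm p + 1) * (3 * S) + S.
  rewrite ode_e; apply: le_trans (nmB _ _) _; apply: lerD => //.
  rewrite nmM; apply: ler_pM; rewrite ?nm_ge0 //.
  by apply: le_trans (nmB _ _) _; rewrite nm1.
rewrite nmM mulrC -ler_pdivlMr // in h; apply: le_trans h _.
rewrite le_eqVlt; apply/orP; left; apply/eqP; field; rewrite gt_eqF //.
Qed.

Lemma Y_bound : nm Y <= nm p + 1 + 3 * S + 4 * S / nm p.
Proof.
have y1' := y1_le.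
have -> : Y = (Y - p + 1) + (p - 1) by ring.
apply: le_trans (nmD _ _) _.
have h : nm (p - 1) <= nm p + 1 by apply: le_trans (nmB _ _) _; rewrite nm1.
lra.
Qed.

(** Where [nm p <= 20 S], every term is bounded. Otherwise [nm (Y - p) <= 5 S], and the terms of
    order [p] cancel down to [p * (w / Y)], which is bounded since [Y] is of the size of [p]. *)
Lemma E_bound : nm (l * p * (Y - p + 1) - 2 * l ^+ 2 * p + l1 * p) <= 200 * S ^+ 3.
Proof.
have S1' := S1; have lS' := lS; have y1' := y1_le; have e' := e_le; have pos' := pos.
have b' := b_le; have yS' := yS.
have n2 : nm (2 : C) = 2 by rewrite -(rcn R 2) nm_rc ger0_norm.
have ED : l * p * (Y - p + 1) - 2 * l ^+ 2 * p + l1 * p =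
    l * (p * (Y - p + 1) - 2 * l * p + b * p).
  by rewrite /b; field; rewrite ?l0.
rewrite ED nmM; set D := _ + b * p.
suff HD : nm D <= 200 * S ^+ 2.
  have -> : 200 * S ^+ 3 = S * (200 * S ^+ 2) by ring.
  by apply: ler_pM; rewrite ?nm_ge0.
have bp : nm (b * p) <= S * nm p by rewrite nmM ler_wpM2r ?nm_ge0.
have lp : nm (2 * l * p) <= 2 * (S * nm p).
  by rewrite !nmM n2 -mulrA ler_wpM2l // ler_wpM2r ?nm_ge0.
have SS : S <= S ^+ 2 by rewrite expr2; nra.
have [hp|hp] := leP (nm p) (20 * S).
  have t1 : nm (p * (Y - p + 1)) <= (nm p + 1) * (3 * S) + S.
    rewrite ode_e; apply: le_trans (nmB _ _) _; apply: lerD => //.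
    rewrite nmM; apply: ler_pM; rewrite ?nm_ge0 //.
    by apply: le_trans (nmB _ _) _; rewrite nm1.
  apply: le_trans (nmD _ _) _; apply: le_trans (lerD (nmB _ _) (lexx _)) _.
  have t2 : nm p * S <= 20 * S * S by rewrite ler_wpM2r //; lra.
  rewrite expr2 in SS *; lra.
have SP : 4 * S / nm p <= S by rewrite ler_pdivrMr //; nra.
have y1 : nm (Y - p) <= 5 * S.
  have -> : Y - p = (Y - p + 1) - 1 by ring.
  apply: le_trans (nmB _ _) _; rewrite nm1; lra.
have Yp : 3 / 4 * nm p <= nm Y.
  have := nm_geB p (p - Y); rewrite opprB addrCA subrr addr0 nm_sym; lra.
pose w := (Y' - l * p) - l * (Y - p).
have Ee : e = 2 * l - b + w / Y by rewrite /e /w; field.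
have -> : D = p * (w / Y) - e - l.
  by rewrite /D ode_e Ee; ring.
have wS : nm w <= 10 * S ^+ 2.
  apply: le_trans (nmB _ _) _; rewrite nmM.
  have h1 : S * nm (Y - p) <= S * (5 * S) by rewrite ler_wpM2l //; lra.
  have h2 : nm l * nm (Y - p) <= S * (5 * S) by apply: ler_pM; rewrite ?nm_ge0.
  rewrite expr2; lra.
have pw : nm (p * (w / Y)) <= 20 * S ^+ 2.
  rewrite nmM nm_div mulrA ler_pdivrMr ?nm_gt0 //.
  have h : nm p * nm w <= nm p * (10 * S ^+ 2) by rewrite ler_wpM2l // ltW.
  apply: le_trans h _.
  have -> : nm p * (10 * S ^+ 2) = S ^+ 2 * (10 * nm p) by ring.
  have -> : 20 * S ^+ 2 * nm Y = S ^+ 2 * (20 * nm Y) by ring.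
  by rewrite ler_wpM2l ?sqr_ge0 //; lra.
apply: le_trans (nmB _ _) _; apply: le_trans (lerD (nmB _ _) (lexx _)) _.
lra.
Qed.

End PointwiseBounds.

Section Asymptotics.
Variables (R : realType) (ph Y : CC R -> CC R).
Local Notation C := (CC R).
Local Notation idC := (fun z : C => z).
Implicit Types (f g c : C -> C) (z w : C) (k m n : nat) (x y t : R).

Lemma liouville f (M : R) : entire1 f -> (forall z, nm (f z) <= M) -> forall z, dv f z = 0.
Proof.
move=> ef fM w; apply: nm_eq0; apply/eqP; rewrite eq_le nm_ge0 andbT leNgt.
apply/negP; set N := nm (dv f w) => N0.
have w0 := nm_ge0 w.
have M0 : 0 <= M := le_trans (nm_ge0 _) (fM 0).
pose r := 2 * nm w + 4 * (M + 1) / N + 1.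
have MN : 0 < 4 * (M + 1) / N by rewrite divr_gt0 //; lra.
have r0 : 0 < r by rewrite /r; lra.
have wr : nm w < r by rewrite /r; lra.
have := cauchy_estimate (@entire1_hol R f (r + 1) ef) wr ltac:(lra) (fun z _ => fM z).
rewrite -/N; apply/negP; rewrite -ltNge.
have h1 : r / 2 <= r - nm w by rewrite /r; lra.
have h2 : r / (r - nm w) ^+ 2 <= 4 / r.
  have -> : 4 / r = r / (r / 2) ^+ 2 by field; rewrite gt_eqF.
  rewrite ler_wpM2l ?(ltW r0) // lef_pV2 ?posrE ?exprn_gt0 ?divr_gt0 ?subr_gt0 //.
  by apply: lerXn2r; rewrite ?nnegrE; lra.
apply: le_lt_trans (ler_wpM2l M0 h2) _.
rewrite mulrA ltr_pdivrMr //.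
have -> : N * r = N * (2 * nm w) + 4 * (M + 1) + N by rewrite /r; field; rewrite gt_eqF.
have h3 : 0 <= N * (2 * nm w) by rewrite !mulr_ge0 // ltW.
lra.
Qed.

(** The bound on the inverse of [ph] controls [lam = ph' / ph], and later the quotient by [nm p] in
    [Y_bound]. *)
Definition bd k z := [/\ nm (ph z) <= 2 ^+ (2 ^ k), (nm (ph z))^-1 <= 2 ^+ (2 ^ k)
  & nm (Y z) <= 2 ^+ (2 ^ k)].

(* On a window, the bounds number [k] fail just outside [|z| <= x], while those
   number [k + 1], that is their squares, still hold a little further out. *)
Definition Win k x := [/\ (1 < k)%N, 1 <= x,
  (forall y, y < x * (1 + 1 / k%:R ^+ 2) -> forall z, nm z <= y -> bd k.+1 z)
  & (forall y, x < y -> ~ (forall z, nm z <= y -> bd k z))].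

(** The parameter [t] crosses a window from 0 to 1; each passage to a derivative or to a good circle
    uses up a part of it. *)
Definition rad k x t := x * (1 + t / k%:R ^+ 2).

(* Windows carry bounds of size [2 ^ 2 ^ k]; being small is being polynomial in
   the exponent [2 ^ k], as logarithmic derivatives are. *)
Definition small t g := exists m n, forall k x, (n <= k)%N -> Win k x ->
  forall z, nm z <= rad k x t -> nm (g z) <= 2 ^+ (k * m).

Hypotheses (eph : entire1 ph) (ph0 : forall z, ph z != 0) (eY : entire1 Y).

Definition lam z := dv ph z / ph z.

Lemma entire_lam : entire1 lam.
Proof.
by move=> z; eexists; apply: der_div => //; apply: entire1_dv => //; exact: entire1_derivative.
Qed.

(** By Liouville no bound number [k] holds in the whole plane: [ph] would be constant and [lam]
    zero. *)
Lemma Win_exist n : (exists z, lam z != 0) -> exists k x, (n <= k)%N /\ Win k x.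
Proof.
move=> [w lw].
have [||||k [x [nk k1 x1 H1 H2]]] :=
    @windows_exist R (fun k y => forall z, nm z <= y -> bd k z) n.
- by move=> k x y H yx z zy; apply: H; exact: le_trans zy yx.
- move=> k k' x H kk' z /H [h1 h2 h3].
  have h : 2 ^+ (2 ^ k) <= 2 ^+ (2 ^ k') :> R.
    by rewrite ler_eXn2l ?ltr1n // leq_pexp2l.
  by split; exact: le_trans h.
- move=> x.
  have eph' : entire1 (fun z => (ph z)^-1) by exact: entire1V.
  have b g : entire1 g -> exists2 M : R, 0 < M & forall z, nm z <= `|x| -> nm (g z) <= M.
    move=> eg; apply: (hol_bounded (@entire1_hol R g (`|x| + 1) eg)) => //.
    by rewrite ltrDl.
  have [M1 _ H1] := b _ eph; have [M2 _ H2] := b _ eph'; have [M3 _ H3] := b _ eY.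
  have [k Hk] := pow2_unbounded (`|M1| + `|M2| + `|M3|).
  exists k => z zx; have zx' : nm z <= `|x| := le_trans zx (ler_norm x).
  have h1 := H1 z zx'; have h2 := H2 z zx'; have h3 := H3 z zx'; rewrite nmV in h2.
  have hk : 2 ^+ k <= 2 ^+ (2 ^ k) :> R by rewrite ler_eXn2l ?ltr1n // ltnW // ltn_expl.
  have := ler_norm M1; have := ler_norm M2; have := ler_norm M3.
  have := normr_ge0 M1; have := normr_ge0 M2; have := normr_ge0 M3.
  by move=> a1 a2 a3 a4 a5 a6; split; lra.
- move=> k; apply: contrapT => H; move: lw; rewrite /lam.
  suff -> : dv ph w = 0 by rewrite mul0r eqxx.
  apply: (@liouville _ (2 ^+ (2 ^ k))) => // z.
  apply: contrapT => Hz; apply: H; exists (nm z) => x Hx.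
  rewrite leNgt; apply/negP => zx; apply: Hz.
  by have [] := Hx z (ltW zx).
by exists k, x; split.
Qed.

Lemma Win_k k x : Win k x -> [/\ 2 <= k%:R :> R, 0 < k%:R :> R & 0 < x].
Proof.
move=> [k1 x1 _ _]; have k2 : 2 <= k%:R :> R by rewrite ler_nat.
by split=> //; lra.
Qed.

Lemma rad_mono k x t t' : Win k x -> t <= t' -> rad k x t <= rad k x t'.
Proof.
move=> /Win_k[k2 k0 x0] tt; rewrite /rad ler_wpM2l ?(ltW x0) // lerD2l.
by rewrite ler_wpM2r // invr_ge0 exprn_ge0 // ltW.
Qed.

Lemma rad_lt k x t t' : Win k x -> t < t' -> rad k x t < rad k x t'.
Proof.
move=> /Win_k[k2 k0 x0] tt; rewrite /rad ltr_pM2l // ltrD2l.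
by rewrite ltr_pM2r // invr_gt0 exprn_gt0.
Qed.

Lemma rad_gap k x t t' : Win k x -> rad k x t' - rad k x t = x * (t' - t) / k%:R ^+ 2.
Proof. by move=> /Win_k[k2 k0 x0]; rewrite /rad; field; rewrite gt_eqF. Qed.

Lemma rad_bounds k x t : Win k x -> 0 <= t <= 1 -> x <= rad k x t <= 2 * x.
Proof.
move=> /Win_k[k2 k0 x0] /andP[t0 t1].
have k4 : 4 <= k%:R ^+ 2 :> R by rewrite expr2; nra.
have h : 0 <= t / k%:R ^+ 2 <= 1.
  rewrite divr_ge0 ?sqr_ge0 //= ler_pdivrMr ?exprn_gt0 //; lra.
by case/andP: h => h1 h2; rewrite /rad; apply/andP; split; nra.
Qed.

Lemma Win_bd k x t z : Win k x -> t < 1 -> nm z <= rad k x t -> bd k.+1 z.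
Proof.
by move=> W t1 zr; have [_ _ H _] := W; apply: H zr; exact: (rad_lt W t1).
Qed.

Lemma small_mono t t' g : t' <= t -> small t g -> small t' g.
Proof.
move=> tt [m [n H]]; exists m, n => k x nk W z zr.
exact: (H k x nk W z (le_trans zr (rad_mono W tt))).
Qed.

Lemma pow_le_km k m m' : (m <= m')%N -> 2 ^+ (k * m) <= 2 ^+ (k * m') :> R.
Proof. by move=> mm; rewrite ler_eXn2l ?ltr1n // leq_mul2l mm orbT. Qed.

Lemma smallD t f g : small t f -> small t g -> small t (fun z => f z + g z).
Proof.
move=> [m [n H]] [m' [n' H']]; exists (maxn m m').+1, (maxn n n') => k x.
rewrite geq_max => /andP[nk nk'] W z zr.
apply: le_trans (nmD _ _) _; apply: le_trans (lerD (H k x nk W z zr) (H' k x nk' W z zr)) _.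
have [k1 _ _ _] := W.
apply: le_trans (_ : 2 * 2 ^+ (k * maxn m m') <= _).
  by rewrite mulr2n mulrDl mul1r lerD // pow_le_km // ?leq_maxl ?leq_maxr.
by rewrite -exprS ler_eXn2l ?ltr1n // mulnS -[X in (X < _)%N]add0n ltn_add2r ltnW.
Qed.

Lemma smallM t f g : small t f -> small t g -> small t (fun z => f z * g z).
Proof.
move=> [m [n H]] [m' [n' H']]; exists (m + m')%N, (maxn n n') => k x.
rewrite geq_max => /andP[nk nk'] W z zr.
rewrite nmM mulnDr exprD; apply: ler_pM; rewrite ?nm_ge0 //; [exact: H nk W z zr|exact: H' nk' W z zr].
Qed.

Lemma small_cst t (a : C) : small t (fun=> a).
Proof.
have [m Hm] := pow2_unbounded (nm a); exists m, 1%N => k x k1 W z _.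
apply: le_trans (ltW Hm) _; rewrite ler_eXn2l ?ltr1n //.
by rewrite leq_pmull.
Qed.

Lemma smallB t f g : small t f -> small t g -> small t (fun z => f z - g z).
Proof.
move=> sf sg; have [m [n H]] := smallD sf (smallM (small_cst t (-1)) sg).
exists m, n => k x nk W z zr; have := H k x nk W z zr.
by rewrite mulN1r.
Qed.

(** The two circles are [x (t' - t) / k ^ 2] apart with [x >= 1], so a derivative costs a factor of
    order [k ^ 4], negligible on the scale of [small]. *)
Lemma cauchy_rad k x t t' (M : R) g z : Win k x -> 0 <= t -> t < t' -> t' <= 1 ->
  entire1 g -> (forall w, nm w <= rad k x t' -> nm (g w) <= M) ->
  nm z <= rad k x t -> nm (dv g z) <= M * (2 * k%:R ^+ 4 / (t' - t) ^+ 2).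
Proof.
move=> W t0 tt t1 eg gM zr; have [k2 k0 x0] := Win_k W.
have [_ x1 _ _] := W.
have lt' := rad_lt W tt; have zr' : nm z < rad k x t' := le_lt_trans zr lt'.
have M0 : 0 <= M.
  by apply: le_trans (nm_ge0 (g z)) (gM z (ltW zr')).
have gM' w : nm w = rad k x t' -> nm (g w) <= M by move=> h; apply: gM; rewrite h.
have := cauchy_estimate (@entire1_hol R g (rad k x t' + 1) eg) zr' ltac:(lra) gM'.
move=> /le_trans; apply; rewrite ler_wpM2l //.
have gap := rad_gap t t' W; have d0 : 0 < t' - t by rewrite subr_gt0.
have g0 : 0 < x * (t' - t) / k%:R ^+ 2 by rewrite divr_gt0 ?mulr_gt0 ?exprn_gt0.
have [|_ r2] := andP (@rad_bounds k x t' W _); first by apply/andP; split; lra.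
have -> : 2 * k%:R ^+ 4 / (t' - t) ^+ 2 = (2 * x) / (x * (t' - t) / k%:R ^+ 2) ^+ 2 * x.
  by field; rewrite !gt_eqF.
apply: le_trans (_ : (2 * x) / (x * (t' - t) / k%:R ^+ 2) ^+ 2 <= _); last first.
  by rewrite ler_peMr // divr_ge0 ?sqr_ge0 // mulr_ge0 // ltW.
apply: ler_pM => //.
- by have := nm_ge0 z; lra.
- by rewrite invr_ge0 sqr_ge0.
have h : x * (t' - t) / k%:R ^+ 2 <= rad k x t' - nm z by lra.
rewrite lef_pV2 ?posrE ?exprn_gt0 //; last lra.
by apply: lerXn2r; rewrite ?nnegrE; lra.
Qed.

Lemma small_dv t t' g : 0 <= t -> t < t' -> t' <= 1 -> entire1 g -> small t' g ->
  small t (dv g).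
Proof.
move=> t0 tt t1 eg [m [n H]].
have [a Ha] := pow2_unbounded (2 / (t' - t) ^+ 2).
exists (m + (4 + a))%N, n => k x nk W z zr; have [k1 _ _ _] := W.
apply: le_trans (cauchy_rad W t0 tt t1 eg (H k x nk W) zr) _.
rewrite mulnDr exprD ler_wpM2l ?exprn_ge0 //.
rewrite mulrAC mulnDr exprD mulrC; apply: ler_pM.
- by rewrite exprn_ge0.
- by rewrite divr_ge0 ?sqr_ge0.
- rewrite exprM; apply: lerXn2r; rewrite ?nnegrE ?exprn_ge0 //.
  by rewrite -natrX ler_nat ltnW // ltn_expl.
apply: le_trans (ltW Ha) _; rewrite ler_eXn2l ?ltr1n // leq_pmull //.
exact: ltnW.
Qed.

End Asymptotics.

(** * Good circles inside windows *)

Section SmallFunctions.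
Variables (R : realType) (ph Y : CC R -> CC R).
Local Notation C := (CC R).
Local Notation idC := (fun z : C => z).
Implicit Types (f g c : C -> C) (z w : C) (k m n : nat) (x y t : R).
Hypotheses (eph : entire1 ph) (ph0 : forall z, ph z != 0) (eY : entire1 Y).
Local Notation lam := (lam ph).
Local Notation Win := (Win ph Y).
Local Notation small := (small ph Y).

Lemma window_circle n (G : nat -> C -> C) (L : nat -> nat) t n0 : 0 <= t -> t <= 7 / 8 ->
  (forall i, (i < n)%N -> entire1 (G i) /\ zero_or_centered (G i)) ->
  (forall k x, (n0 <= k)%N -> Win k x -> forall i z, (i < n)%N ->
     nm z <= rad k x (t + 1 / 16) -> nm (G i z) <= 2 ^+ L k) ->
  exists K : nat, forall k x, (n0 <= k)%N -> Win k x -> exists rho,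
    [/\ rad k x t <= rho, rho <= rad k x (t + 1 / 16) & forall i z, (i < n)%N -> nm z = rho ->
      ((exists z, G i z != 0) -> G i z != 0) /\
      nm (dv (G i) z) * x <= (K * (L k).+1 ^ 2 * k ^ 6)%N%:R * nm (G i z)].
Proof.
move=> t0 t8 HG HL; have [K HK] := good_circle HG.
(* With [p = q k ^ 2] and [rad k x t <= 2 x], the value 96 makes the factor [1 + 3 / p] lead no
   further than [rad k x (t + 1 / 16)]. *)
have [q Hq] : exists q : nat, (96 <= q)%N by exists 96%N.
exists (K * q ^ 3)%N => k x nk W; have [k2 k0 x0] := Win_k W; have [k1 x1 _ _] := W.
have kk0 : (0 < k)%N by apply: ltnW.
have Q0 : 96 <= q%:R :> R by rewrite ler_nat.
pose p := (q * k ^ 2)%N.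
have p0 : (0 < p)%N by rewrite muln_gt0 expn_gt0 kk0 andbT; apply: leq_trans Hq.
have rt : x <= rad k x t <= 2 * x by apply: rad_bounds W _; lra.
case/andP: rt => rt1 rt2.
have pR : p%:R = q%:R * k%:R ^+ 2 :> R by rewrite natrM natrX.
have P0 : 0 < p%:R :> R by rewrite ltr0n.
have gap : rad k x t * (1 + 3 / p%:R) <= rad k x (t + 1 / 16).
  have g := rad_gap t (t + 1 / 16) W.
  have -> : rad k x (t + 1 / 16) = rad k x t + x * (t + 1 / 16 - t) / k%:R ^+ 2.
    by rewrite -g; ring.
  rewrite mulrDr mulr1 lerD2l.
  apply: le_trans (_ : 2 * x * (3 / p%:R) <= _).
    by rewrite ler_wpM2r // divr_ge0 // ltW.
  rewrite pR.
  have -> : 2 * x * (3 / (q%:R * k%:R ^+ 2)) = x / k%:R ^+ 2 * (6 / q%:R).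
    by field; rewrite !gt_eqF //; lra.
  have -> : x * (t + 1 / 16 - t) / k%:R ^+ 2 = x / k%:R ^+ 2 * (1 / 16) by field; rewrite gt_eqF.
  rewrite ler_wpM2l ?divr_ge0 ?sqr_ge0 ?(ltW x0) //.
  rewrite ler_pdivrMr; lra.
have rt0 : 0 < rad k x t by lra.
have [|rho /andP[rho1 rho2] Hrho] := HK (L k) p (rad k x t) p0 rt0.
  by move=> i z ilt zr; apply: (HL k x nk W i z ilt); apply: le_trans zr gap.
exists rho; split=> //.
  apply: le_trans rho2 _; apply: le_trans gap; rewrite ler_wpM2l ?(ltW rt0) // lerD2l.
  by rewrite ler_wpM2r ?invr_ge0 ?(ltW P0) //; lra.
move=> i z ilt zr; have [h1 h2] := Hrho i z ilt zr; split=> //.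
apply: le_trans (_ : nm (dv (G i) z) * rad k x t <= _).
  by rewrite ler_wpM2l ?nm_ge0.
apply: le_trans h2 _.
have -> : (K * (L k).+1 ^ 2 * p ^ 3 = K * q ^ 3 * (L k).+1 ^ 2 * k ^ 6)%N.
  have -> : (p ^ 3 = q ^ 3 * k ^ 6)%N by rewrite /p expnMn -expnM.
  by move: (q ^ 3)%N (k ^ 6)%N ((L k).+1 ^ 2)%N => a b d; rewrite mulnA (mulnAC K).
exact: lexx.
Qed.

(** A first bound by Cauchy's estimate, still doubly exponential, which makes [good_circle]
    applicable to [lam]. *)
Lemma window_lam_bound k x t z : (3 <= k)%N -> Win k x -> 0 <= t -> t <= 15 / 16 ->
  nm z <= rad k x t -> nm (lam z) <= 2 ^+ (2 ^ (k + 3)).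
Proof.
move=> k3 W t0 t1 zr.
have phb w : nm w <= rad k x (t + 1 / 32) -> nm (ph w) <= 2 ^+ (2 ^ k.+1).
  have t32 : t + 1 / 32 < 1 by lra.
  by move=> wr; have [] := Win_bd W t32 wr.
have [k2 k0 x0] := Win_k W.
have := cauchy_rad W t0 (_ : t < t + 1 / 32) _ eph phb zr.
move=> /(_ ltac:(lra) ltac:(lra)) h1.
have t11 : t < 1 by lra.
have [_ h2 _] := Win_bd W t11 zr.
rewrite /lam nm_div; apply: le_trans (ler_pM (nm_ge0 _) _ h1 h2) _.
  by rewrite invr_ge0 nm_ge0.
have h3 : 2 * k%:R ^+ 4 / (t + 1 / 32 - t) ^+ 2 <= 2 ^+ (11 + 4 * k) :> R.
  have -> : t + 1 / 32 - t = 1 / 32 by ring.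
  have -> : 2 * k%:R ^+ 4 / (1 / 32) ^+ 2 = 2 ^+ 11 * k%:R ^+ 4 :> R by field.
  rewrite exprD ler_wpM2l ?exprn_ge0 // mulnC exprM.
  apply: lerXn2r; rewrite ?nnegrE ?exprn_ge0 //.
  by rewrite -natrX ler_nat ltnW // ltn_expl.
apply: le_trans (_ : 2 ^+ (2 ^ k.+1) * 2 ^+ (11 + 4 * k) * 2 ^+ (2 ^ k.+1) <= _).
  by rewrite ler_wpM2r ?exprn_ge0 // ler_wpM2l // exprn_ge0.
rewrite -!exprD ler_eXn2l ?ltr1n //.
have h4 : (11 + 4 * k <= 2 ^ (k + 2))%N.
  elim: k k3 {W zr phb k2 k0 h1 h2 h3} => // k IH; rewrite leq_eqVlt => /orP[/eqP <- //|].
  by rewrite ltnS => /IH; rewrite (addSn k 2) expnS; lia.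
by clear - h4; move: h4; rewrite !addnS !addn0 !expnS; lia.
Qed.

Hypotheses (clam : zero_or_centered lam) (cY : zero_or_centered Y)
  (cy : zero_or_centered (fun z => Y z - ph z)).

(** Bounds [2 ^ L] with [L] of order [2 ^ k] yield logarithmic derivatives polynomial in [L], hence
    at most [2 ^ (k m)]. Being the logarithmic derivative of [ph], [lam] itself becomes small. *)
Lemma main_circle t : 0 <= t -> t <= 7 / 8 ->
  exists m n, forall k x, (n <= k)%N -> Win k x -> exists rho,
    [/\ rad k x t <= rho, rho <= rad k x (t + 1 / 16) & forall z, nm z = rho ->
     [/\ (exists z, lam z != 0) -> lam z != 0, (exists z, Y z != 0) -> Y z != 0,
         nm (lam z) <= 2 ^+ (k * m), nm (dv lam z) <= 2 ^+ (k * m) * nm (lam z) &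
         nm (dv Y z) <= 2 ^+ (k * m) * nm (Y z) /\
         nm (dv Y z - lam z * ph z) <= 2 ^+ (k * m) * nm (Y z - ph z)]].
Proof.
move=> t0 t8.
pose G i := if i == 0%N then ph else if i == 1%N then lam else
  if i == 2%N then Y else fun z => Y z - ph z.
have elam := entire_lam eph ph0.
have eyp : entire1 (fun z => Y z - ph z) by exact: entire1B.
have [||K HK] := @window_circle 4 G (fun k => 2 ^ (k + 3))%N t 3 t0 t8.
- case=> [|[|[|[|//]]]] _ /=; split=> //.
  + by right; exact: ph0.
- move=> k x k3 W i z ilt zr.
  have t11 : t + 1 / 16 < 1 by lra.
  have [b1 b2 b3] := Win_bd W t11 zr.
  have w1 : 2 ^+ (2 ^ k.+1) <= 2 ^+ (2 ^ (k + 3)) :> R.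
    by rewrite ler_eXn2l ?ltr1n // leq_pexp2l // -addn1 leq_add2l.
  case: i ilt => [|[|[|[|//]]]] _ /=.
  + exact: le_trans w1.
  + by apply: window_lam_bound k3 W _ _ zr; lra.
  + exact: le_trans w1.
  + apply: le_trans (nmB _ _) _; apply: le_trans (lerD b3 b1) _.
    have -> : 2 ^+ (2 ^ k.+1) + 2 ^+ (2 ^ k.+1) = 2 ^+ (2 ^ k.+1).+1 :> R.
      by rewrite exprS; ring.
    rewrite ler_eXn2l ?ltr1n //.
    have : (2 ^ k.+1 < 2 ^ (k + 2))%N by rewrite ltn_exp2l // -addn1 ltn_add2l.
    by move=> h; apply: leq_trans h _; rewrite leq_pexp2l // leq_add2l.
have [c Hc] := pow2_unbounded (K%:R : R).
exists (c + (8 + 6))%N, 3%N => k x k3 W.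
have [rho [r1 r2 H]] := HK k x k3 W.
exists rho; split=> // z zr.
have [_ x1 _ _] := W; have [k2 k0 x0] := Win_k W.
have kk : (0 < k)%N by apply: leq_trans k3.
have SB : (K * (2 ^ (k + 3)).+1 ^ 2 * k ^ 6)%N%:R <= 2 ^+ (k * (c + (8 + 6))) :> R.
  rewrite !mulnDr !exprD (natrM _ _ (k ^ 6)) (natrM _ K).
  rewrite mulrA; apply: ler_pM => //; first apply: ler_pM => //.
  - by apply: le_trans (ltW Hc) _; rewrite ler_eXn2l ?ltr1n // leq_pmull.
  - rewrite -natrX ler_nat mulnC expnM.
    have -> : ((2 ^ 8) ^ k = (2 ^ (4 * k)) ^ 2)%N by rewrite -!expnM; congr (_ ^ _)%N; lia.
    rewrite leq_exp2r //; apply: leq_trans (_ : 2 * 2 ^ (k + 3) <= _)%N.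
      by have := expn_gt0 2 (k + 3); rewrite /=; lia.
    by rewrite -expnS leq_pexp2l //; lia.
  - rewrite natrX exprM; apply: lerXn2r; rewrite ?nnegrE ?exprn_ge0 //.
    by rewrite -natrX ler_nat ltnW // ltn_expl.
set S := 2 ^+ (k * _) in SB *.
have key i : (i < 4)%N -> nm (dv (G i) z) <= S * nm (G i z).
  move=> ilt; have [_ h] := H i z ilt zr.
  apply: le_trans (_ : nm (dv (G i) z) * x <= _); first by rewrite ler_peMr ?nm_ge0.
  by apply: le_trans h _; rewrite ler_wpM2r ?nm_ge0.
split.
- by have [] := H 1%N z isT zr.
- by have [] := H 2%N z isT zr.
- have := key 0%N isT; rewrite /= /lam nm_div ler_pdivrMr ?nm_gt0 //.
- exact: key 1%N isT.
split; first exact: key 2%N isT.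
have := key 3%N isT; rewrite /=.
have -> : dv (fun z => Y z - ph z) z = dv Y z - lam z * ph z; last by [].
by rewrite /lam divfK //; apply: dvE; apply: derB; exact: entire1_dv.
Qed.

Lemma expR1_le4 : expR 1 <= 4 :> R.
Proof.
have h : 1 / 2 <= expR (- (1 / 2)) :> R.
  by apply: le_trans (expR_ge1Dx _); lra.
have h0 : 0 < expR (1 / 2) :> R by exact: expR_gt0.
have h2 : expR (1 / 2) <= 2 :> R.
  by have := ler_wpM2l (ltW h0) h; rewrite expRN divff ?gt_eqF //; lra.
have -> : (1 : R) = 1 / 2 + 1 / 2 by field.
rewrite expRD; nra.
Qed.

(** Integration of [lam] along a ray writes [ph z / ph 0] as the exponential of a number of modulus
    at most [B]. *)
Lemma ph_growth (rho B : R) z : 0 < rho -> (forall w, nm w = rho -> nm (lam w) * rho <= B) ->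
  nm z <= rho -> nm (ph z) <= nm (ph 0) * expR B /\
     (nm (ph z))^-1 <= (nm (ph 0))^-1 * expR B.
Proof.
move=> rho0 HB zr.
have elam := entire_lam eph ph0.
have lb w : nm w <= rho -> nm (lam w) <= B / rho.
  move=> wr; apply: (max_principle (@entire1_hol R lam (rho + 1) elam) wr); first lra.
    rewrite divr_ge0 ?(ltW rho0) //; apply: le_trans (HB (rc rho) _).
      by rewrite mulr_ge0 ?nm_ge0 ?ltW.
    by rewrite nm_rc ger0_norm // ltW.
  by move=> y yr; rewrite ler_pdivlMr // HB.
have R1 : 0 < rho + 1 by lra.
have [K HK] := @hol_log R (rho + 1) ph R1 (@entire1_hol R ph (rho + 1) eph) (fun w _ => ph0 w).
have Kz : nm (K z - K 0) <= B.
  have z0 := nm_ge0 z.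
  have := @prim_bound R (fun t => K (rc t * z)) (fun t => lam (rc t * z) * z) 0 1 B ler01.
  rewrite rc1 rc0 mul1r mul0r subr0 mulr1; apply.
    move=> t ht; have zt : nm (rc t * z) < rho + 1 by apply: nm_ray ht; lra.
    have [dK _] := HK _ zt.
    exact: (der_comp (der_ray z t) dK).
  move=> t /andP[h0 h1]; rewrite nmM.
  have zt : nm (rc t * z) <= rho by rewrite nmM nm_rc ger0_norm //; nra.
  apply: le_trans (_ : B / rho * rho <= _); last by rewrite divfK // gt_eqF.
  by apply: ler_pM; rewrite ?nm_ge0 // lb.
have zR : nm z < rho + 1 by lra.
have z0R : nm (0 : C) < rho + 1 by rewrite nm0.
have [_ E] := HK z zR; have [_ E0] := HK 0 z0R.
have re0 : re (K 0) = 0.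
  have : cexp (K 0) = 1 by apply: (mulfI (ph0 0)); rewrite -E0 mulr1.
  move=> /(congr1 (@nm R)); rewrite nm_cexp nm1 => h.
  by apply: expR_inj; rewrite h expR0.
have := le_trans (re_le_nm _) Kz; rewrite reB re0 subr0 ler_norml => /andP[h1 h2].
have p0 : 0 < nm (ph 0) by rewrite nm_gt0.
rewrite E nmM nm_cexp invfM; split.
  by rewrite ler_pM2l // ler_expR.
rewrite ler_pM2l ?invr_gt0 // -expRN ler_expR; lra.
Qed.

Hypothesis ode : forall z, lam z * ph z * (Y z - ph z + 1) * Y z + lam z ^+ 2 * Y z
  = (ph z - 1) * ((lam z ^+ 2 - dv lam z) * Y z + lam z * dv Y z).
Hypotheses (lam0 : exists z, lam z != 0) (Y0 : exists z, Y z != 0).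

Lemma exponent_bound (K M m d k : nat) : (0 < k)%N ->
  (d + 2 * (4 * (K * (k * M).+1 ^ 2 * k ^ 6)) + k * m + 4 <=
   (d + 8 * (K * M.+1 ^ 2) + m + 5) * k ^ 8)%N.
Proof.
move=> k1.
have kM : ((k * M).+1 ^ 2 <= M.+1 ^ 2 * k ^ 2)%N.
  by rewrite -expnMn leq_exp2r // mulSn (mulnC M) -addn1 addnC leq_add2r.
have k8 : (k ^ 8 = k ^ 2 * k ^ 6)%N by rewrite -expnD.
have kk8 : (k <= k ^ 8)%N by rewrite -[X in (X <= _)%N]expn1 leq_pexp2l.
have k81 : (0 < k ^ 8)%N by rewrite expn_gt0 k1.
move: (k ^ 8)%N (k ^ 2)%N (k ^ 6)%N ((k * M).+1 ^ 2)%N (M.+1 ^ 2)%N k8 kk8 k81 kM.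
move=> k8 a b x y -> kk8 k81 kM.
have t1 : (K * x * b <= K * y * (a * b))%N.
  have -> : (K * y * (a * b) = K * (y * a) * b)%N by rewrite !mulnA.
  by rewrite leq_mul2r leq_mul2l kM !orbT.
have t2 : (k * m <= m * (a * b))%N by rewrite mulnC leq_mul2l kk8 orbT.
have t3 : (d <= d * (a * b))%N by rewrite leq_pmulr.
rewrite (mulnDl _ 5) (mulnDl _ m) (mulnDl d) -(mulnA 8).
move: (a * b)%N (K * x * b)%N (K * y)%N k81 t1 t2 t3 => e f g.
move: (g * e)%N (d * e)%N (m * e)%N (k * m)%N => e1 e2 e3 e4; lia.
Qed.

(* If [g] and [c] were both nonzero, [j lam] would be a difference of two
   logarithmic derivatives of small functions, hence so small that [ph], its
   inverse and [Y] could not be as large as the window requires. *)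
Lemma small_log_relation g c (j : nat) : entire1 g -> entire1 c -> zero_or_centered g ->
  zero_or_centered c -> small (1 / 2) g -> small (1 / 2) c -> (0 < j)%N ->
  (forall z, dv g z * c z - g z * dv c z = j%:R * lam z * g z * c z) ->
  (forall z, g z = 0) \/ (forall z, c z = 0).
Proof.
move=> eg ec [g0|g0] [c0|c0] sg sc j0 rel; [by left|by left|by right|exfalso].
have [mg [ng Hg]] := sg; have [mc [nc Hc]] := sc.
pose G i := if i == 0%N then g else c.
pose M := maxn mg mc; pose n1 := maxn ng nc.
(* Smallness allows the exponent [k * M] where the window only gives one of order [2 ^ k]; the
   resulting bounds are polynomial in [k]. *)
have [||K HK] := @window_circle 2 G (fun k => k * M)%N (3 / 8) n1 ltac:(lra) ltac:(lra).
- by case=> [|[|//]] _; split=> //; right.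
- move=> k x; rewrite geq_max => /andP[h1 h2] W i z ilt zr.
  have zr' : nm z <= rad k x (1 / 2) by apply: le_trans zr (rad_mono W _); lra.
  case: i ilt => [|[|//]] _ /=.
    by apply: le_trans (Hg k x h1 W z zr') (pow_le_km _ _ _); exact: leq_maxl.
  by apply: le_trans (Hc k x h2 W z zr') (pow_le_km _ _ _); exact: leq_maxr.
(* A second circle inside the first one, on which [Y_bound] transfers the bounds from [ph] to
   [Y]. *)
have [m2 [n2 H2]] := main_circle (t := 1 / 4) ltac:(lra) ltac:(lra).
have [c1 Hc1] := pow2_unbounded (nm (ph 0)); have [c2 Hc2] := pow2_unbounded (nm (ph 0))^-1.
pose B k := (4 * (K * (k * M).+1 ^ 2 * k ^ 6))%N.
pose ex k := (maxn c1 c2 + 2 * B k)%N.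
pose cc := (maxn c1 c2 + 8 * (K * M.+1 ^ 2) + m2 + 5)%N.
have [n3 H3] := poly_lt_pow2 cc.
have [k [x [nk W]]] := Win_exist eph ph0 eY (maxn n1 (maxn n2 (maxn n3 1))) lam0.
move: nk; rewrite geq_max => /andP[nk1]; rewrite geq_max => /andP[nk2].
rewrite geq_max => /andP[nk3 k1].
have [k2 k0 x0] := Win_k W; have [_ x1 WU WL] := W.
have [rho [r1 r2 Hrho]] := HK k x nk1 W.
have [rho2 [s1 s2 Hrho2]] := H2 k x nk2 W.
have q1 : x <= rad k x (3 / 8) <= 2 * x by apply: rad_bounds W _; lra.
have q2 : x <= rad k x (3 / 8 + 1 / 16) <= 2 * x by apply: rad_bounds W _; lra.
case/andP: q1 => q11 q12; case/andP: q2 => q21 q22.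
have rho0 : 0 < rho by lra.
have lamB w : nm w = rho -> nm (lam w) * rho <= (B k)%:R.
  move=> wr; have [gz h1] := Hrho 0%N w isT wr; have [cz h2] := Hrho 1%N w isT wr.
  have {}gz : g w != 0 by apply: gz; exists 0.
  have {}cz : c w != 0 by apply: cz; exists 0.
  rewrite /= in h1 h2; set T := (K * _ * _)%N%:R in h1 h2.
  have T0 : 0 <= T by rewrite ler0n.
  have E : j%:R * lam w = dv g w / g w - dv c w / c w.
    apply: (mulIf (mulf_neq0 gz cz)).
    have -> : (dv g w / g w - dv c w / c w) * (g w * c w) = dv g w * c w - g w * dv c w.
      by field; rewrite ?gz ?cz.
    by rewrite rel; ring.
  have e1 : nm (dv g w / g w) * x <= T.
    by rewrite nm_div mulrAC ler_pdivrMr ?nm_gt0.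
  have e2 : nm (dv c w / c w) * x <= T.
    by rewrite nm_div mulrAC ler_pdivrMr ?nm_gt0.
  have jl : nm (lam w) <= nm (j%:R * lam w).
    by rewrite nmM -rcn nm_rc ger0_norm // ler_peMl ?nm_ge0 // ler1n.
  have l1 : nm (lam w) <= nm (dv g w / g w) + nm (dv c w / c w).
    by apply: le_trans jl _; rewrite E nmB.
  have l2 : nm (lam w) * x <= 2 * T.
    apply: le_trans (_ : (nm (dv g w / g w) + nm (dv c w / c w)) * x <= _); last lra.
    by rewrite ler_wpM2r // ltW.
  have -> : (B k)%:R = 4 * T by rewrite /B natrM.
  have l3 : nm (lam w) * rho <= nm (lam w) * (2 * x) by rewrite ler_wpM2l ?nm_ge0 //; lra.
  lra.
have phB z : nm z <= rho -> nm (ph z) <= 2 ^+ ex k /\ (nm (ph z))^-1 <= 2 ^+ ex k.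
  move=> zr; have [h1 h2] := ph_growth rho0 lamB zr.
  have e4 : expR (B k)%:R <= 2 ^+ (2 * B k) :> R.
    rewrite exprM -[X in expR X]mulr1 expRM_natl; apply: lerXn2r; rewrite ?nnegrE ?expR_ge0 //.
    by have := expR1_le4; rewrite expr2; lra.
  have w1 : 2 ^+ c1 <= 2 ^+ maxn c1 c2 :> R by rewrite ler_eXn2l ?ltr1n // leq_maxl.
  have w2 : 2 ^+ c2 <= 2 ^+ maxn c1 c2 :> R by rewrite ler_eXn2l ?ltr1n // leq_maxr.
  rewrite /ex exprD; split; [apply: le_trans h1 _|apply: le_trans h2 _];
    apply: ler_pM; rewrite ?expR_ge0 ?invr_ge0 ?nm_ge0 //.
  - exact: le_trans (ltW Hc1) w1.
  - exact: le_trans (ltW Hc2) w2.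
(* [F] is the exponent reached by the bound of [Y]; polynomial in [k], it stays below [2 ^ k]. *)
pose F := (ex k + k * m2 + 4)%N.
have FB : (F <= 2 ^ k)%N.
  by apply: leq_trans (H3 k nk3); exact: exponent_bound.
have s0 : 1 / 4 + 1 / 16 < 3 / 8 :> R by lra.
have rr : rho2 <= rho by have := rad_lt W s0; lra.
have xs : x < rho2.
  by have := rad_lt W (_ : 0 < 1 / 4); rewrite /rad mul0r addr0 mulr1 => /(_ ltac:(lra)); rewrite /rad in s1; lra.
(* The three bounds number [k] hold up to a radius beyond [x], against the choice of the window. *)
apply: (WL rho2 xs) => z zr.
have exk : (ex k <= 2 ^ k)%N by apply: leq_trans FB; rewrite /F -addnA leq_addr.
have [p1 p2] := phB z (le_trans zr rr).
have wex : 2 ^+ ex k <= 2 ^+ (2 ^ k) :> R by rewrite ler_eXn2l ?ltr1n.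
split; [exact: le_trans wex|exact: le_trans wex|].
apply: (max_principle (@entire1_hol R Y (rho2 + 1) eY) zr); [lra|by rewrite exprn_ge0|].
move=> w wr; have [h1 h2 h3 h4 [h5 h6]] := Hrho2 w wr.
have S1 : 1 <= 2 ^+ (k * m2) :> R by rewrite exprn_ege1 // ler1n.
have Yb := Y_bound (ph0 w) (h1 lam0) (h2 Y0) h3 h4 h5 (ode w).
have [b1 b2] := phB w ltac:(lra).
apply: le_trans Yb _; apply: le_trans (_ : 2 ^+ F <= _); last by rewrite ler_eXn2l ?ltr1n.
have E1 : 1 <= 2 ^+ ex k :> R by rewrite exprn_ege1 // ler1n.
rewrite /F (exprD _ (ex k + k * m2)%N) (exprD _ (ex k)); set S := 2 ^+ (k * m2) in S1 *; set X := 2 ^+ ex k in E1 b1 b2 *.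
have t1 : 4 * S / nm (ph w) <= 4 * S * X by rewrite ler_wpM2l //; lra.
have t2 : X <= X * S by nra.
have t3 : S <= X * S by nra.
have -> : (2 : R) ^+ 4 = 16 by ring.
lra.
Qed.

End SmallFunctions.

(** * The one-variable theorem *)

Section Coefficients.
Variable K : comNzRingType.
Implicit Types l E : K.

(* With [D = E / l] and [s = 2 l - 1 - l' / l] one has [Y = ph + s + D / ph];
   substituting this into the differential equation for [Y] gives a quadratic
   equation for [ph], whose coefficients times [l ^ 2] are these. *)
Definition acoef l l1 l2 E : K :=
  l * E + (2 * l ^+ 2 - l1) * (2 * l ^+ 2 - l - l1) + l ^+ 3
  - (l ^+ 2 - l1) * (2 * l ^+ 2 - l - l1) - 2 * l ^+ 2 * l1 + l2 * l - l1 ^+ 2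
  + l * (2 * l ^+ 2 - l1).
Definition bcoef l l1 l2 E E1 : K :=
  (4 * l ^+ 2 - l - 2 * l1) * E + l ^+ 2 * (2 * l ^+ 2 - l - l1)
  - (E1 * l - E * l1) + l1 * E
  + (l ^+ 2 - l1) * (2 * l ^+ 2 - l - l1) + 2 * l ^+ 2 * l1 - l2 * l + l1 ^+ 2.
Definition ccoef l l1 E E1 : K :=
  E ^+ 2 + l ^+ 2 * E + (E1 * l - E * l1) - l1 * E.

Variables (T : Type) (Q : (T -> K) -> Prop).
Hypotheses (QD : forall f g, Q f -> Q g -> Q (fun z => f z + g z))
  (QB : forall f g, Q f -> Q g -> Q (fun z => f z - g z))
  (QM : forall f g, Q f -> Q g -> Q (fun z => f z * g z))
  (Qc : forall c, Q (fun=> c)).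
Variables l l1 l2 E E1 : T -> K.
Hypotheses (Ql : Q l) (Ql1 : Q l1) (Ql2 : Q l2) (QE : Q E) (QE1 : Q E1).

Ltac closed := repeat first [assumption | apply: Qc | apply: QB | apply: QD | apply: QM].

(** Stated for any class [Q] closed under the ring operations, so as to apply both to entire
    functions and to small ones. *)
Lemma closed_acoef : Q (fun z => acoef (l z) (l1 z) (l2 z) (E z)).
Proof. by rewrite /acoef; closed. Qed.

Lemma closed_bcoef : Q (fun z => bcoef (l z) (l1 z) (l2 z) (E z) (E1 z)).
Proof. by rewrite /bcoef; closed. Qed.

Lemma closed_ccoef : Q (fun z => ccoef (l z) (l1 z) (E z) (E1 z)).
Proof. by rewrite /ccoef; closed. Qed.

Lemma closed_factor (n : K) : Q (fun z => n * l z ^+ 2 - l1 z + E z).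
Proof. by closed. Qed.

(** The letters change meaning here: [l2], [E] and [E1] stand for [Y'], [ph] and [Y]. *)
Lemma closed_ode : Q (fun z => l z * E z * (E1 z - E z + 1) * E1 z + l z ^+ 2 * E1 z
  - (E z - 1) * ((l z ^+ 2 - l1 z) * E1 z + l z * l2 z)).
Proof. by closed. Qed.

End Coefficients.

(** * Impossibility of a nonconstant [ph] *)

Section Contradiction.
Variables (R : realType) (ph Y : CC R -> CC R).
Local Notation C := (CC R).
Local Notation idC := (fun z : C => z).
Implicit Types (f g c : C -> C) (z w : C) (k m n : nat) (x y t : R).
Local Notation lam := (lam ph).
Local Notation Win := (Win ph Y).
Local Notation small := (small ph Y).

(** This is [lam * ph * (Y - ph - s)] with [s = 2 lam - 1 - lam' / lam]; the factor [lam] clears the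
    poles of [s]. *)
Definition Efun z : C := lam z * ph z * (Y z - ph z + 1) - 2 * lam z ^+ 2 * ph z
  + dv lam z * ph z.
Definition afun z : C := acoef (lam z) (dv lam z) (dv (dv lam) z) (Efun z).
Definition bfun z : C := bcoef (lam z) (dv lam z) (dv (dv lam) z) (Efun z) (dv Efun z).
Definition cfun z : C := ccoef (lam z) (dv lam z) (Efun z) (dv Efun z).

Hypotheses (eph : entire1 ph) (ph0 : forall z, ph z != 0) (eY : entire1 Y).
Hypothesis ode : forall z, lam z * ph z * (Y z - ph z + 1) * Y z + lam z ^+ 2 * Y z
  = (ph z - 1) * ((lam z ^+ 2 - dv lam z) * Y z + lam z * dv Y z).

Let el : entire1 lam. Proof. exact: entire_lam. Qed.
Let el1 : entire1 (dv lam). Proof. exact: entire1_derivative. Qed.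
Let el2 : entire1 (dv (dv lam)). Proof. exact: entire1_derivative. Qed.

Lemma entire_E : entire1 Efun.
Proof.
apply: entire1D; last exact: entire1M.
apply: entire1B.
  apply: entire1M; first exact: entire1M.
  by apply: entire1D; [exact: entire1B|exact: entire1_cst].
by apply: entire1M => //; apply: entire1M; [exact: entire1_cst|exact: entire1X].
Qed.

Let eE1 : entire1 (dv Efun). Proof. apply: entire1_derivative; exact: entire_E. Qed.

Lemma entire_a : entire1 afun.
Proof.
refine (closed_acoef (@entire1D R) (@entire1B R) (@entire1M R) (@entire1_cst R)
  el el1 el2 entire_E).
Qed.
Lemma entire_b : entire1 bfun.
Proof.
refine (closed_bcoef (@entire1D R) (@entire1B R) (@entire1M R) (@entire1_cst R)
  el el1 el2 entire_E eE1).
Qed.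

Lemma dv_ph z : dv ph z = lam z * ph z.
Proof. by rewrite /lam divfK. Qed.

Lemma dv_E z : dv Efun z = (dv lam z * ph z + lam z * (lam z * ph z)) * (Y z - ph z + 1)
  + lam z * ph z * (dv Y z - lam z * ph z) - 4 * lam z * dv lam z * ph z
  - 2 * lam z ^+ 2 * (lam z * ph z) + dv (dv lam) z * ph z + dv lam z * (lam z * ph z).
Proof.
have dl := entire1_dv z el; have dl1 := entire1_dv z el1.
have dp : der idC ph z (lam z * ph z) by rewrite -dv_ph; exact: entire1_dv.
have dY := entire1_dv z eY.
apply: dvE; rewrite /Efun.
apply: der_eq (derD (derB (derM (derM dl dp) (derD (derB dY dp) (der_const _ 1 z)))
  (derM (derM (der_const _ 2 z) (derX 2 dl)) dp)) (derM dl1 dp)).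
rewrite /=; ring.
Qed.

(** The left side is [lam * ph] times the differential equation, in which [Y] and [Y'] have been
    expressed by [Efun] and its derivative. *)
Lemma quadratic z : afun z * ph z ^+ 2 + bfun z * ph z + cfun z = 0.
Proof.
have -> : afun z * ph z ^+ 2 + bfun z * ph z + cfun z = lam z * ph z *
  (lam z * ph z * (Y z - ph z + 1) * Y z + lam z ^+ 2 * Y z
   - (ph z - 1) * ((lam z ^+ 2 - dv lam z) * Y z + lam z * dv Y z)).
  rewrite /afun /bfun /cfun /acoef /bcoef /ccoef dv_E /Efun; ring.
by rewrite ode subrr mulr0.
Qed.

(** The sum is the quadratic taken at [ph = 1]. There the differential equation reduces to
    [lam * Y * (Y + lam) = 0], and the two factors are [lam * Y] and [lam * (Y + lam)]. *)
Lemma coefficient_sum z : afun z + bfun z + cfun z =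
  (2 * lam z ^+ 2 - dv lam z + Efun z) * (3 * lam z ^+ 2 - dv lam z + Efun z).
Proof. rewrite /afun /bfun /cfun /acoef /bcoef /ccoef; ring. Qed.

Hypotheses (clam : zero_or_centered lam) (cY : zero_or_centered Y)
  (cy : zero_or_centered (fun z => Y z - ph z)) (cE : zero_or_centered Efun)
  (ca : zero_or_centered afun) (cb : zero_or_centered bfun).
Hypotheses (lam0 : exists z, lam z != 0) (Y0 : exists z, Y z != 0).

Let circle := main_circle eph ph0 eY clam cY cy (t := 7 / 8).

Let small_lam : small (7 / 8) lam.
Proof.
have [m [n H]] := circle ltac:(lra) ltac:(lra).
exists m, n => k x nk W z zr; have [rho [r1 r2 Hr]] := H k x nk W.
apply: (max_principle (@entire1_hol R lam (rho + 1) el) (le_trans zr r1)).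
- by rewrite ltrDl.
- exact: exprn_ge0.
by move=> w /Hr[].
Qed.

Let small_E : small (7 / 8) Efun.
Proof.
have [m [n H]] := circle ltac:(lra) ltac:(lra).
exists (m * 3 + 8)%N, n => k x nk W z zr; have [rho [r1 r2 Hr]] := H k x nk W.
apply: (max_principle (@entire1_hol R Efun (rho + 1) entire_E) (le_trans zr r1)).
- by rewrite ltrDl.
- exact: exprn_ge0.
move=> w /Hr[h1 h2 h3 h4 [h5 h6]].
have S1 : 1 <= 2 ^+ (k * m) :> R by rewrite exprn_ege1 // ler1n.
have := E_bound S1 (ph0 w) (h1 lam0) (h2 Y0) h3 h4 h5 h6 (ode w).
move=> /le_trans; apply; rewrite mulnDr mulnA exprD mulrC [2 ^+ (k * m * 3)]exprM.
rewrite ler_wpM2l ?exprn_ge0 //.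
have [k1 _ _ _] := W.
apply: (@le_trans _ _ (2 ^+ 8)).
  by rewrite -natrX ler_nat.
by rewrite ler_eXn2l ?ltr1n // leq_pmull // ltnW.
Qed.

Let sl : small (5 / 8) lam. Proof. by apply: small_mono small_lam; lra. Qed.
Let sl1' : small (6 / 8) (dv lam).
Proof. by apply: small_dv small_lam => //; lra. Qed.
Let sl1 : small (5 / 8) (dv lam). Proof. by apply: small_mono sl1'; lra. Qed.
Let sl2 : small (5 / 8) (dv (dv lam)).
Proof. by apply: small_dv sl1' => //; lra. Qed.
Let sE : small (5 / 8) Efun. Proof. by apply: small_mono small_E; lra. Qed.
Let sE1 : small (5 / 8) (dv Efun).
Proof. by apply: small_dv small_E; [lra|lra|lra|exact: entire_E]. Qed.

Let half_le : 1 / 2 <= 5 / 8 :> R. Proof. lra. Qed.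
Let sa : small (1 / 2) afun.
Proof.
apply: (small_mono half_le).
refine (closed_acoef (@smallD R ph Y _) (@smallB R ph Y _) (@smallM R ph Y _)
  (@small_cst R ph Y _) sl sl1 sl2 sE).
Qed.
Let sb : small (1 / 2) bfun.
Proof.
apply: (small_mono half_le).
refine (closed_bcoef (@smallD R ph Y _) (@smallB R ph Y _) (@smallM R ph Y _)
  (@small_cst R ph Y _) sl sl1 sl2 sE sE1).
Qed.
Let sc : small (1 / 2) cfun.
Proof.
apply: (small_mono half_le).
refine (closed_ccoef (@smallD R ph Y _) (@smallB R ph Y _) (@smallM R ph Y _)
  sl sl1 sE sE1).
Qed.
Let sl' : small (1 / 2) lam. Proof. by apply: small_mono small_lam; lra. Qed.
Let sE' : small (1 / 2) Efun. Proof. by apply: small_mono small_E; lra. Qed.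

Lemma small_dom t f g h : small t g -> small t h -> (forall z, nm (f z) <= nm (g z) + nm (h z)) ->
  small t f.
Proof.
move=> [m [n H]] [m' [n' H']] fgh; exists (maxn m m').+1, (maxn n n') => k x.
rewrite geq_max => /andP[nk nk'] W z zr.
apply: le_trans (fgh z) _; apply: le_trans (lerD (H k x nk W z zr) (H' k x nk' W z zr)) _.
have [k1 _ _ _] := W.
apply: le_trans (_ : 2 * 2 ^+ (k * maxn m m') <= _).
  by rewrite mulr2n mulrDl mul1r lerD // pow_le_km // ?leq_maxl ?leq_maxr.
by rewrite -exprS ler_eXn2l ?ltr1n // mulnS -[X in (X < _)%N]add0n ltn_add2r ltnW.
Qed.

(** The logarithmic derivatives of [c * ph] and [c] differ by [lam], so [small_log_relation] applies
    with [j = 1]. *)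
Let kill c : entire1 c -> zero_or_centered c -> small (1 / 2) c ->
  small (1 / 2) (fun z => c z * ph z) -> forall z, c z = 0.
Proof.
move=> ec zc sc0 scp; have ecp : entire1 (fun z => c z * ph z) by exact: entire1M.
have zcp : zero_or_centered (fun z => c z * ph z).
  by case: zc => [c0|c0]; [left=> z; rewrite c0 mul0r|right; rewrite mulf_neq0].
have [z|H|H] // := small_log_relation eph ph0 eY clam cY cy ode lam0 Y0 ecp ec zcp zc scp sc0 (ltn0Sn 0).
  have -> : dv (fun z => c z * ph z) z = dv c z * ph z + c z * (lam z * ph z).
    by apply: dvE; apply: derM; [exact: entire1_dv|rewrite -dv_ph; exact: entire1_dv].
  by ring.
by move=> z; have /eqP := H z; rewrite mulf_eq0 (negbTE (ph0 z)) orbF => /eqP.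
Qed.

(** Where [nm (ph z) > 1], dividing the quadratic equation by [ph] bounds [a * ph] by the other two
    coefficients; elsewhere it is bounded by [a]. *)
Let a_eq0 z : afun z = 0.
Proof.
apply: kill z => //; first exact: entire_a.
have [ma [na Ha]] := sa; have [mb [nb Hb]] := sb; have [mc [nc Hc]] := sc.
pose m3 := maxn ma (maxn mb mc).
exists m3.+1, (maxn na (maxn nb nc)) => k x.
rewrite geq_max => /andP[nka]; rewrite geq_max => /andP[nkb nkc] W z zr.
have [k1 _ _ _] := W; have p0 : 0 < nm (ph z) by rewrite nm_gt0.
have ba := le_trans (Ha k x nka W z zr) (pow_le_km R k (leq_maxl _ _ : (ma <= m3)%N)).
have bb : nm (bfun z) <= 2 ^+ (k * m3).
  by apply: le_trans (Hb k x nkb W z zr) _; rewrite pow_le_km // !leq_max leqnn orbT.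
have bc : nm (cfun z) <= 2 ^+ (k * m3).
  by apply: le_trans (Hc k x nkc W z zr) _; rewrite pow_le_km // !leq_max leqnn !orbT.
apply: le_trans (_ : 2 * 2 ^+ (k * m3) <= _); last first.
  by rewrite -exprS ler_eXn2l ?ltr1n // mulnS -[X in (X < _)%N]add0n ltn_add2r ltnW.
have q0 : 0 <= 2 ^+ (k * m3) :> R by rewrite exprn_ge0.
rewrite nmM; have [p1|p1] := leP (nm (ph z)) 1.
  have := nm_ge0 (afun z); nra.
have E : nm (afun z) * nm (ph z) ^+ 2 <= nm (bfun z) * nm (ph z) + nm (cfun z).
  rewrite -nmX -!nmM -[nm (_ * _)]nmN.
  have -> : - (afun z * ph z ^+ 2) = bfun z * ph z + cfun z.
    by apply/eqP; rewrite -subr_eq0 -oppr_eq0 opprB opprK addrC addrA quadratic.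
  by apply: le_trans (nmD _ _) _; rewrite nmM.
rewrite -(ler_pM2r p0) -mulrA -expr2; apply: le_trans E _.
have h1 : nm (bfun z) * nm (ph z) <= 2 ^+ (k * m3) * nm (ph z) by rewrite ler_wpM2r ?nm_ge0.
nra.
Qed.

Let b_eq0 z : bfun z = 0.
Proof.
apply: kill z => //; first exact: entire_b.
apply: (@small_dom _ _ cfun (fun=> 0)) => //; first exact: small_cst.
move=> z; rewrite nm0 addr0 -[nm (cfun z)]nmN.
by have := quadratic z; rewrite a_eq0 mul0r add0r => /eqP; rewrite addr_eq0 => /eqP->.
Qed.

Let c_eq0 z : cfun z = 0.
Proof. by have := quadratic z; rewrite a_eq0 b_eq0 !mul0r !add0r. Qed.

Theorem no_transcendental_quotient : False.
Proof.
have nl : ~ forall z, lam z = 0 by move=> H; have [z] := lam0; rewrite H eqxx.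
have rel := small_log_relation eph ph0 eY clam cY cy ode lam0 Y0.
have one0 : zero_or_centered (fun=> 1 : C) by right; exact: oner_neq0.
(* The relation of [small_log_relation] for [lam] and the constant 1. *)
have last j : (0 < j)%N -> (forall z, dv lam z = j%:R * lam z ^+ 2) -> False.
  move=> j0 Hl; have [z|//|/(_ 0)/eqP] := rel lam (fun=> 1) j el (entire1_cst 1) clam one0 sl'
    (small_cst _ _ _ _) j0.
    have -> : dv (fun=> 1 : C) z = 0 by apply: dvE; exact: der_const.
    by rewrite Hl; ring.
  by rewrite oner_eq0.
(* The equation [cfun = 0] reads [E' lam - E lam' = E (lam' - lam ^ 2 - E)], and the right side is
   [j lam * E * lam]. Hence [E = 0], that is [lam' = j.+1 lam ^ 2]. *)
have EE (j : nat) : (0 < j)%N -> (forall z, Efun z = dv lam z - j.+1%:R * lam z ^+ 2) -> False.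
  move=> j0 HE; have [z|H|//] := rel Efun lam j entire_E el cE clam sE' sl' j0.
    have E0 : dv Efun z * lam z - Efun z * dv lam z =
        Efun z * (dv lam z - lam z ^+ 2 - Efun z) + cfun z.
      by rewrite /cfun /ccoef; ring.
    by rewrite E0 c_eq0 addr0 {2}HE -natr1; ring.
  apply: (last j.+1) => // z; apply/esym/eqP; rewrite -subr_eq0 -oppr_eq0 opprB.
  by rewrite -HE H.
have eG1 := closed_factor (@entire1D R) (@entire1B R) (@entire1M R)
  (@entire1_cst R) el el1 entire_E 2.
have eG2 := closed_factor (@entire1D R) (@entire1B R) (@entire1M R)
  (@entire1_cst R) el el1 entire_E 3.
have [z|H|H] := entire1_mul_eq0 eG1 eG2.
- by rewrite -coefficient_sum a_eq0 b_eq0 c_eq0 !addr0.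
- apply: (EE 1%N) => // z; have /eqP := H z; rewrite addrC addr_eq0 => /eqP->; rewrite opprB //.
- apply: (EE 2%N) => // z; have /eqP := H z; rewrite addrC addr_eq0 => /eqP->; rewrite opprB //.
Qed.

End Contradiction.

(** * From the equation of [F] to that of [Y] *)

Section OneVariable.
Variable R : realType.
Local Notation C := (CC R).
Local Notation idC := (fun z : C => z).
Implicit Types (f g h : C -> C) (z w a b : C).

(** If division by [z] never stopped, the maximum principle on a circle of radius at least
    [2 * nm w] would give [nm (f w) <= M / 2 ^ m] for every [m]. *)
Lemma factor_at0 f : entire1 f -> (exists z, f z != 0) ->
  exists m g, [/\ entire1 g, g 0 != 0 & forall z, f z = z ^+ m * g z].
Proof.
move=> ef [w fw]; apply: contrapT => H.
have fac m : exists g, entire1 g /\ forall z, f z = z ^+ m * g z.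
  elim: m => [|m [g [eg fg]]]; first by exists f; split=> // z; rewrite expr0 mul1r.
  have g0 : g 0 = 0 by apply: contrapT => /eqP g0; apply: H; exists m, g.
  exists (quo g 0); split.
    move=> z; have zR : nm z < nm z + 1 by rewrite ltrDl.
    apply: (hol_quo (@entire1_hol R g (nm z + 1) eg)) => //.
    by rewrite nm0; have := nm_ge0 z; lra.
  by move=> z; rewrite fg {1}(quoE z g0) subr0 exprS mulrA (mulrC z).
pose r := 2 * (nm w + 1).
have w0 := nm_ge0 w.
have r0 : 0 < r by rewrite /r; lra.
have [M M0 HM] := hol_bounded (@entire1_hol R f (r + 1) ef) (ltW r0) (ltac:(lra) : r < r + 1).
have bound m : nm (f w) <= M * (1 / 2) ^+ m.
  have [g [eg fg]] := fac m; rewrite fg nmM nmX.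
  have gb : nm (g w) <= M / r ^+ m.
    apply: (max_principle (@entire1_hol R g (r + 1) eg) (r := r)).
    - by rewrite /r; lra.
    - by lra.
    - by rewrite divr_ge0 ?exprn_ge0 // ltW.
    move=> z zr; rewrite ler_pdivlMr ?exprn_gt0 //.
    have := HM z; rewrite zr => /(_ (lexx _)); rewrite fg nmM nmX zr mulrC //.
  apply: le_trans (_ : nm w ^+ m * (M / r ^+ m) <= _).
    by rewrite ler_wpM2l ?exprn_ge0.
  rewrite mulrCA ler_wpM2l ?(ltW M0) // -expr_div_n.
  apply: lerXn2r; rewrite ?nnegrE ?divr_ge0 ?(ltW r0) //.
  rewrite ler_pdivrMr // /r; lra.
have N0 : 0 < nm (f w) by rewrite nm_gt0.
have [m Hm] := pow2_unbounded (M / nm (f w)).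
have := bound m; rewrite expr_div_n expr1n mul1r ler_pdivlMr ?exprn_gt0 //.
by rewrite mulrC -ler_pdivlMr // leNgt Hm.
Qed.

Lemma factor_at a f : entire1 f -> (exists z, f z != 0) ->
  exists m g, [/\ entire1 g, g a != 0 & forall z, f z = (z - a) ^+ m * g z].
Proof.
move=> ef [w fw].
have [|m [g [eg g0 fg]]] := factor_at0 (entire1_shift a ef); first by exists (w - a); rewrite subrK.
exists m, (fun z => g (z - a)); split; first exact: entire1_shift.
  by rewrite subrr.
by move=> z; rewrite -fg subrK.
Qed.

Lemma dv_shift f a : entire1 f -> dv (fun y => f (y + a)) = fun y => dv f (y + a).
Proof.
by move=> ef; apply/funext => y; apply: dvE; apply: der_shift; exact: entire1_dv.
Qed.

Lemma dv_eq0_const f : entire1 f -> (forall z, dv f z = 0) -> forall z, f z = f 0.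
Proof.
move=> ef df z; apply: (@const_on_disc R (nm z + 1)); last by rewrite ltrDl.
by move=> w _; rewrite -(df w); exact: entire1_dv.
Qed.

(* At a zero of order [m >= 1] of [f] the derivative vanishes to order [m - 1]. *)
Lemma entire_inverse_log_derivative f : entire1 f -> (exists z, f z != 0) ->
  (forall z, dv f z = 0 -> f z = 0) ->
  exists h, entire1 h /\ forall z, dv f z != 0 -> h z = f z / dv f z.
Proof.
move=> ef fn0 crit; have ef' := entire1_derivative ef.
(* A zero of [f'] is by hypothesis one of [f], hence a multiple one, and [f / f'] extends there by
   0. *)
pose h z := if dv f z == 0 then 0 else f z / dv f z.
exists h; split; last by move=> z; rewrite /h => /negbTE ->.
move=> p; have [fp|fp] := eqVneq (dv f p) 0; last first.
  have n0 : 0 < nm (dv f p) by rewrite nm_gt0.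
  have Dd := der_div fp (entire1_dv p ef) (entire1_dv p ef').
  eexists; refine (der_near (g := h) _ _ Dd); first by rewrite /h (negbTE fp).
  apply: nr_mono (entire1_cont p ef' n0) => k hk.
  rewrite /h ifN //; apply: contraTneq hk => ->.
  by rewrite sub0r nmN ltxx.
have [m [g [eg gp fg]]] := factor_at p ef fn0.
have m0 : (0 < m)%N.
  rewrite lt0n; apply: contraNneq gp => m0.
  by have := crit p fp; rewrite fg m0 expr0 mul1r => ->.
(* The cofactor of [f']: near [p] one has [f / f' = (z - p) * g / d] with [d p != 0]. *)
pose d z := m%:R * g z + (z - p) * dv g z.
have eg' := entire1_derivative eg.
have ed : entire1 d.
  apply: entire1D; first by apply: entire1M => //; exact: entire1_cst.
  by apply: entire1M => // z; eexists; exact: der_subc.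
have dp : d p != 0.
  by rewrite /d subrr mul0r addr0 mulf_neq0 // pnatr_eq0 -lt0n.
have Ef' z : dv f z = (z - p) ^+ m.-1 * d z.
  apply: dvE; apply: (@der_ext _ _ _ (fun z => (z - p) ^+ m * g z)).
    by move=> y; rewrite fg.
  apply: der_eq (derM (derX m (der_subc p z)) (entire1_dv z eg)).
  have zm : (z - p) ^+ m = (z - p) * (z - p) ^+ m.-1 by rewrite -exprS prednK.
  by rewrite zm /d; ring.
have Dn := derM (der_subc p p) (entire1_dv p eg).
have Dd := der_div dp Dn (entire1_dv p ed).
have n0 : 0 < nm (d p) by rewrite nm_gt0.
eexists; refine (der_near (g := h) _ _ Dd).
  by rewrite /h fp eqxx subrr !mul0r.
apply: nr_mono (entire1_cont p ed n0) => k hk.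
have dk : d (p + k) != 0.
  by apply: contraTneq hk => ->; rewrite sub0r nmN ltxx.
have [->|k0] := eqVneq k 0; first by rewrite addr0 /h fp eqxx subrr !mul0r.
have pk : p + k - p = k by ring.
have fk : dv f (p + k) != 0 by rewrite Ef' pk mulf_neq0 // expf_neq0.
have km : k ^+ m = k * k ^+ m.-1 by rewrite -exprS prednK.
rewrite /h ifN // fg Ef' pk km; field.
by rewrite dk expf_neq0.
Qed.

Theorem log_quotient_constant (F phi : C -> C) b : b != 0 -> entire1 F -> entire1 phi ->
  (forall z, phi z != 0) -> (forall z, dv F z = phi z * F z + b) ->
  (forall z, dv F z = 0 -> F z = - b) -> forall z, phi z = phi 0.
Proof.
move=> b0 eF ep p0 FE crit.
apply: dv_eq0_const => // z1; apply: contrapT => /eqP dphi.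
have el := entire_lam ep p0.
have lz1 : lam phi z1 != 0 by rewrite /lam mulf_neq0 // invr_neq0.
have lam0 : exists z, lam phi z != 0 by exists z1.
have not1 : ~ forall z, phi z = 1.
  move=> H; move: dphi; have -> : dv phi z1 = 0; last by rewrite eqxx.
  by apply: dvE; apply: (@der_ext _ _ _ (fun=> 1)) => [y|]; [rewrite H|exact: der_const].
pose f z := F z + b.
have ef : entire1 f by apply: entire1D => //; exact: entire1_cst.
have df z : dv f z = dv F z.
  by apply: dvE; apply: der_eq (derD (entire1_dv z eF) (der_const _ b z)); rewrite addr0.
have dfE : dv f = dv F by apply/funext.
have fn0 : exists z, f z != 0.
  apply: contrapT => H; apply: not1 => z.
  have f0 y : f y = 0 by apply/eqP; apply: contraT => fy; exfalso; apply: H; exists y.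
  have Fb y : F y = - b by apply/eqP; rewrite -addr_eq0 -/(f y) f0.
  have F0 : dv F z = 0.
    by apply: dvE; apply: (@der_ext _ _ _ (fun=> - b)) => [y|]; [rewrite Fb|exact: der_const].
  have := FE z; rewrite F0 Fb mulrN => /eqP; rewrite eq_sym addrC subr_eq0 => /eqP E.
  by apply: (mulIf b0); rewrite -E mul1r.
have [|h [eh hE]] := entire_inverse_log_derivative ef fn0.
  by move=> z; rewrite df => /crit; rewrite /f => ->; rewrite addNr.
have F'n0 : exists z, dv F z != 0.
  apply: contrapT => H; apply: not1 => z.
  have F'0 y : dv F y = 0 by apply/eqP; apply: contraT => Fy; exfalso; apply: H; exists y.
  have := FE z; rewrite F'0 (crit z (F'0 z)) mulrN => /eqP; rewrite eq_sym addrC subr_eq0 => /eqP E.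
  by apply: (mulIf b0); rewrite -E mul1r.
have eF' := entire1_derivative eF.
pose Y z := lam phi z * (h z - (phi z)^-1).
have eY : entire1 Y.
  by apply: entire1M => //; apply: entire1B => //; exact: entire1V.
have dphiE z : dv phi z = lam phi z * phi z by rewrite dv_ph.
have dF' z : dv (dv F) z = lam phi z * phi z * F z + phi z * dv F z.
  apply: dvE; apply: (@der_ext _ _ _ (fun z => phi z * F z + b)).
    by move=> y; rewrite FE.
  apply: der_eq (derD (derM (entire1_dv z ep) (entire1_dv z eF)) (der_const _ b z)).
  by rewrite dphiE addr0.
(* Identities involving [f / f'] are checked where [F'] does not vanish and extended by the identity
   theorem. *)
have extend g : entire1 g -> (forall z, dv F z != 0 -> g z = 0) -> forall z, g z = 0.
  move=> eg g0; have [z|//|H] := entire1_mul_eq0 eg eF'.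
    by have [->|/g0->] := eqVneq (dv F z) 0; rewrite ?mulr0 ?mul0r.
  by have [z] := F'n0; rewrite H eqxx.
have hF z : dv F z * h z = f z.
  apply/eqP; rewrite -subr_eq0; apply/eqP.
  apply: (extend (fun z => dv F z * h z - f z)); first by apply: entire1B => //; exact: entire1M.
  by move=> y y0; rewrite hE df // mulrC divfK // subrr.
have dh z : dv (dv F) z * h z + dv F z * dv h z = dv F z.
  rewrite -[in RHS]df; apply/esym/dvE; apply: (@der_ext _ _ _ (fun z => dv F z * h z)) => //.
  by apply: derM; exact: entire1_dv.
have dY z : dv Y z = dv (lam phi) z * (h z - (phi z)^-1) +
    lam phi z * (dv h z + lam phi z / phi z).
  apply: dvE; apply: der_eq (derM (entire1_dv z el) (derB (entire1_dv z eh) (derV (p0 z) (entire1_dv z ep)))).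
  by rewrite dphiE; field.
have ode z : lam phi z * phi z * (Y z - phi z + 1) * Y z + lam phi z ^+ 2 * Y z
  = (phi z - 1) * ((lam phi z ^+ 2 - dv (lam phi) z) * Y z + lam phi z * dv Y z).
  have el1 := entire1_derivative el; have eY1 := entire1_derivative eY.
  apply/eqP; rewrite -subr_eq0; apply/eqP.
  apply: (extend (fun z => lam phi z * phi z * (Y z - phi z + 1) * Y z + lam phi z ^+ 2 * Y z
    - (phi z - 1) * ((lam phi z ^+ 2 - dv (lam phi) z) * Y z + lam phi z * dv Y z))).
    refine (closed_ode (@entire1D R) (@entire1B R) (@entire1M R) (@entire1_cst R) el el1 eY1 ep eY).
  move=> y y0; rewrite dY /Y.
  have E1 := dh y; rewrite dF' in E1; have E2 := hF y; rewrite /f in E2; have E3 := FE y.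
  have p0y := p0 y.
  move: (lam phi y) (dv (lam phi) y) (phi y) (h y) (dv h y) (F y) (dv F y) y0 E1 E2 E3 p0y
    => l l1 p H H' G G' G'0 E1 E2 E3 py.
  have EG : G = G' * H - b by rewrite E2 addrK.
  (* This relation expresses [b / G'] and [G / G'] by [p] and [H], which eliminates [F] and its
     derivative. *)
  have EG' : G' * (1 - p * H) = b * (1 - p).
    by rewrite [in LHS]mulrBr mulr1 {1}E3 EG; ring.
  have EH' : H' = 1 - (l * p * G + p * G') * H / G'.
    have e : G' * H' = G' - (l * p * G + p * G') * H.
      by apply/eqP; rewrite eq_sym subr_eq addrC E1.
    by apply: (mulfI G'0); rewrite e; field.
  have EB : b * (1 - p) / G' = 1 - p * H by rewrite -EG'; field.
  have EGG : G / G' = H - b / G' by rewrite EG; field.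
  (* Where [phi = 1] one cannot divide by [1 - p]; there [H = 1] and [Y] vanishes. *)
  have [p1|p1] := eqVneq p 1.
    rewrite p1 in EG' *; have H1 : H = 1.
      apply/esym/eqP; rewrite -subr_eq0; move/eqP: EG'.
      by rewrite subrr mulr0 mul1r mulf_eq0 (negbTE G'0).
    by rewrite H1 invr1; ring.
  have p1' : 1 - p != 0 by rewrite subr_eq0 eq_sym.
  have EbG : b / G' = (1 - p * H) / (1 - p).
    by rewrite -EB; field; rewrite ?G'0 ?p1'.
  have -> : H' = 1 - l * p * H * (H - (1 - p * H) / (1 - p)) - p * H.
    by rewrite EH' -EbG -EGG; field.
  by field; rewrite ?p1' ?py.
(* [Y = 0] would mean [h = 1 / phi], that is [F' = phi (F + b)]; compared with the equation of [F]
   this gives [phi = 1]. *)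
have Y0 : exists z, Y z != 0.
  apply: contrapT => H; have Yz z : Y z = 0.
    by apply/eqP; apply: contraT => Yz; exfalso; apply: H; exists z.
  have [z|Hl|Hh] := entire1_mul_eq0 el (entire1B eh (entire1V ep p0)).
  - exact: Yz.
  - by move: lz1; rewrite Hl eqxx.
  apply: not1 => z; have /eqP := Hh z; rewrite subr_eq0 => /eqP hz.
  have := hF z; rewrite hz /f => E; have := FE z.
  have -> : dv F z = phi z * (F z + b) by rewrite -E mulrC divfK.
  rewrite mulrDr => /addrI E2; apply: (mulIf b0); by rewrite mul1r.
(* Six functions have to be [zero_or_centered]; a point where none of those that are not identically
   zero vanishes becomes the origin. *)
pose G i := nth (fun=> 1 : C) [:: lam phi; Y; (fun z => Y z - phi z); Efun phi Y; afun phi Y; bfun phi Y] i.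
pose G' i := if `[< exists z, G i z != 0 >] then G i else (fun=> 1).
have eG i : (i < 6)%N -> entire1 (G i).
  case: i => [|[|[|[|[|[|//]]]]]] _ //=.
  - exact: entire1B.
  - exact: entire_E.
  - exact: entire_a.
  - exact: entire_b.
have [i ilt|z0 Hz0] := @generic_point R 6 G'.
  rewrite /G'; case: asboolP => [H|_]; first by split=> //; exact: eG.
  by split; [exact: entire1_cst|exists 0; exact: oner_neq0].
have zoc i : (i < 6)%N -> zero_or_centered (fun z => G i (z + z0)).
  move=> ilt; have := Hz0 i ilt; rewrite /G'; case: asboolP => [_ H|H _].
    by right; rewrite add0r.
  by left=> z; apply/eqP; apply: contraT => Gz; exfalso; apply: H; exists (z + z0).
pose sp z := phi (z + z0); pose sY z := Y (z + z0).
have esp : entire1 sp by exact: entire1_shift.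
have esY : entire1 sY by exact: entire1_shift.
have slam : lam sp = fun z => lam phi (z + z0).
  by apply/funext => z; rewrite /lam /sp (dv_shift z0 ep).
have sl1 : dv (lam sp) = fun z => dv (lam phi) (z + z0) by rewrite slam (dv_shift z0 el).
have sl2 : dv (dv (lam sp)) = fun z => dv (dv (lam phi)) (z + z0).
  by rewrite sl1 (dv_shift z0 (entire1_derivative el)).
have sE : Efun sp sY = fun z => Efun phi Y (z + z0).
  by apply/funext => z; rewrite /Efun sl1 slam.
have sE1 : dv (Efun sp sY) = fun z => dv (Efun phi Y) (z + z0).
  by rewrite sE (dv_shift z0 (entire_E ep p0 eY)).
have sa : afun sp sY = fun z => afun phi Y (z + z0).
  by apply/funext => z; rewrite /afun sl2 sl1 sE slam.
have sb : bfun sp sY = fun z => bfun phi Y (z + z0).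
  by apply/funext => z; rewrite /bfun sl2 sl1 sE1 sE slam.
apply: (@no_transcendental_quotient R sp sY esp (fun z => p0 _) esY).
- by move=> z; rewrite sl1 slam /sY (dv_shift z0 eY).
- by rewrite slam; exact: zoc 0%N isT.
- exact: zoc 1%N isT.
- exact: zoc 2%N isT.
- by rewrite sE; exact: zoc 3%N isT.
- by rewrite sa; exact: zoc 4%N isT.
- by rewrite sb; exact: zoc 5%N isT.
- by exists (z1 - z0); rewrite slam subrK.
- by have [z Yz] := Y0; exists (z - z0); rewrite /sY subrK.
Qed.

End OneVariable.

(** * Holomorphic functions of several variables *)

Section SharedValueOnLine.
Variable R : realType.
Local Notation C := (CC R).
Local Notation idC := (fun z : C => z).
Implicit Types (f g h : C -> C) (z w a b : C).

(** At a common simple zero both functions are divided by [z - p]; the ratio is there that of the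
    derivatives, hence nonzero. *)
Lemma entire_ratio f g : entire1 f -> entire1 g -> (forall z, f z = 0 <-> g z = 0) ->
  (forall z, f z = 0 -> dv f z != 0 /\ dv g z != 0) ->
  exists phi, [/\ entire1 phi, forall z, phi z != 0 & forall z, g z = phi z * f z].
Proof.
move=> ef eg fg simple.
pose phi z := if f z == 0 then dv g z / dv f z else g z / f z.
exists phi; split.
- move=> p; have [fp|fp] := eqVneq (f p) 0; last first.
    have n0 : 0 < nm (f p) by rewrite nm_gt0.
    eexists; refine (der_near (g := phi) _ _ (der_div fp (entire1_dv p eg) (entire1_dv p ef))).
      by rewrite /phi (negbTE fp).
    apply: nr_mono (entire1_cont p ef n0) => k hk.
    by rewrite /phi ifN //; apply: contraTneq hk => ->; rewrite sub0r nmN ltxx.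
  have gp : g p = 0 by apply/fg.
  have [f'p g'p] := simple p fp.
  have eq h : entire1 h -> h p = 0 -> entire1 (quo h p).
    move=> eh hp z; have m1 : nm z < nm z + nm p + 1 by have := nm_ge0 p; lra.
    apply: (hol_quo (@entire1_hol R h (nm z + nm p + 1) eh)) => //.
    by have := nm_ge0 z; lra.
  have qp h : quo h p p = dv h p by rewrite /quo eqxx.
  have qf0 : quo f p p != 0 by rewrite qp.
  have n0 : 0 < nm (quo f p p) by rewrite nm_gt0.
  have ef1 := eq f ef fp; have eg1 := eq g eg gp.
  eexists; refine (der_near (g := phi) _ _ (der_div qf0 (entire1_dv p eg1) (entire1_dv p ef1))).
    by rewrite /phi fp eqxx !qp.
  apply: nr_mono (entire1_cont p ef1 n0) => k hk.
  have qk : quo f p (p + k) != 0.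
    by apply: contraTneq hk => ->; rewrite sub0r nmN ltxx.
  have [->|k0] := eqVneq k 0; first by rewrite addr0 /phi fp eqxx !qp.
  have pk : p + k - p = k by ring.
  have fk : f (p + k) != 0 by rewrite (quoE _ fp) pk mulf_neq0.
  rewrite /phi ifN // (quoE (p + k) fp) (quoE (p + k) gp) pk; field.
  by rewrite k0 qk.
- move=> z; rewrite /phi; have [fz|fz] := eqVneq (f z) 0.
    by have [f' g'] := simple z fz; rewrite mulf_neq0 // invr_neq0.
  rewrite mulf_neq0 ?invr_neq0 //; apply: contraNneq fz => gz.
  by apply/eqP/fg.
- move=> z; rewrite /phi; have [fz|fz] := eqVneq (f z) 0; last by rewrite divfK.
  by rewrite fz mulr0; apply/fg.
Qed.

Theorem line_equation g b : b != 0 -> entire1 g ->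
  (forall z, dv g z = 0 -> g z = 0) -> (forall z, g z = b <-> dv g z = b) ->
  (forall z, g z = b -> dv (dv g) z != 0) ->
  exists2 A, A != 0 & forall z, dv g z - b = A * (g z - b).
Proof.
move=> b0 eg crit share simple.
have ec := entire1_cst b.
have eF := entire1B eg ec; have eG := entire1B (entire1_derivative eg) ec.
have dF z : dv (fun z => g z - b) z = dv g z.
  by apply: dvE; apply: der_eq (derB (entire1_dv z eg) (der_const _ b z)); rewrite subr0.
have dG z : dv (fun z => dv g z - b) z = dv (dv g) z.
  apply: dvE; apply: der_eq (derB (entire1_dv z (entire1_derivative eg)) (der_const _ b z)).
  by rewrite subr0.
have [z|z|phi [ephi phi0 E]] := entire_ratio eF eG.
- by split=> /eqP; rewrite subr_eq0 => /eqP /share ->; rewrite subrr.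
- move=> /eqP; rewrite subr_eq0 => /eqP gz; rewrite dF dG; split; last exact: simple.
  by have /share -> := gz.
exists (phi 0); first exact: phi0.
have cst := log_quotient_constant b0 eF ephi phi0.
move=> z; rewrite E cst // => y; rewrite dF.
  by rewrite -E subrK.
by move=> /crit ->; rewrite sub0r.
Qed.

End SharedValueOnLine.

(** * Partial derivatives and level sets *)

Section SeveralVariables.
Variables (R : realType) (n : nat).
Local Notation C := (CC R).
Local Notation idC := (fun z : C => z).
Local Notation V := 'rV[C]_n.
Implicit Types (f g q : V -> C) (p z v w : V) (t s : C) (i j : 'I_n).

Definition vnm w : R := \sum_j nm (w 0 j).
Definition lin (c : 'I_n -> C) w : C := \sum_j w 0 j * c j.
Definition approx f z (c : 'I_n -> C) := forall e : R, 0 < e ->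
  exists2 d : R, 0 < d & forall w, vnm w < d ->
    nm (f (z + w) - f z - lin c w) <= e * vnm w.
Definition hol f := forall z, exists c, approx f z c.
Definition evec i : V := delta_mx 0 i.
Definition pd i f z : C := dv (fun t => f (z + t *: evec i)) 0.

Lemma vnm_ge0 w : 0 <= vnm w.
Proof. by apply: sumr_ge0 => j _; exact: nm_ge0. Qed.

Lemma vnmD v w : vnm (v + w) <= vnm v + vnm w.
Proof. by rewrite -big_split /=; apply: ler_sum => j _; rewrite mxE nmD. Qed.

Lemma vnmZ t w : vnm (t *: w) = nm t * vnm w.
Proof. by rewrite mulr_sumr; apply: eq_bigr => j _; rewrite mxE nmM. Qed.

Lemma vnm0 : vnm 0 = 0.
Proof. by apply: big1 => j _; rewrite mxE nm0. Qed.

Lemma vnm_eq0 w : vnm w = 0 -> w = 0.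
Proof.
move=> /eqP; rewrite psumr_eq0 => [/allP H|j _]; last exact: nm_ge0.
apply/rowP => j; rewrite mxE; apply: nm_eq0; apply/eqP.
by have := H j (mem_index_enum _).
Qed.

Lemma linZ c t w : lin c (t *: w) = t * lin c w.
Proof. by rewrite mulr_sumr; apply: eq_bigr => j _; rewrite mxE mulrA. Qed.

Lemma linD c v w : lin c (v + w) = lin c v + lin c w.
Proof. by rewrite -big_split /=; apply: eq_bigr => j _; rewrite mxE mulrDl. Qed.

Lemma linN c w : lin c (- w) = - lin c w.
Proof. by rewrite -scaleN1r linZ mulN1r. Qed.

Lemma lin_evec c i : lin c (evec i) = c i.
Proof.
rewrite /lin (bigD1 i) //= mxE !eqxx mul1r big1 ?addr0 // => j ji.
by rewrite mxE /= (negbTE ji) mul0r.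
Qed.

Lemma vnm_evec i : vnm (evec i) = 1.
Proof.
rewrite /vnm (bigD1 i) //= mxE !eqxx nm1 big1 ?addr0 // => j ji.
by rewrite mxE /= (negbTE ji) nm0.
Qed.

Lemma nm_lin c w : nm (lin c w) <= vnm w * \sum_j nm (c j).
Proof.
apply: (@le_trans _ _ (\sum_j nm (w 0 j) * nm (c j))).
  rewrite /lin; elim: (index_enum _) => [|j l IH]; first by rewrite !big_nil nm0.
  by rewrite !big_cons; apply: le_trans (nmD _ _) _; rewrite nmM lerD2l.
rewrite mulr_sumr; apply: ler_sum => j _; rewrite ler_wpM2r ?nm_ge0 //.
rewrite /vnm (bigD1 j) //= lerDl; apply: sumr_ge0 => k _; exact: nm_ge0.
Qed.

Lemma approx_slice f p v t c : approx f (p + t *: v) c ->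
  der idC (fun s => f (p + s *: v)) t (lin c v).
Proof.
move=> fc e e0; have m0 := vnm_ge0 v.
have m1 : 0 < vnm v + 1 by lra.
have [d d0 Hd] := fc _ (divr_gt0 e0 m1).
exists (d / (vnm v + 1)); first exact: divr_gt0.
move=> h; rewrite ltr_pdivlMr // => hd.
have h0 := nm_ge0 h.
have := Hd (h *: v); rewrite vnmZ linZ.
have -> : p + t *: v + h *: v = p + (t + h) *: v by rewrite scalerDl addrA.
have hd' : nm h * vnm v < d by lra.
move=> /(_ hd') /le_trans; apply.
rewrite mulrAC ler_pdivrMr // -mulrA ler_wpM2l ?(ltW e0) //; lra.
Qed.

Lemma approx_pd f z c i : approx f z c -> pd i f z = c i.
Proof.
move=> fc; apply: dvE; rewrite -(lin_evec c i); apply: approx_slice.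
by rewrite scale0r addr0.
Qed.

Lemma hol_approx f z : hol f -> approx f z (fun j => pd j f z).
Proof.
move=> hf; have [c fc] := hf z; suff -> : (fun j => pd j f z) = c by [].
by apply/funext => j; exact: approx_pd.
Qed.

Lemma hol_slice f p v t : hol f ->
  der idC (fun s => f (p + s *: v)) t (lin (fun j => pd j f (p + t *: v)) v).
Proof. by move=> hf; apply: approx_slice; exact: hol_approx. Qed.

Lemma hol_slice_entire f p v : hol f -> entire1 (fun s => f (p + s *: v)).
Proof. by move=> hf t; eexists; exact: hol_slice. Qed.

Lemma hol_cont f z : hol f -> forall e : R, 0 < e -> exists2 d : R, 0 < d &
  forall w, vnm w < d -> nm (f (z + w) - f z) < e.
Proof.
move=> hf e e0; have [d d0 Hd] := hol_approx z hf ltr01.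
set S := \sum_j nm (pd j f z).
have S0 : 0 <= S by apply: sumr_ge0 => j _; exact: nm_ge0.
have S1 : 0 < S + 2 by lra.
exists (Num.min d (e / (S + 2))); first by rewrite lt_min d0 divr_gt0.
move=> w; rewrite lt_min ltr_pdivlMr // => /andP[w1 w2].
have -> : f (z + w) - f z = (f (z + w) - f z - lin (fun j => pd j f z) w)
  + lin (fun j => pd j f z) w by ring.
apply: le_lt_trans (nmD _ _) _.
have := Hd w w1; have := nm_lin (fun j => pd j f z) w; rewrite -/S.
have := vnm_ge0 w; move: (vnm w) w2 => m; lra.
Qed.

Section LocalBounds.
Variables (f : V -> C) (z0 : V) (d M : R).
Hypotheses (hf : hol f) (d0 : 0 < d) (fM : forall w, vnm w < 4 * d -> nm (f (z0 + w)) <= M).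

(** Taylor's bound on the complex line in the direction of [w], scaled so that the unit circle lies
    at distance [d]. The constant is uniform in the point and the direction. *)
Lemma second_order_bound z w : vnm (z - z0) < 2 * d -> vnm w <= d / 2 ->
  nm (f (z + w) - f z - lin (fun j => pd j f z) w) <= 2 * M / d ^+ 2 * vnm w ^+ 2.
Proof.
have d0' := d0.
move=> zd wd; have M0 : 0 <= M.
  by apply: le_trans (nm_ge0 (f (z0 + 0))) (fM _); rewrite vnm0; lra.
have w0 := vnm_ge0 w.
have [w00|wn0] := eqVneq (vnm w) 0.
  have -> : w = 0 by exact: vnm_eq0.
  have -> : lin (fun j => pd j f z) 0 = 0.
    by rewrite -(scale0r (0 : V)) linZ mul0r.
  by rewrite addr0 subrr subr0 nm0 mulr_ge0 ?sqr_ge0 // divr_ge0 ?sqr_ge0 ?mulr_ge0.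
have wp : 0 < vnm w by rewrite lt_def wn0.
pose s := vnm w / d; have s0 : 0 < s by exact: divr_gt0.
have s2 : s <= 1 / 2 by rewrite /s ler_pdivrMr //; lra.
pose v := rc s^-1 *: w.
have vE : w = rc s *: v.
  by rewrite /v scalerA -rcM divff ?gt_eqF // rc1 scale1r.
have mv : vnm v = d.
  rewrite /v vnmZ nm_rc gtr0_norm ?invr_gt0 // /s; field; rewrite !gt_eqF //.
have eg := hol_slice_entire z v hf.
have n0 : nm (0 : C) + nm (rc s) < 1 by rewrite nm0 nm_rc gtr0_norm //; lra.
have gM (t : C) : nm t = 1 -> nm (f (z + t *: v)) <= M.
  move=> t1; have -> : z + t *: v = z0 + ((z - z0) + t *: v).
    by rewrite addrA [z0 + _]addrC subrK.
  apply: fM; apply: le_lt_trans (vnmD _ _) _; rewrite vnmZ t1 mv; lra.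
have := taylor2 (@entire1_hol R _ 2 eg) n0 ltac:(lra) gM.
rewrite add0r scale0r addr0 -vE nm0 subr0 nm_rc gtr0_norm // expr1n mul1r.
have -> : dv (fun s => f (z + s *: v)) 0 = lin (fun j => pd j f z) v.
  by rewrite (dvE (hol_slice z v 0 hf)) scale0r addr0.
rewrite -linZ -vE => /le_trans; apply.
have -> : 2 * M / d ^+ 2 * vnm w ^+ 2 = M * 2 * s ^+ 2.
  by rewrite /s; field; rewrite gt_eqF.
rewrite ler_wpM2r ?sqr_ge0 // ler_wpM2l // div1r -[leRHS]invrK.
rewrite lef_pV2 ?posrE ?invr_gt0 //; last lra.
by rewrite -div1r; lra.
Qed.

End LocalBounds.

Lemma local_bound f z0 : hol f -> exists d M : R, [/\ 0 < d, 0 < M &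
  forall w, vnm w < 4 * d -> nm (f (z0 + w)) <= M].
Proof.
move=> hf; have [d d0 Hd] := hol_cont z0 hf ltr01.
exists (d / 4), (nm (f z0) + 1); split; first lra.
  by have := nm_ge0 (f z0); lra.
move=> w wd; have := Hd w ltac:(lra); have := nm_geB (f (z0 + w)) (f z0); lra.
Qed.

(** A difference quotient with a fixed small step [s] is as continuous as [f], and by
    [second_order_bound] approximates [pd j f] uniformly near [z0]. *)
Lemma pd_cont f z0 j : hol f -> forall e : R, 0 < e -> exists2 d : R, 0 < d &
  forall w, vnm w < d -> nm (pd j f (z0 + w) - pd j f z0) < e.
Proof.
move=> hf e e0; have [d [M [d0 M0 fM]]] := local_bound z0 hf.
pose B := 2 * M / d ^+ 2; have B0 : 0 < B by rewrite divr_gt0 ?mulr_gt0 ?exprn_gt0.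
pose s := Num.min (d / 2) (e / (4 * B)).
have B4 : 0 < 4 * B by lra.
have s0 : 0 < s by rewrite lt_min (divr_gt0 d0) // (divr_gt0 e0).
have sd : s <= d / 2 by rewrite ge_min lexx.
have sB : s * B <= e / 4.
  have : s <= e / (4 * B) by rewrite ge_min lexx orbT.
  move=> h; apply: le_trans (ler_wpM2r (ltW B0) h) _.
  by rewrite le_eqVlt; apply/orP; left; apply/eqP; field; rewrite gt_eqF.
have q z : vnm (z - z0) < 2 * d ->
    nm (f (z + rc s *: evec j) - f z - rc s * pd j f z) <= B * s ^+ 2.
  move=> zd; have := second_order_bound hf d0 fM (w := rc s *: evec j) zd.
  by rewrite vnmZ vnm_evec mulr1 nm_rc gtr0_norm // linZ lin_evec; apply.
have es : 0 < e * s / 8 by rewrite divr_gt0 ?mulr_gt0.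
have [d1 d10 H1] := hol_cont z0 hf es.
have [d2 d20 H2] := hol_cont (z0 + rc s *: evec j) hf es.
exists (Num.min d (Num.min d1 d2)); first by rewrite !lt_min d0 d10.
move=> w; rewrite !lt_min => /and3P[w1 w2 w3].
have h1 := H1 w w2; have h2 := H2 w w3.
rewrite addrAC in h2.
have q1 := q z0; rewrite subrr vnm0 in q1; have {}q1 := q1 ltac:(lra).
have q2 := q (z0 + w); rewrite addrAC subrr add0r in q2; have {}q2 := q2 ltac:(lra).
have E : rc s * (pd j f (z0 + w) - pd j f z0) =
  (f (z0 + w + rc s *: evec j) - f (z0 + rc s *: evec j)) - (f (z0 + w) - f z0)
  - (f (z0 + w + rc s *: evec j) - f (z0 + w) - rc s * pd j f (z0 + w))
  + (f (z0 + rc s *: evec j) - f z0 - rc s * pd j f z0) by ring.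
have : s * nm (pd j f (z0 + w) - pd j f z0) < e * s.
  have -> : s * nm (pd j f (z0 + w) - pd j f z0) = nm (rc s * (pd j f (z0 + w) - pd j f z0)).
    by rewrite nmM nm_rc gtr0_norm.
  rewrite E; apply: le_lt_trans (nmD _ _) _.
  apply: le_lt_trans (lerD (nmB _ _) (lexx _)) _.
  apply: le_lt_trans (lerD (lerD (nmB _ _) (lexx _)) (lexx _)) _.
  have : B * s ^+ 2 <= e / 4 * s by rewrite expr2 mulrA (mulrC B); exact: ler_wpM2r (ltW s0) _ _ sB.
  lra.
by rewrite mulrC ltr_pM2r.
Qed.

Section LinearMean.
Variables (K : 'I_n -> C -> C) (r : R).
Hypothesis cK : forall j, ccont (K j) r.

Let ccont_sum w (l : seq 'I_n) : ccont (fun t => \sum_(j <- l) w 0 j * K j t) r.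
Proof.
elim: l => [|k l IH] t tr.
  by apply: (cont_ext (f := fun=> 0)) => [y|]; [rewrite big_nil|exact: cont_const].
apply: (cont_ext (f := fun t => w 0 k * K k t + \sum_(j <- l) w 0 j * K j t)).
  by move=> y; rewrite big_cons.
by apply: contD; [apply: contM; [exact: cont_const|exact: cK]|exact: IH].
Qed.

Lemma ccont_lin w : ccont (fun t => lin (fun j => K j t) w) r.
Proof. exact: ccont_sum. Qed.

Lemma mean_lin w : 0 <= r ->
  mean (fun t => lin (fun j => K j t) w) r = lin (fun j => mean (K j) r) w.
Proof.
move=> r0; rewrite /lin; elim: (index_enum _) => [|j l IH].
  rewrite big_nil -[RHS](mean_cst r 0); apply: mean_ext => // t _.
  by rewrite big_nil.
rewrite big_cons -IH -(meanZ r0 _ (cK j)).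
rewrite -(meanD r0 (ccontM (@ccont_cst R r (w 0 j)) (cK j)) (ccont_sum w l)).
by apply: mean_ext => // t _; rewrite big_cons.
Qed.

End LinearMean.

(** [pd i f] is a Cauchy mean of [f] over a circle in direction [i]. First-order expansions of [f]
    along this circle average to one of [pd i f], thanks to their uniform quadratic remainder. *)
Lemma hol_pd f i : hol f -> hol (pd i f).
Proof.
move=> hf z0; have [d [M [d0 M0 fM]]] := local_bound z0 hf.
pose K (t : C) := t / (t - 0) ^+ 2.
have n0d : nm (0 : C) < d by rewrite nm0.
have cK : ccont K d := ccont_kernel 2 n0d.
have csl z : ccont (fun t => f (z + t *: evec i)) d.
  by move=> t _; apply: der_cont; exact: hol_slice.
have pdE z : pd i f z = mean (fun t => f (z + t *: evec i) * K t) d.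
  apply: (cauchy_derivative (@entire1_hol R _ (d + 1) (hol_slice_entire z (evec i) hf)) n0d).
  by rewrite ltrDl.
pose Kp j (t : C) := pd j f (z0 + t *: evec i) * K t.
have cKp j : ccont (Kp j) d.
  apply: ccontM cK => t td e e0.
  have [d1 d10 H1] := pd_cont (z0 + t *: evec i) j hf e0.
  exists d1 => // h hd; rewrite scalerDl addrA; apply: H1.
  by rewrite vnmZ vnm_evec mulr1.
pose c j := mean (Kp j) d; exists c.
pose B := 2 * M / d ^+ 2 * (d / d ^+ 2).
have B0 : 0 < B by rewrite /B !mulr_gt0 ?invr_gt0 ?exprn_gt0.
suff quad w : vnm w <= d / 2 ->
    nm (pd i f (z0 + w) - pd i f z0 - lin c w) <= B * vnm w ^+ 2.
  move=> e e0; exists (Num.min (d / 2) (e / B)); first by rewrite lt_min !divr_gt0.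
  move=> w; rewrite lt_min (ltr_pdivlMr _ _ B0) => /andP[w1 w2].
  apply: le_trans (quad w (ltW w1)) _; rewrite expr2 mulrA ler_wpM2r ?vnm_ge0 //.
  by rewrite mulrC ltW.
move=> wd.
have clin := ccont_lin cKp w.
rewrite -(mean_lin cKp w (ltW d0)) !pdE.
have c1 z := ccontM (csl z) cK.
rewrite -(meanB (ltW d0) (c1 _) (c1 _)) -(meanB (ltW d0) (ccontB (c1 _) (c1 _)) clin).
apply: mean_bound; first exact: ltW.
  by apply: ccontB => //; apply: ccontB.
move=> t td.
have -> : f (z0 + w + t *: evec i) * K t - f (z0 + t *: evec i) * K t
    - lin (fun j => Kp j t) w =
  (f (z0 + t *: evec i + w) - f (z0 + t *: evec i)
    - lin (fun j => pd j f (z0 + t *: evec i)) w) * K t.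
  have -> : lin (fun j => Kp j t) w = lin (fun j => pd j f (z0 + t *: evec i)) w * K t.
    by rewrite /lin mulr_suml; apply: eq_bigr => j _; rewrite mulrA.
  by rewrite (addrAC z0 w); ring.
rewrite nmM /B mulrAC; apply: ler_pM; rewrite ?nm_ge0 //.
  apply: (second_order_bound hf d0 fM) => //.
  by rewrite addrAC subrr add0r vnmZ vnm_evec mulr1 td; lra.
by have := nm_kernel 2 n0d td; rewrite nm0 [d - 0]subr0.
Qed.

Lemma hol_cst a : hol (fun=> a).
Proof.
move=> z; exists (fun=> 0) => e e0; exists 1 => // w _.
rewrite subrr /lin big1 ?subr0 ?nm0 => [|j _]; last by rewrite mulr0.
by rewrite mulr_ge0 ?vnm_ge0 ?ltW.
Qed.

Lemma holB f g : hol f -> hol g -> hol (fun z => f z - g z).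
Proof.
move=> hf hg z; have [c fc] := hf z; have [c' gc] := hg z.
exists (fun j => c j - c' j) => e e0; have e2 : 0 < e / 2 by lra.
have [d d0 Hd] := fc _ e2; have [d' d'0 Hd'] := gc _ e2.
exists (Num.min d d'); first by rewrite lt_min d0.
move=> w; rewrite lt_min => /andP[w1 w2].
have -> : lin (fun j => c j - c' j) w = lin c w - lin c' w.
  by rewrite /lin -sumrB; apply: eq_bigr => j _; rewrite mulrBr.
have -> : f (z + w) - g (z + w) - (f z - g z) - (lin c w - lin c' w) =
  (f (z + w) - f z - lin c w) - (g (z + w) - g z - lin c' w) by ring.
apply: le_trans (nmB _ _) _; have := Hd w w1; have := Hd' w w2; lra.
Qed.

Lemma pd_subc f b i : pd i (fun z => f z - b) = pd i f.
Proof.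
apply/funext => z; rewrite /pd.
have eq (g : C -> C) t l : der idC (fun s => g s - b) t l <-> der idC g t l.
  split=> H e e0; apply: nr_mono (H e e0) => h.
    by rewrite opprB addrA subrK.
  by rewrite opprB addrA subrK.
by rewrite /dv; congr xget; apply/funext => l; apply/propext; exact: eq.
Qed.

(* If [pd j q p] were too large, moving transversally by [s] from [p] along the
   tangent direction would leave [f - b] without zeros near [s = 0], against the
   maximum principle for its inverse. *)
Lemma tangent_to_level_set f q b p i j : hol f -> hol q ->
  (forall z, f z = b -> q z = b) -> f p = b -> pd i f p != 0 ->
  pd i f p * pd j q p = pd j f p * pd i q p.
Proof.
move=> hf hq fq fp fi0.
set al := pd i f p in fi0 *; set be := pd j f p.
(* A tangent direction: the derivative of [f] along [v] is 0, and that of [q] is [D] below. *)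
pose v := al *: evec j - be *: evec i.
pose VV := vnm v + 1.
have V0 := vnm_ge0 v.
have al0 : 0 < nm al by rewrite nm_gt0.
have linv c : lin c v = al * c j - be * c i.
  by rewrite /v linD linN !linZ !lin_evec.
apply/eqP; rewrite -subr_eq0; set D := _ - _; rewrite -nm_eq0E eq_le nm_ge0 andbT leNgt.
apply/negP => D0.
set g := nm (pd i q p); have g0 : 0 <= g by exact: nm_ge0.
(* [e] limits the transversal drift relative to the step [t], and [et] the error of the first-order
   expansions; together their effect on [q] stays below [t * nm D]. *)
pose e := Num.min (1 / 4) (nm D / (8 * (g + 1))).
have e0 : 0 < e by rewrite lt_min !divr_gt0 // mulr_gt0 //; lra.
have e4 : e <= 1 / 4 by rewrite ge_min lexx.
have eg : e * g <= nm D / 8.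
  have h : e <= nm D / (8 * (g + 1)) by rewrite ge_min lexx orbT.
  apply: le_trans (ler_wpM2r g0 h) _.
  have -> : nm D / (8 * (g + 1)) * g = nm D / 8 * (g / (g + 1)) by field; rewrite gt_eqF //; lra.
  rewrite ler_piMr //; first by rewrite divr_ge0 // ltW.
  rewrite ler_pdivrMr; lra.
pose et := Num.min (nm al * e / (8 * VV)) (nm D / (8 * VV)).
have VV0 : 0 < VV by rewrite /VV; lra.
have et0 : 0 < et by rewrite lt_min !divr_gt0 ?mulr_gt0.
have et1 : et * VV <= nm al * e / 8.
  have h : et <= nm al * e / (8 * VV) by rewrite ge_min lexx.
  apply: le_trans (ler_wpM2r (ltW VV0) h) _.
  by rewrite le_eqVlt; apply/orP; left; apply/eqP; field; rewrite gt_eqF.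
have et2 : et * VV <= nm D / 8.
  have h : et <= nm D / (8 * VV) by rewrite ge_min lexx orbT.
  apply: le_trans (ler_wpM2r (ltW VV0) h) _.
  by rewrite le_eqVlt; apply/orP; left; apply/eqP; field; rewrite gt_eqF.
have [d1 d10 H1] := hol_approx p hf et0; have [d2 d20 H2] := hol_approx p hq et0.
pose dd := Num.min d1 d2; have dd0 : 0 < dd by rewrite lt_min d10.
pose t := dd / (2 * VV); have t0 : 0 < t by rewrite divr_gt0 ?mulr_gt0.
have tV : t * VV = dd / 2 by rewrite /t; field; rewrite gt_eqF.
pose W s : V := rc t *: v + s *: evec i.
have mW s : nm s <= 2 * e * t -> vnm (W s) <= t * VV.
  move=> sb; apply: le_trans (vnmD _ _) _; rewrite !vnmZ vnm_evec nm_rc gtr0_norm // mulr1.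
  by rewrite /VV; nra.
have mWd s : nm s <= 2 * e * t -> vnm (W s) < d1 /\ vnm (W s) < d2.
  move=> /mW h; have dd1 : dd <= d1 by rewrite ge_min lexx.
  have dd2 : dd <= d2 by rewrite ge_min lexx orbT.
  by split; lra.
have linW c s : lin c (W s) = rc t * (al * c j - be * c i) + s * c i.
  by rewrite linD !linZ linv lin_evec.
pose G s := f (p + W s) - b.
have eG : entire1 G.
  apply: (entire1B (f := fun s => f (p + W s))); last exact: entire1_cst.
  move=> s; have [l Hl] := hol_slice_entire (p + rc t *: v) (evec i) hf s.
  by exists l; apply: der_ext Hl => y; rewrite /W addrA.
have GE s : nm s <= 2 * e * t -> nm (G s - s * al) <= et * (t * VV).
  move=> sb; have [w1 _] := mWd s sb; have := H1 (W s) w1.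
  rewrite linW -/al -/be fp.
  have -> : rc t * (al * be - be * al) + s * al = s * al by ring.
  by move=> /le_trans; apply; rewrite ler_wpM2l ?(ltW et0) ?mW.
(* A zero of [G] near 0 is a point of the level set, where [q = b] as well; the expansion of [q]
   then contradicts the size of [D]. *)
have [[s [sb Gs]]|nz] := pselect (exists s, nm s <= 2 * e * t /\ G s = 0).
  have fs : f (p + W s) = b by apply/eqP; rewrite -subr_eq0 -/(G s) Gs.
  have [w1 w2] := mWd s sb.
  have := H2 (W s) w2; rewrite (fq _ fs) (fq _ fp) subrr sub0r nmN linW -/D => h.
  have m := mW s sb.
  have h1 : t * nm D <= et * (t * VV) + 2 * e * t * g.
    have -> : t * nm D = nm (rc t * D) by rewrite nmM nm_rc gtr0_norm.
    have -> : rc t * D = (rc t * D + s * pd i q p) - s * pd i q p by ring.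
    apply: le_trans (nmB _ _) _; apply: lerD.
      by apply: le_trans h _; rewrite ler_wpM2l ?(ltW et0).
    by rewrite nmM ler_wpM2r.
  have h2 : et * (t * VV) + 2 * e * t * g <= t * (3 / 8 * nm D).
    have -> : et * (t * VV) + 2 * e * t * g = t * (et * VV + 2 * (e * g)) by ring.
    by rewrite ler_wpM2l ?(ltW t0) //; lra.
  have := le_trans h1 h2; rewrite ler_pM2l //; lra.
have nz' s : nm s < 2 * e * t -> G s != 0.
  by move=> sb; apply/eqP => Gs; apply: nz; exists s; split=> //; exact: ltW.
have et0' : 0 < e * t by rewrite mulr_gt0.
have hV : hol_on (2 * e * t) (fun s => (G s)^-1).
  by move=> s sb; eexists; apply: derV; [exact: nz'|exact: entire1_dv].
have n0 : nm (0 : C) = 0 := nm0 _.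
have G0 : nm (G 0) <= et * (t * VV).
  by have := GE 0; rewrite n0 mul0r subr0; apply; lra.
have low s : nm s = e * t -> nm al * (e * t) - et * (t * VV) <= nm (G s).
  move=> sb; have := GE s; rewrite sb => /(_ ltac:(lra)).
  have := nm_geB (s * al) (s * al - G s).
  have -> : s * al - (s * al - G s) = G s by ring.
  by rewrite nmM sb nm_sym (mulrC (e * t)) => h1 h2; clear - h1 h2; lra.
pose L := nm al * (e * t) - et * (t * VV); rewrite -/L in low.
have L1 : et * (t * VV) < L.
  rewrite /L; have -> : et * (t * VV) = t * (et * VV) by ring.
  have : t * (et * VV) <= t * (nm al * e / 8) by rewrite ler_wpM2l ?(ltW t0).
  have : 0 < t * (nm al * e) by exact: mulr_gt0 t0 (mulr_gt0 al0 e0).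
  lra.
have G00 : G 0 != 0 by apply: nz'; rewrite n0; lra.
have GN : 0 < nm (G 0) by rewrite nm_gt0.
have L0 : 0 < L by lra.
clearbody L; have := max_principle (w := 0) (r := e * t) (M := L^-1) hV ltac:(lra) ltac:(lra).
rewrite invr_ge0 (ltW L0) => /(_ isT).
have bnd s : nm s = e * t -> nm (G s)^-1 <= L^-1.
  move=> /low; rewrite nmV; move: (nm (G s)) => y ly.
  by rewrite lef_pV2 ?posrE ?(lt_le_trans L0 ly).
move=> /(_ bnd); rewrite nmV lef_pV2 ?posrE //; lra.
Qed.

End SeveralVariables.

(** * Differentiability in terms of real bounds *)

Section Bridge.
Variables (R : realType) (n : nat).
Local Notation C := (CC R).
Local Notation V := 'rV[C]_n.
Implicit Types (f g q : V -> C) (p z v w : V) (t s : C) (i j : 'I_n).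

Lemma gt0_rc (e : C) : 0 < e -> exists2 d : R, 0 < d & e = rc d.
Proof.
move=> e0; exists (nm e); first by rewrite nm_gt0 gt_eqF.
by rewrite -norm_rcE gtr0_norm.
Qed.

Lemma ltr_rc (x y : R) : (rc x < rc y) = (x < y).
Proof. exact: ltcR. Qed.

Lemma ler_rc (x y : R) : (rc x <= rc y) = (x <= y).
Proof. exact: lecR. Qed.

Lemma norm_rV_le (w : V) : `|w| <= rc (vnm w).
Proof.
have h0 : 0 <= rc (vnm w) by rewrite -[0]/(rc 0) ler_rc vnm_ge0.
rewrite -[`|w|]/(mx_norm w) mx_normE -[rc _]/((NngNum h0)%:num) num_le.
apply/bigmax_leP; split=> [|[k j] _]; rewrite -num_le //=.
rewrite norm_rcE ler_rc (ord1 k) /vnm (bigD1 j) //= lerDl.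
by apply: sumr_ge0 => l _; exact: nm_ge0.
Qed.

Lemma nbhs_vnm p (P : set V) : nbhs p P ->
  exists2 d : R, 0 < d & forall w, vnm w < d -> P (p + w).
Proof.
move=> /nbhs_ballP[e /= /gt0_rc[d d0 ->]] H; exists d => // w wd; apply: H; split=> [|k j]; first by rewrite -[0]/(rc 0) ltr_rc.
rewrite /ball /= mxE opprD addrA subrr add0r normrN norm_rcE ltr_rc (ord1 k).
apply: le_lt_trans wd; rewrite /vnm (bigD1 j) //= lerDl.
by apply: sumr_ge0 => l _; exact: nm_ge0.
Qed.

Lemma differentiable_approx f z : differentiable f z ->
  approx f z (fun j => 'd f z (evec R j)).
Proof.
move=> /diff_locallyP[_ /eqaddoP H] e e0.
have e0' : 0 < rc e by rewrite -[0]/(rc 0) ltr_rc.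
have [d d0 Hd] := nbhs_vnm (H _ e0').
exists d => // w /Hd; rewrite add0r /= => h.
rewrite -ler_rc -norm_rcE rcM.
have -> : lin (fun j => 'd f z (evec R j)) w = 'd f z w.
  rewrite [in RHS](row_sum_delta w) linear_sum /=.
  by apply: eq_bigr => j _; rewrite linearZ.
apply: le_trans (ler_wpM2l (ltW e0') (norm_rV_le w)).
apply: le_trans h; rewrite le_eqVlt; apply/orP; left; apply/eqP.
by rewrite !fctE /= opprD addrA (addrC w).
Qed.

Lemma entire_hol f : entire f -> hol f.
Proof. by move=> ef z; eexists; exact: differentiable_approx. Qed.

Lemma partialE f z i : entire f -> partial i f z = pd i f z.
Proof.
move=> ef; rewrite /partial deriveE; last exact: ef.
by rewrite (approx_pd i (differentiable_approx (ef z))).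
Qed.

End Bridge.

(** * Taylor expansions and multiplicities *)

Section CircleTaylor.
Variable R : realType.
Local Notation C := (CC R).
Local Notation idC := (fun z : C => z).
Implicit Types (g h : C -> C) (r : R) (z w t : C) (k : nat).

(* [z * h' z] is up to the factor ['i] the derivative of [h] along the circle. *)
Lemma mean_tangential h h' r : 0 < r -> (forall z, nm z = r -> der idC h z (h' z)) ->
  mean (fun z => z * h' z) r = 0.
Proof.
move=> r0 dh.
have dc (x : R) : der (@rc R) (circ r) x ('i%C * circ r x).
  have d1 : der (@rc R) (fun y : R => 'i%C * rc y) x ('i%C * 1).
    by apply: derZ; apply: der_em; exact: rcD.
  apply: der_eq (derZ (rc r) (der_comp (g := @cexp R) d1 (der_cexp _))).
  by rewrite /circ; ring.
have alg (i a c : C) : i * i = -1 -> - i * (a * (i * c)) = c * a.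
  move=> ii; have -> : - i * (a * (i * c)) = - (i * i) * (c * a) by ring.
  by rewrite ii opprK mul1r.
have ii : 'i%C * 'i%C = -1 :> C by rewrite -expr2 sqr_i.
rewrite /mean (@IntE _ (fun x => - 'i%C * h (circ r x))) ?twopi_ge0 //.
  by rewrite /circ cexp_2pi rc0 mulr0 cexp0 subrr mulr0.
move=> x _; have D := dh _ (nm_circ x (ltW r0)).
apply: der_eq (derZ (- 'i%C) (der_comp (dc x) D)).
exact: alg.
Qed.

Lemma ccont_pow k r : 0 < r -> ccont (fun t : C => (t ^+ k)^-1) r.
Proof.
move=> r0; apply: ccontV; last exact: ccontX (@ccont_id R r).
by move=> z zr; rewrite expf_neq0 // -nm_gt0 zr.
Qed.

Lemma ccont_entire1 g r : entire1 g -> ccont g r.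
Proof. by move=> eg z _; exact: entire1_cont. Qed.

(** The means are Taylor coefficients at 0, and the formula is an integration by parts on the
    circle. *)
Lemma coef_dv g k r : 0 < r -> entire1 g ->
  mean (fun t => dv g t / t ^+ k) r = k.+1%:R * mean (fun t => g t / t ^+ k.+1) r.
Proof.
move=> r0 eg; set K : C := k.+1%:R.
have t0 t : nm t = r -> t != 0 by move=> tr; rewrite -nm_gt0 tr.
pose h' t := (dv g t * t ^+ k.+1 - g t * (K * t ^+ k * 1)) / (t ^+ k.+1) ^+ 2.
have := @mean_tangential (fun t => g t / t ^+ k.+1) h' r r0.
have dh z : nm z = r -> der idC (fun t => g t / t ^+ k.+1) z (h' z).
  move=> zr; have z0 : z ^+ k.+1 != 0 by rewrite expf_neq0 ?t0.
  exact: (der_div (f := g) (g := fun t => t ^+ k.+1) z0 (entire1_dv z eg) (derX k.+1 (der_id z))).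
move=> /(_ dh) E.
have c1 := ccontM (ccont_entire1 (r := r) (entire1_derivative eg)) (ccont_pow k r0).
have c2 := ccontM (ccont_entire1 (r := r) eg) (ccont_pow k.+1 r0).
apply/eqP; rewrite -subr_eq0 -(meanZ (ltW r0) K c2).
rewrite -(meanB (ltW r0) c1 (ccontM (@ccont_cst R r K) c2)) -E; apply/eqP.
apply: mean_ext; first exact: ltW.
move=> t /t0 tn0; have k0 : t ^+ k != 0 by rewrite expf_neq0.
rewrite /h' (exprS t k); move: (t ^+ k) k0 => y k0; field.
by rewrite k0 tn0.
Qed.

(** Radius 2 against the point 1 gives a geometric remainder of ratio [1 / 2]. Every [z] is reached
    later as the value at [t = 1] of the slice [p + t (z - p)]. *)
Lemma taylor_remainder g M k : entire1 g -> (forall t, nm t = 2 -> nm (g t) <= M) ->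
  nm (\sum_(0 <= j < k) mean (fun t => g t / t ^+ j) 2 - g 1) <= 2 * M / 2 ^+ k.
Proof.
move=> eg gM; have r0 : 0 < 2 :> R by [].
have n1 : nm (1 : C) < 2 by rewrite nm1; lra.
have cK := ccont_kernel1 n1.
(* The remainder after [k] terms; consecutive remainders differ by one Taylor coefficient. *)
pose E k := mean (fun t => g t * (t / (t - 1)) / t ^+ k) 2.
have cE j := ccontM (ccontM (ccont_entire1 (r := 2) eg) cK) (ccont_pow j r0).
have E0 : E 0%N = g 1.
  rewrite -(cauchy_formula (@entire1_hol R g 3 eg) n1); last lra.
  by apply: mean_ext => // t _; rewrite expr0 divr1.
have ES j : mean (fun t => g t / t ^+ j) 2 = E j - E j.+1.
  rewrite /E -(meanB (ltW r0) (cE j) (cE j.+1)).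
  apply: mean_ext => // t t2.
  have tn0 : t != 0 by rewrite -nm_gt0 t2.
  have tn1 : t - 1 != 0.
    by rewrite subr_eq0; apply: contraTneq (n1) => <-; rewrite t2 ltxx.
  have k0 : t ^+ j != 0 by rewrite expf_neq0.
  rewrite (exprS t j); move: (t ^+ j) k0 => y k0; field.
  by rewrite k0 tn1 tn0.
have -> : \sum_(0 <= j < k) mean (fun t => g t / t ^+ j) 2 = g 1 - E k.
  elim: k => [|k IH]; first by rewrite big_geq // E0 subrr.
  by rewrite big_nat_recr //= IH ES addrA subrK.
rewrite addrAC subrr add0r nmN; apply: mean_bound => // t t2.
rewrite nmM nmV nmX t2 -ler_pdivlMr ?invr_gt0 ?exprn_gt0 // mulfK ?gt_eqF ?exprn_gt0 //.
rewrite nmM mulrC; apply: ler_pM; rewrite ?nm_ge0 ?gM //.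
have := nm_kernel1 n1 t2; have -> : 2 - nm (1 : C) = 1 by rewrite nm1; lra.
by rewrite divr1.
Qed.

End CircleTaylor.

Section Multiplicity.
Variables (R : realType) (n : nat).
Local Notation C := (CC R).
Local Notation V := 'rV[C]_n.
Implicit Types (f g q : V -> C) (p z v w : V) (t s b : C) (i j : 'I_n) (k : nat).

(* The homogeneous part of degree [k] of the Taylor expansion of [f] at [p]. *)
Fixpoint hpoly k f p : mpoly n C :=
  if k is k'.+1 then
    (k%:R : C)^-1 *: \sum_j mpolyX C (mnm1 j) * hpoly k' (pd j f) p
  else mpolyC n (f p).

Lemma hpoly_homog k f p : hpoly k f p \is ishomog1 k mdeg.
Proof.
elim: k f => [|k IH] f /=.
  by rewrite -[mpolyC n _]mulr1 mul_mpolyC; apply: dhomogZ; exact: dhomog1.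
apply: dhomogZ; apply: rpred_sum => j _; rewrite -add1n; apply: dhomogM => //.
by rewrite dhomogX; apply/eqP; exact: mdeg1.
Qed.

(** The recursion of [hpoly] is Euler's relation for homogeneous polynomials; on the slice
    [t -> f (p + t w)] it becomes [coef_dv]. *)
Lemma hpoly_eval k f p w : hol f ->
  mpoly_eval (hpoly k f p) w = mean (fun t => f (p + t *: w) / t ^+ k) 2.
Proof.
have r0 : 0 < 2 :> R by [].
have n0 : nm (0 : C) < 2 by rewrite nm0.
elim: k f => [|k IH] f hf; have eg := hol_slice_entire p w hf.
  rewrite /mpoly_eval /= mevalC.
  have := cauchy_formula (@entire1_hol R _ 3 eg) n0; rewrite scale0r addr0 => <-; last lra.
  apply: mean_ext => // t t2; have t0 : t != 0 by rewrite -nm_gt0 t2.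
  by rewrite subr0 divff // expr0 divr1 mulr1.
have c j := ccontM (ccont_entire1 (r := 2) (hol_slice_entire p w (hol_pd j hf))) (ccont_pow k r0).
have k0 : (k.+1%:R : C) != 0 by rewrite pnatr_eq0.
apply: (mulfI k0); rewrite -(coef_dv k r0 eg) /mpoly_eval /= mevalZ mulrA divff // mul1r.
rewrite raddf_sum /= -[RHS](_ :
  mean (fun t => lin (fun j => pd j f (p + t *: w) / t ^+ k) w) 2 = _).
  rewrite (mean_lin c w (ltW r0)); apply: eq_bigr => j _.
  by rewrite mevalM mevalXU -/(mpoly_eval _ w) IH //; exact: hol_pd.
apply: mean_ext => // t t2; rewrite (dvE (hol_slice p w t hf)) /lin mulr_suml.
by apply: eq_bigr => j _; rewrite mulrA.
Qed.

Lemma hol_expansion f p : hol f -> homogeneous_expansion f p (fun k => hpoly k f p).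
Proof.
move=> hf; split=> [k|]; first exact: hpoly_homog.
apply: (@nearW _ (nbhs p)) => z; apply/cvgrPdist_lt => e /gt0_rc[d d0 ->].
pose g t := f (p + t *: (z - p)).
have eg : entire1 g := hol_slice_entire p (z - p) hf.
have [M M0 gM] := ccont_bounded (r := 2) ltac:(lra) (ccont_entire1 (r := 2) eg).
have [N HN] := pow2_unbounded (2 * M / d).
exists N => // k /= kN; rewrite norm_rcE ltr_rc nm_sym.
have -> : f z = g 1 by rewrite /g scale1r addrC subrK.
have -> : series (fun k => mpoly_eval (hpoly k f p) (z - p)) k =
    \sum_(0 <= j < k) mean (fun t => g t / t ^+ j) 2.
  by rewrite /series /=; apply: eq_bigr => j _; rewrite hpoly_eval.
apply: le_lt_trans (taylor_remainder k eg gM) _.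
rewrite ltr_pdivrMr ?exprn_gt0 // (mulrC d) -ltr_pdivrMr //.
apply: lt_le_trans HN _; rewrite ler_weXn2l //; lra.
Qed.

Lemma simple_of_gradient f p i : hol f -> f p = 0 -> pd i f p != 0 ->
  zero_multiplicity f p 1.
Proof.
move=> hf fp fi; exists (fun k => hpoly k f p); split.
- exact: hol_expansion.
- apply: contraNneq fi => P0; have : mpoly_eval (hpoly 1 f p) (evec R i) = 0.
    by rewrite P0 /mpoly_eval meval0.
  rewrite /mpoly_eval /= mevalZ invr1 mul1r raddf_sum /= => E.
  apply/eqP; rewrite -(lin_evec (fun j => pd j f p) i); apply: etrans E.
  by apply: eq_bigr => j _; rewrite mevalM mevalXU mevalC.
- by case=> //= _; rewrite fp mpolyC0.
Qed.

Lemma mpoly_eval_homog (P : mpoly n C) k t v : P \is ishomog1 k mdeg ->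
  mpoly_eval P (t *: v) = t ^+ k * mpoly_eval P v.
Proof.
move=> /dhomogP hP; rewrite /mpoly_eval !mevalE mulr_sumr.
rewrite [LHS]big_seq [RHS]big_seq; apply: eq_bigr => m /hP mk.
have <- : mdeg m = k by exact: mk.
rewrite mulrCA; congr (_ * _); rewrite mdegE -prodrXr -big_split /=.
by apply: eq_bigr => j _; rewrite mxE exprMn.
Qed.

Lemma linear_form_neq0 (P : mpoly n C) : P \is ishomog1 1 mdeg -> P != 0 ->
  exists j, mpoly_eval P (evec R j) != 0.
Proof.
move=> /dhomogP hP; rewrite -msupp_eq0.
case E : (msupp P) => [//|m l] _; have mP : m \in msupp P by rewrite E mem_head.
have /eqP/mdeg1P[j /eqP mj] := hP m mP; exists j.
have other m' : m' \in msupp P -> m' != m ->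
    mcoeff m' P * \prod_(i < n) evec R j 0 i ^+ m' i = 0.
  move=> m'P; have /eqP/mdeg1P[j' /eqP ->] := hP m' m'P; rewrite mj => jj.
  rewrite (bigD1 j') //= mxE mnm1E !eqxx /= expr1.
  have /negbTE -> : j' != j by apply: contraNneq jj => ->.
  by rewrite mul0r mulr0.
rewrite /mpoly_eval mevalE (bigD1_seq m) ?msupp_uniq //= [X in _ + X](_ : _ = 0).
  rewrite addr0 mulf_neq0 -?mcoeff_msupp //; apply/prodf_neq0 => i _.
  rewrite mj mnm1E mxE eqxx /= (eq_sym i).
  by case: (j == i); rewrite ?expr0 ?expr1 oner_eq0.
rewrite big_seq_cond; apply: big1 => m' /andP[m'P m'm]; exact: other.
Qed.

End Multiplicity.

(** * The linear term of an arbitrary expansion *)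

Section LinearCoefficient.
Variables (R : realType) (c : nat -> CC R) (g : CC R -> CC R) (d : R).
Hypotheses (d0 : 0 < d) (c0 : c 0%N = 0) (g0 : g 0 = 0)
  (der_g : der (fun z : CC R => z) g 0 0).
Let S k t := \sum_(0 <= j < k) c j * t ^+ j.
Hypothesis cvg_g : forall t, nm t < d -> forall e : R, 0 < e ->
  exists N, forall k, (N <= k)%N -> nm (g t - S k t) < e.

Let SS k t : S k.+1 t = S k t + c k * t ^+ k.
Proof. by rewrite /S big_nat_recr. Qed.

(** A multiplicity is witnessed by an unspecified expansion, so its linear term has to be identified
    from convergence alone: the terms of degree at least 2 add up to [O (t ^ 2)]. *)
Lemma linear_coefficient_eq0 : c 1%N = 0.
Proof.
have d0' := d0; have d2 : 0 < d / 2 by lra.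
have nmd (s : R) : 0 < s -> nm (rc (s * (d / 2)) : CC R) = s * (d / 2).
  by move=> s0; rewrite nm_rc gtr0_norm // mulr_gt0.
have [|N HN] := cvg_g (t := rc (d / 2)) _ ltr01; first by rewrite nm_rc gtr0_norm //; lra.
pose a k := nm (c k) * (d / 2) ^+ k.
have aE k : a k = nm (c k * rc (d / 2) ^+ k) by rewrite nmM nmX nm_rc gtr0_norm.
have a0 k : 0 <= a k by rewrite aE nm_ge0.
(* From rank [N] on, terms at [d / 2] are differences of partial sums within 1 of the limit; the sum
   takes care of the earlier ones. *)
pose B := 2 + \sum_(0 <= k < N) a k.
have aB k : a k <= B.
  have s0 l : 0 <= \sum_(0 <= k < l) a k by apply: sumr_ge0.
  have [kN|Nk] := ltnP k N.
    rewrite /B big_mkord (bigD1 (Ordinal kN)) //= addrCA lerDl.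
    by rewrite addr_ge0 // sumr_ge0.
  rewrite aE; have h1 := HN k Nk; have h2 := HN k.+1 (leqW Nk); have h3 := s0 N.
  have -> : c k * rc (d / 2) ^+ k = (g (rc (d / 2)) - S k (rc (d / 2)))
     - (g (rc (d / 2)) - S k.+1 (rc (d / 2))) by rewrite SS; ring.
  apply: le_trans (nmB _ _) _; rewrite /B; lra.
have B0 : 0 < B by rewrite /B ltr_pwDl // sumr_ge0.
clearbody B.
have quad (s : R) : 0 < s -> s <= 1 / 2 ->
    nm (g (rc (s * (d / 2))) - c 1%N * rc (s * (d / 2))) <= 2 * B * s ^+ 2.
  move=> s0 s2; set t := rc (s * (d / 2)).
  have term k : nm (c k * t ^+ k) <= B * s ^+ k.
    rewrite nmM nmX nmd // exprMn mulrCA mulrC ler_wpM2r ?exprn_ge0 ?(ltW s0) //.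
    exact: aB.
  (* The subtracted term makes the geometric estimate inductive, as [s <= 1 / 2]. *)
  have part k : nm (S k.+2 t - c 1%N * t) <= 2 * B * s ^+ 2 - 2 * B * s ^+ k.+2.
    elim: k => [|k IH].
      rewrite !SS /S big_geq // c0 mul0r addr0 add0r expr1 subrr nm0 subrr //.
    rewrite SS addrAC; apply: le_trans (nmD _ _) _.
    have h1 := term k.+2; rewrite [s ^+ k.+3]exprS.
    have p0 : 0 <= B * s ^+ k.+2 by rewrite mulr_ge0 ?exprn_ge0 ?ltW.
    have : s * (B * s ^+ k.+2) <= 1 / 2 * (B * s ^+ k.+2) by rewrite ler_wpM2r.
    move: (s ^+ k.+2) h1 p0 IH => y h1 p0 IH; nra.
  rewrite leNgt; apply/negP => lt.
  have td : nm t < d by rewrite nmd //; nra.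
  have [|K HK] := cvg_g td (e := nm (g t - c 1%N * t) - 2 * B * s ^+ 2).
    by rewrite subr_gt0.
  have h1 := HK K.+2 (leqW (leqW (leqnn K))); have h2 := part K.
  have h3 : 0 <= 2 * B * s ^+ K.+2 by rewrite mulr_ge0 ?exprn_ge0 ?ltW ?mulr_gt0.
  have E : g t - c 1%N * t = (g t - S K.+2 t) + (S K.+2 t - c 1%N * t) by ring.
  have := nmD (g t - S K.+2 t) (S K.+2 t - c 1%N * t); rewrite -E; lra.
apply/eqP; rewrite -nm_eq0E eq_le nm_ge0 andbT leNgt; apply/negP => c1.
set L := nm (c 1%N) in c1.
have L4 : 0 < L / 4 by lra.
have [d1 d10 Hd1] := der_g L4.
pose s := Num.min (1 / 2) (Num.min (d1 / d) (L * d / (32 * B))).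
have s0 : 0 < s.
  rewrite !lt_min; apply/and3P; split; first by lra.
    exact: divr_gt0.
  by apply: divr_gt0; rewrite mulr_gt0.
have s2 : s <= 1 / 2 by rewrite ge_min lexx.
have sd : s * d <= d1.
  by rewrite -ler_pdivlMr // !ge_min lexx !orbT.
have sB : s * (32 * B) <= L * d.
  by rewrite -ler_pdivlMr ?mulr_gt0 // !ge_min lexx !orbT.
have sd0 : 0 < s * d by rewrite mulr_gt0.
have h1 := Hd1 (rc (s * (d / 2))); rewrite nmd // add0r g0 mulr0 !subr0 in h1.
have {}h1 := h1 ltac:(lra); have h2 := quad s s0 s2.
have : L * (s * (d / 2)) <= L / 4 * (s * (d / 2)) + 2 * B * s ^+ 2.
  have -> : L * (s * (d / 2)) = nm (c 1%N * rc (s * (d / 2))) by rewrite nmM nmd.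
  have := nm_geB (c 1%N * rc (s * (d / 2))) (g (rc (s * (d / 2)))).
  rewrite nm_sym; lra.
have : s * (s * (32 * B)) <= s * (L * d) by rewrite ler_wpM2l ?(ltW s0).
have : 0 < L * (s * d) by rewrite mulr_gt0.
rewrite expr2; nra.
Qed.

End LinearCoefficient.

Section Gradient.
Variables (R : realType) (n : nat).
Local Notation V := 'rV[CC R]_n.

(** A nonzero linear part does not vanish on some basis vector, and on that axis it is the
    derivative. *)
Lemma gradient_of_simple (q : V -> CC R) (p : V) : hol q -> q p = 0 ->
  zero_multiplicity q p 1 -> exists j, pd j q p != 0.
Proof.
move=> hq qp [P [[hP /nbhs_vnm[d d0 Hd]] P1 P0]].
have [j cj] := linear_form_neq0 (hP 1%N) P1.
exists j; apply: contraNneq cj => pj.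
pose c k := mpoly_eval (P k) (evec R j).
apply/eqP; apply: (@linear_coefficient_eq0 R c (fun t => q (p + t *: evec R j)) d) => //.
- by rewrite /c (P0 0%N) // /mpoly_eval meval0.
- by rewrite scale0r addr0.
- apply: der_eq (hol_slice p (evec R j) 0 hq).
  by rewrite lin_evec scale0r addr0.
- move=> t td e e0; have := Hd (t *: evec R j).
  rewrite vnmZ vnm_evec mulr1 => /(_ td) /cvgrPdist_lt /(_ (rc e)).
  rewrite -[0 < rc e]/(rc 0 < rc e) ltr_rc => /(_ e0) [N _ HN].
  exists N => k kN; have := HN k kN; rewrite norm_rcE ltr_rc.
  congr (nm (_ - _) < _); rewrite /series /=; apply: eq_bigr => l _.
  have -> : p + t *: evec R j - p = t *: evec R j by rewrite addrAC subrr add0r.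
  by rewrite (mpoly_eval_homog _ _ (hP l)) mulrC.
Qed.

End Gradient.

(** * From lines to the whole space *)

Section LinearEquation.
Variable R : realType.
Local Notation C := (CC R).
Local Notation idC := (fun z : C => z).
Implicit Types (g : C -> C) (a b s t x y : C).

Lemma der_cexpM g y d : der idC g y d -> der idC (fun t => cexp (g t)) y (cexp (g y) * d).
Proof. by move=> dg; apply: (der_comp (g := @cexp R)) dg (der_cexp _). Qed.

Lemma linear_equation g a b s : a != 0 ->
  (forall t, der idC g t (s * (a * g t + b))) ->
  forall t, g t = (g 0 + b / a) * cexp (s * a * t) - b / a.
Proof.
move=> a0 dg t.
pose H t := (g t + b / a) * cexp (- (s * a) * t).
have dH x : der idC H x 0.
  have d1 : der idC (fun t => cexp (- (s * a) * t)) x (cexp (- (s * a) * x) * (- (s * a) * 1)).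
    by apply: (der_cexpM (g := fun t => - (s * a) * t)); exact: derZ (der_id x).
  have d2 := derD (dg x) (der_const _ (b / a) x).
  apply: der_eq (derM d2 d1); move: (cexp _) => E; field => //.
have eH : entire1 H by move=> x; exists 0.
have Hc : H t = H 0 by apply: (dv_eq0_const eH) => x; exact: dvE.
have E : cexp (- (s * a) * t) * cexp (s * a * t) = 1 by rewrite -cexpD mulNr addNr cexp0.
have -> : g 0 + b / a = H 0 by rewrite /H mulr0 cexp0 mulr1.
by rewrite -Hc /H -mulrA E mulr1 addrK.
Qed.

End LinearEquation.

(** * The equations in the plane of two axes *)

Section Plane.
Variable R : realType.
Local Notation C := (CC R).
Local Notation idC := (fun z : C => z).
Variables (F : C -> C -> C) (p q : C -> C) (b : C).
Hypotheses (b0 : b != 0) (p0 : forall y, p y != 0)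
  (Fx : forall x y, der idC (fun x => F x y) x (p y * F x y + b))
  (Fy : forall x y, der idC (F x) y (q x * F x y + b))
  (eFx : forall x, entire1 (fun y => p y * F x y + b))
  (crit : forall x y, p y * F x y + b = 0 -> F x y = - b).

Let solution x y : F x y = (F 0 y + b / p y) * cexp (p y * x) - b / p y.
Proof.
have := @linear_equation R (fun x => F x y) (p y) b 1 (p0 y).
rewrite mul1r; apply => t; rewrite mul1r; exact: Fx.
Qed.

(** Where [F x] does not vanish, [p] is a quotient of entire functions of [y]. Such an [x] exists
    for each [y], since [F = 0] along a line would give [b = 0]. *)
Let entire_p : entire1 p.
Proof.
move=> y.
have [x Fxy] : exists x, F x y != 0.
  apply: contrapT => H; have F0 x : F x y = 0.
    by apply/eqP/negPn/negP => Fxy; apply: H; exists x.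
  have d0 : der idC (fun x => F x y) 0 0.
    by apply: (der_ext (f := fun=> 0)) (der_const _ 0 0) => x; rewrite F0.
  have := der_uniq d0 (Fx 0 y); rewrite F0 mulr0 add0r => /esym/eqP.
  by rewrite (negbTE b0).
have eF : entire1 (F x) by move=> u; eexists; exact: Fy.
have eN := entire1B (eFx x) (entire1_cst b).
have n0 : 0 < nm (F x y) by rewrite nm_gt0.
eexists; refine (der_near (g := p) _ _ (der_div Fxy (entire1_dv y eN) (entire1_dv y eF))).
  by rewrite addrK mulfK.
apply: nr_mono (entire1_cont y eF n0) => k hk; rewrite addrK mulfK //.
by apply: contraTneq hk => ->; rewrite sub0r nmN ltxx.
Qed.

(* [F x y = K y * cexp (p y * x) - b / p y]. Where [K] does not vanish, [F] has zeros
   [x] differing by [2 i pi / p y], and comparing the two values of [Fy] there gives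
   [dv p y = 0]; where [K] vanishes, [crit] gives [p y = 1]. *)
Lemma plane_factor_const y : p y = p 0.
Proof.
have alt u : dv p u * (p u - 1) = 0.
  set D := dv p u; set P := p u.
  have P0 : P != 0 := p0 u.
  set K := F 0 u + b / P.
  have [K0|K0] := eqVneq K 0.
    have FE : F 0 u = - (b / P) by apply/eqP; rewrite -addr_eq0 -/K K0.
    have Fb : F 0 u = - b.
      by apply: crit; rewrite -/P FE mulrN mulrCA divff // mulr1 addNr.
    have /oppr_inj/eqP : - (b / P) = - b by rewrite -FE.
    rewrite -subr_eq0 => /eqP E.
    have -> : P - 1 = - (P / b) * (b / P - b) by field; rewrite b0 P0.
    by rewrite E !mulr0.
  have dp := entire1_dv u entire_p; rewrite -/D in dp.
  have dF x : der idC (F x) u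
      ((q 0 * F 0 u + b - b * D / P ^+ 2 ) * cexp (P * x) + K * (cexp (P * x) * (x * D))
        + b * D / P ^+ 2).
    have d1 : der idC (fun y => b / p y) u (- (b * D / P ^+ 2)).
      by apply: der_eq (der_div P0 (der_const _ b u) dp); rewrite mul0r sub0r mulNr.
    have d2 : der idC (fun y => cexp (p y * x)) u (cexp (P * x) * (x * D)).
      apply: (der_cexpM (g := fun y => p y * x)).
      by apply: der_ext (derZ x dp) => t; rewrite mulrC.
    apply: (der_ext (f := fun y => (F 0 y + b / p y) * cexp (p y * x) - b / p y)).
      by move=> t; rewrite [RHS]solution.
    apply: der_eq (derB (derM (derD (Fy 0 u) d1) d2) d1).
    by rewrite opprK.
  set L := q 0 * F 0 u + b - b * D / P ^+ 2 in dF.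
  (* At a zero [x] of [F] the unknown [q x] drops out of [Fy]: the derivative in [y] is [b]. *)
  have key x : K * cexp (P * x) = b / P ->
      b = L * cexp (P * x) + (b / P) * (x * D) + b * D / P ^+ 2.
    move=> Kx; have Fx0 : F x u = 0 by rewrite solution -/P -/K Kx subrr.
    have := der_uniq (Fy x u) (dF x); rewrite Fx0 mulr0 add0r => {1}->.
    by rewrite mulrA Kx.
  have bPK : b / P / K != 0 by rewrite !mulf_neq0 // invr_neq0.
  have [v Ev] := cexp_surj bPK.
  pose w : C := 'i%C * rc (2 * pi).
  have w0 : w != 0 by rewrite mulf_neq0 ?rc2pi_neq0 // -nm_gt0 nm_i.
  have E1 : P * (v / P) = v by rewrite mulrC divfK.
  have E2 : P * ((v + w) / P) = v + w by rewrite mulrC divfK.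
  have e2 : cexp (v + w) = cexp v by rewrite cexpD cexp_2pi mulr1.
  have k1 := key (v / P); have k2 := key ((v + w) / P).
  rewrite E1 Ev in k1; rewrite E2 e2 Ev in k2.
  have KE : K * (b / P / K) = b / P by rewrite mulrC divfK.
  have {}k1 := k1 KE; have {}k2 := k2 KE.
  have E : b / P * (w / P) * D = 0.
    have : b - b = (L * (b / P / K) + (b / P) * ((v + w) / P * D) + b * D / P ^+ 2)
       - (L * (b / P / K) + (b / P) * (v / P * D) + b * D / P ^+ 2) by rewrite -k1 -k2.
    rewrite subrr => /esym <-.
    by rewrite (mulrDl v w); ring.
  clearbody w; move/eqP: E; rewrite !mulf_eq0 !invr_eq0 (negbTE b0) (negbTE P0) (negbTE w0) /=.
  by move=> /eqP ->; rewrite mul0r.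
have eD := entire1_derivative entire_p; have e1 := entire1B entire_p (entire1_cst 1).
case: (entire1_mul_eq0 eD e1 alt) => H; first exact: (dv_eq0_const entire_p).
by have [/eqP h1 /eqP h2] := (H y, H 0); move: h1 h2; rewrite !subr_eq0 => /eqP -> /eqP ->.
Qed.

(** For [x] with [cexp (P * x) = 2] one has [F x y = 2 * F 0 y + b / P]; deriving both sides in [y]
    by [Fy] leaves [b / P * (P - Q) = 0]. *)
Lemma plane_factors_eq : (forall x, q x = q 0) -> p 0 = q 0.
Proof.
move=> qc; have two : (2 : C) != 0 by rewrite pnatr_eq0.
have [v Ev] := cexp_surj two.
set P := p 0; set Q := q 0; have P0 : P != 0 := p0 0.
pose x := v / P; have Ex : cexp (P * x) = 2 by rewrite mulrC divfK.
have FE y : F x y = (F 0 y + b / P) * 2 - b / P.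
  by rewrite solution plane_factor_const -/P Ex.
have d1 : der idC (F x) 0 (2 * (Q * F 0 0 + b)).
  apply: (der_ext (f := fun y => 2 * F 0 y + b / P)).
    by move=> y; rewrite FE; ring.
  by apply: der_eq (derD (derZ 2 (Fy 0 0)) (der_const _ (b / P) 0)); rewrite addr0.
have := der_uniq d1 (Fy x 0); rewrite qc -/Q FE => E.
have : b / P * (P - Q) = 0.
  have -> : b / P * (P - Q) = 2 * (Q * F 0 0 + b) - (Q * ((F 0 0 + b / P) * 2 - b / P) + b).
    by field.
  by rewrite E subrr.
move/eqP; rewrite !mulf_eq0 invr_eq0 (negbTE b0) (negbTE P0) /= subr_eq0.
by move/eqP.
Qed.

End Plane.

Section Gluing.
Variables (R : realType) (n : nat).
Local Notation C := (CC R).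
Local Notation idC := (fun z : C => z).
Local Notation V := 'rV[C]_n.
Variables (f : V -> C) (b : C).
Hypotheses (hf : hol f) (b0 : b != 0)
  (crit : forall i z, pd i f z = 0 -> f z = 0)
  (share : forall i z, f z = b <-> pd i f z = b)
  (mult : forall i z, f z = b -> zero_multiplicity (fun w => f w - b) z 1 ->
     zero_multiplicity (fun w => pd i f w - b) z 1).
Implicit Types (p z w v : V) (s t x y : C) (i j : 'I_n).

Lemma hol_line i z t : der idC (fun s => f (z + s *: evec R i)) t (pd i f (z + t *: evec R i)).
Proof. by apply: der_eq (hol_slice z (evec R i) t hf); rewrite lin_evec. Qed.

Lemma simple_on_lines i p : f p = b -> pd i (pd i f) p != 0.
Proof.
move=> fp; have fb : pd i f p = b by apply/share.
have hc := hol_cst (n := n) b.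
have m1 : zero_multiplicity (fun w => f w - b) p 1.
  apply: (simple_of_gradient (i := i)); first exact: holB.
    by rewrite fp subrr.
  by rewrite pd_subc fb.
have [|j] := gradient_of_simple (holB (hol_pd i hf) hc) _ (mult i fp m1).
  by rewrite fb subrr.
rewrite pd_subc => qj; have fi0 : pd i f p != 0 by rewrite fb.
have sh z : f z = b -> pd i f z = b by move=> /share.
have := tangent_to_level_set j hf (hol_pd i hf) sh fp fi0.
by move=> E; apply: contraNneq (mulf_neq0 fi0 qj) => h; rewrite E h mulr0.
Qed.

Lemma line_factor i z : exists2 A, A != 0 &
  forall t, pd i f (z + t *: evec R i) = A * (f (z + t *: evec R i) - b) + b.
Proof.
pose g t := f (z + t *: evec R i).
have dg t : dv g t = pd i f (z + t *: evec R i) by exact: dvE (hol_line i z t).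
have [||||A A0 HA] := @line_equation R g b b0.
- exact: hol_slice_entire.
- by move=> t; rewrite dg => /crit.
- by move=> t; rewrite dg; exact: share.
- move=> t gt; have -> : dv g = fun t => pd i f (z + t *: evec R i) by apply/funext.
  rewrite (dvE (hol_slice z (evec R i) t (hol_pd i hf))) lin_evec.
  exact: simple_on_lines.
by exists A => // t; rewrite -HA dg subrK.
Qed.

Lemma factor_exists : exists A : 'I_n -> V -> C, forall i z, A i z != 0 /\
  forall t, pd i f (z + t *: evec R i) = A i z * (f (z + t *: evec R i) - b) + b.
Proof.
have H (iz : 'I_n * V) : exists A, A != 0 /\
    forall t, pd iz.1 f (iz.2 + t *: evec R iz.1) = A * (f (iz.2 + t *: evec R iz.1) - b) + b.
  by have [A A0 HA] := line_factor iz.1 iz.2; exists A.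
by have [A HA] := choice H; exists (fun i z => A (i, z)) => i z; exact: HA (i, z).
Qed.

Section Factor.
Variable A : 'I_n -> V -> C.
Hypotheses (A0 : forall i z, A i z != 0)
  (HA : forall i z t, pd i f (z + t *: evec R i) = A i z * (f (z + t *: evec R i) - b) + b).

(** The case [i = j] is included; through [factor_line] it allows moving along the axis of the
    factor itself. *)
Lemma factor_plane i j z (F := fun x y => f (z + x *: evec R i + y *: evec R j) - b)
    (p := fun y => A i (z + y *: evec R j)) (q := fun x => A j (z + x *: evec R i)) :
  [/\ forall x y, der idC (fun x => F x y) x (p y * F x y + b),
      forall x y, der idC (F x) y (q x * F x y + b),
      forall x, entire1 (fun y => p y * F x y + b) &
      forall x y, p y * F x y + b = 0 -> F x y = - b].
Proof.
have comm x y : z + x *: evec R i + y *: evec R j = z + y *: evec R j + x *: evec R i.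
  by rewrite addrAC.
have pE x y : p y * F x y + b = pd i f (z + x *: evec R i + y *: evec R j).
  by rewrite /p /F comm HA.
split=> [x y|x y|x|x y].
- rewrite pE comm; have := derB (hol_line i (z + y *: evec R j) x) (der_const _ b x).
  by rewrite subr0; apply: der_ext => s; rewrite /F comm.
- rewrite /q /F -HA; have := derB (hol_line j (z + x *: evec R i) y) (der_const _ b y).
  by rewrite subr0.
- move=> y; have [l Hl] := hol_slice_entire (z + x *: evec R i) (evec R j) (hol_pd i hf) y.
  by exists l; apply: der_ext Hl => s; rewrite pE.
- by rewrite pE => /crit E; rewrite /F E sub0r.
Qed.

Lemma factor_line i j z y : A i (z + y *: evec R j) = A i z.
Proof.
have [h1 h2 h3 h4] := factor_plane i j z.
have := plane_factor_const b0 (fun y => A0 i _) h1 h2 h3 h4 y.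
by rewrite scale0r addr0.
Qed.

Lemma factor_sym i j z : A i z = A j z.
Proof.
have [h1 h2 h3 h4] := factor_plane i j z.
have := plane_factors_eq b0 (fun y => A0 i _) h1 h2 h3 h4.
rewrite !scale0r !addr0; apply => x; exact: factor_line.
Qed.

Lemma factor_cst i j z : A i z = A j 0.
Proof.
rewrite (factor_sym i j) (row_sum_delta z); elim: (index_enum _) => [|k l IH].
  by rewrite big_nil.
by rewrite big_cons addrC -[delta_mx _ _]/(evec R k) factor_line.
Qed.

(** On the ray through [z] all partial derivatives are [a (f - b) + b], so the restriction of
    [f - b] solves a linear equation whose factor is the sum of the coordinates. *)
Lemma exponential_form i z :
  f z = (f 0 - b + b / A i 0) * cexp (A i 0 * \sum_j z 0 j) + b - b / A i 0.
Proof.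
set a := A i 0; pose g t := f (0 + t *: z) - b.
pose s : C := \sum_j z 0 j.
have dg t : der idC g t (s * (a * g t + b)).
  apply: der_eq (derB (hol_slice 0 z t hf) (der_const _ b t)).
  rewrite subr0 /lin /s mulr_suml; apply: eq_bigr => j _; congr (_ * _).
  by have := HA j (0 + t *: z) 0; rewrite scale0r addr0 (factor_cst j i).
have := linear_equation (A0 i 0) dg 1; rewrite -/a /g scale0r scale1r !add0r mulr1.
by rewrite [a * _]mulrC -/s => /(canRL (subrK b)) ->; rewrite addrAC.
Qed.

End Factor.

Theorem exponential_solution : (0 < n)%N -> exists A c, A != 0 /\
  forall z, f z = c * cexp (A * \sum_j z 0 j) + b - b / A.
Proof.
move=> n0; have [A HA] := factor_exists; pose i := Ordinal n0.
exists (A i 0), (f 0 - b + b / A i 0); split; first by have [] := HA i 0.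
move=> z; apply: exponential_form => j w; have [h1 h2] := HA j w => //.
Qed.

End Gluing.

Theorem theorem1p3 (R : realType) (n : nat) (hn : (1 <= n)%N)
    (f : 'rV[CC R]_n -> CC R) (b : CC R)
    (f_entire : entire f) (f_transc : transcendental f) (b_neq0 : b != 0)
    (h1 : forall (i : 'I_n) (z : 'rV[CC R]_n), partial i f z = 0 -> f z = 0)
    (h2 : forall i : 'I_n, share_CM f (partial i f) b) :
  (exists c : CC R, c != 0 /\
     forall z : 'rV[CC R]_n, f z = c * cexp (\sum_(i < n) z 0 i))
  \/
  (exists A c : CC R, [/\ A != 0, c != 0 &
     forall z : 'rV[CC R]_n,
       f z = c / A * cexp (A * \sum_(i < n) z 0 i) + b - b / A]).
Proof.
have pdE i : partial i f = pd i f by apply/funext => z; exact: partialE.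
right.
have [|i z|i z fz|A [c [A0 E]]] := exponential_solution (entire_hol f_entire) b_neq0 _ _ _ hn.
- by move=> i z; rewrite -pdE; exact: h1.
- by rewrite -pdE; have [h _] := h2 i; exact: h.
- by have [_ h] := h2 i; have [h' _] := h z fz 1%N; rewrite -pdE.
exists A, (A * c); split=> [//||z]; last by rewrite E (mulrC A c) mulfK.
rewrite mulf_neq0 //; apply: contra_notN f_transc => /eqP c0.
by exists (mpolyC n (b - b / A)) => z; rewrite E c0 mul0r add0r /mpoly_eval mevalC.
Qed.
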